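(* Let $d\in\mathbb{N}$, $L>0$, $q\in[1,\infty)$, let $\Phi=\{\phi_\omega\mid\omega\in\Omega\}$ with finite subsets $\Omega_n\subset\Omega$ be a dictionary satisfying Assumption A (see context), and suppose that the data follow the white noise model $dY(x)=f(x)\,dx+\frac{\sigma}{\sqrt n}\,dW(x)$ on $\mathbb{T}^d$ with $f\in BV_L$. Let $$\gamma_n=\kappa\,\sigma\sqrt{\frac{2\log \#\Omega_n}{n}},$$ and let $\hat f_\Phi$ be the frame-constrained TV-estimator with parameter $\gamma_n$. (a) If $\kappa>1$, then there is a constant $C>0$ independent of $n$ such that for every $n\in\mathbb{N}$ with $n\ge e^{L}$, $$\sup_{f\in BV_L}\|\hat f_\Phi-f\|_{L^q}\le C\,n^{-\min\{\frac1{d+2},\frac1{dq}\}}\,(\log n)^{3-\min\{d,2\}}$$ with probability at least $1-(\#\Omega_n)^{1-\kappa^2}$. (b) If, in addition, $\kappa^2>1+\frac{1}{(d+2)\Gamma}$ with $\Gamma$ the constant from Assumption A, then there is a constant $C>0$ independent of $n$ such that for all $n$ large enough $$\sup_{f\in BV_L}\mathbb{E}\big[\|\hat f_\Phi-f\|_{L^q}\big]\le C\,n^{-\min\{\frac1{d+2},\frac1{dq}\}}\,(\log n)^{3-\min\{d,2\}}.$$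
   Context: All functions are real-valued and $1$-periodic, i.e. defined on $\mathbb{T}^d=\mathbb{R}^d/\mathbb{Z}^d\simeq[0,1)^d$; $L^q=L^q(\mathbb{T}^d)$, $\langle\cdot,\cdot\rangle$ is the $L^2$ inner product. Throughout $n\ge2$. $dW$ is standard Gaussian white noise on $L^2(\mathbb{T}^d)$ and $\sigma>0$ is known. Bounded variation: $|g|_{BV}=\sup\{\int_{\mathbb{T}^d}g\,\mathrm{div}(h)\,dx\mid h\in C^1(\mathbb{T}^d;\mathbb{R}^d),\ \|h\|_{L^\infty}\le1\}$; $BV$ is the space of $g\in L^1$ with $|g|_{BV}<\infty$ (equivalently the weak gradient is a finite $\mathbb{R}^d$-valued Radon measure), and $\|g\|_{BV}=\|g\|_{L^1}+|g|_{BV}$. Set $BV_L=\{g\in BV\cap L^\infty\mid \|g\|_{L^\infty}\le L,\ |g|_{BV}\le L\}$. Besov norm: let $\{\psi_{j,k,e}\}$ be an $S$-regular periodized tensor-product orthonormal wavelet basis of $L^2(\mathbb{T}^d)$ with $S>\max\{1,d/2\}$, where $j\ge0$, $k\in P_j^d=\{0,\dots,2^j-1\}^d$, $e\in E_j$, $E_0=\{0,1\}^d$, $E_j=\{0,1\}^d\setminus\{0\}$ for $j\ge1$. Then $\|g\|_{B^{-d/2}_{\infty,\infty}}=\sup_{j\ge0}\max_{k\in P_j^d,\,e\in E_j}|\langle\psi_{j,k,e},g\rangle|$ (different choices of basis give equivalent norms). Assumption A: $\Phi=\{\phi_\omega\mid\omega\in\Omega\}\subset L^2$ with $\Omega$ countable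 and $\|\phi_\omega\|_{L^2}=1$ for all $\omega$. For each $n$ there is a finite subset $\Omega_n\subset\Omega$ with $c\,n^\Gamma\le\#\Omega_n\le Q(n)$ for all $n$, for some polynomial $Q$ and constants $c,\Gamma>0$; and there is a constant $C>0$, independent of $n$ and $g$, such that for every $n$ and every $g\in L^\infty$, $$\|g\|_{B^{-d/2}_{\infty,\infty}}\le C\max_{\omega\in\Omega_n}|\langle\phi_\omega,g\rangle|+C\,\frac{\|g\|_{L^\infty}}{\sqrt n}.$$ Estimator: the observed coefficients are $Y_\omega=\langle\phi_\omega,f\rangle+\frac{\sigma}{\sqrt n}\int_{\mathbb{T}^d}\phi_\omega\,dW$. Let $X_n=\{g\in BV\cap L^\infty\mid\|g\|_{L^\infty}\le\log n\}$. The frame-constrained TV-estimator $\hat f_\Phi$ with parameter $\gamma_n$ is any solution of $$\hat f_\Phi\in\operatorname{argmin}_{g\in X_n}|g|_{BV}\quad\text{subject to}\quad\max_{\omega\in\Omega_n}|\langle\phi_\omega,g\rangle-Y_\omega|\le\gamma_n,$$ with the convention that $\hat f_\Phi$ is the constant zero function if no $g\in X_n$ satisfies the constraint. In part (a), the supremum over $f$ is taken for one common realization of the noise $dW$. *)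

(* Defs.v *)
From HB Require Import structures.
From mathcomp Require Import all_boot all_order all_algebra finmap.
From mathcomp Require Import all_classical all_reals all_analysis.
From mathcomp Require Import measurable_realfun ess_sup_inf.

Set Implicit Arguments.
Unset Strict Implicit.
Unset Printing Implicit Defensive.

Import Order.TTheory GRing.Theory Num.Theory.
Import numFieldNormedType.Exports.

Local Open Scope classical_set_scope.
Local Open Scope ring_scope.

(* Row vectors carry the sigma-algebra generated by the coordinates, which is
   the Borel sigma-algebra of R^d. *)
Section measurable_row.
Context {R : realType} {d : nat}.

Definition row_coord (i : 'I_d) (x : 'rV[R]_d) : measurableTypeR R := x ord0 i.

Let row_set0 : g_sigma_preimage row_coord set0.
Proof. exact: sigma_algebra0. Qed.

Let row_setC A : g_sigma_preimage row_coord A ->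
  g_sigma_preimage row_coord (~` A).
Proof. exact: sigma_algebraC. Qed.

Let row_bigcup (F : _^nat) : (forall i, g_sigma_preimage row_coord (F i)) ->
  g_sigma_preimage row_coord (\bigcup_i (F i)).
Proof. exact: sigma_algebra_bigcup. Qed.

HB.instance Definition _ :=
  @isMeasurable.Build (measure_tuple_display default_measure_display)
  'rV[R]_d (g_sigma_preimage row_coord) row_set0 row_setC row_bigcup.

Lemma measurable_row_coord (i : 'I_d) : measurable_fun [set: 'rV[R]_d] (row_coord i).
Proof.
move=> _ Y mY; rewrite setTI; apply: sub_sigma_algebra => /=.
rewrite -bigcup_seq/=; exists i => /=; first by rewrite mem_index_enum.
by exists Y => //; rewrite setTI.
Qed.

Lemma measurable_fun_row d1 (T1 : measurableType d1) (f : T1 -> 'rV[R]_d) :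
  (forall i, measurable_fun [set: T1] (row_coord i \o f)) ->
  measurable_fun [set: T1] f.
Proof.
move=> mf.
suff : g_sigma_preimage (fun i => row_coord i \o f) `<=` measurable.
  rewrite g_sigma_preimage_comp => prefS _ A mA.
  by apply: prefS; exists A.
apply: smallest_sub; first exact: sigma_algebra_measurable.
rewrite -bigcup_seq; apply: bigcup_sub => i Ii.
by move=> A [B mB <-]; exact: mf.
Qed.

End measurable_row.

Section torus.
Context {R : realType}.

Definition cons_row d (p : measurableTypeR R * 'rV[R]_d) : 'rV[R]_d.+1 :=
  \row_i oapp (p.2 ord0) p.1 (unlift ord0 i).

Lemma measurable_cons_row d : measurable_fun setT (@cons_row d).
Proof.
apply: measurable_fun_row => i.
case: (unliftP ord0 i) => [j ->|->].
  rewrite (_ : _ \o _ = row_coord j \o snd); last first.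
    by apply/funext => p; rewrite /= /row_coord mxE liftK.
  by apply: measurableT_comp => //; exact: measurable_row_coord.
rewrite (_ : _ \o _ = fst); first exact: measurable_fst.
by apply/funext => p; rewrite /= /row_coord mxE unlift_none.
Qed.

HB.instance Definition _ d :=
  isMeasurableFun.Build _ _ _ _ (@cons_row d) (@measurable_cons_row d).

(* Lebesgue measure on the fundamental domain [0,1)^d of the torus. *)
Fixpoint torus_measure d : probability 'rV[R]_d R :=
  if d is d'.+1 then
    distribution (uniform_prob (@ltr01 R) \x torus_measure d')%E (@cons_row d')
  else \d_(0 : 'rV[R]_0).

Lemma torus_measure_box d (A : 'I_d -> set (measurableTypeR R)) :
  (forall i, measurable (A i)) ->
  torus_measure d [set x | forall i, A i (x ord0 i)] =
  (\prod_(i < d) uniform_prob (@ltr01 R) (A i))%E.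
Proof.
elim: d A => [|d IHd] A mA.
  rewrite big_ord0 /= diracE (_ : _ \in _)// inE /= => -[].
  by [].
rewrite big_ord_recl -IHd// /= /distribution /pushforward.
rewrite -product_measure1E//; last first.
  rewrite (_ : (fun x => _) = \bigcap_(i : 'I_d) (row_coord i @^-1` A (lift ord0 i))).
    apply: fin_bigcap_measurable => // i _.
    by rewrite -[X in measurable X]setTI; exact: measurable_row_coord.
  by apply/seteqP; split => x /= h; [move=> i _; exact: h | move=> i; exact: (h i)].
congr (_ _); apply/seteqP; split => -[t x] /= h.
  split; first by have := h ord0; rewrite mxE unlift_none.
  by move=> i; have := h (lift ord0 i); rewrite mxE liftK.
move=> i; rewrite mxE; case: unliftP => [j ->|->] /=; first exact: h.2.
exact: h.1.
Qed.

Definition inner d (T : measurableType d) (mu : {measure set T -> \bar R})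
  (f g : T -> R) : R := \int[mu]_x (f x * g x).

Definition orthonormal_basis d (T : measurableType d)
    (mu : {measure set T -> \bar R}) (I : eqType) (b : I -> T -> R) : Prop :=
  [/\ forall i, b i \in Lfun mu 2%:E,
      forall i i', inner mu (b i) (b i') = (i == i')%:R &
      forall g, g \in Lfun mu 2%:E -> (forall i, inner mu (b i) g = 0) ->
        {ae mu, forall x, g x = 0}].

Definition rapidly_decreasing (f : R -> R) : Prop :=
  forall N : nat, exists C : R, forall x, (1 + `|x|) ^+ N * `|f x| <= C.

Definition dilate (f : R -> R) (j : nat) (k : int) (x : R) : R :=
  Num.sqrt 2 ^+ j * f (2 ^+ j * x - k%:~R).

Definition wavelet_system (phi psi : R -> R) (i : int + nat * int) : R -> R :=
  match i with inl k => dilate phi 0 k | inr (j, k) => dilate psi j k end.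

Definition smooth_decay (S : nat) (f : R -> R) : Prop :=
  [/\ forall m, (m < S)%N -> forall x, derivable (derive1n m f) x 1,
      continuous (derive1n S f) &
      forall m, (m <= S)%N -> rapidly_decreasing (derive1n m f)].

(* Regularity in the sense of Meyer; the vanishing moments then hold
   automatically and are listed as part of the usual definition.  That the
   system built from [phi] and all the levels j >= 0 of [psi] is an orthonormal
   basis of L^2(R) amounts to the closed spans V_j of the 2^(j/2) phi(2^j . - k)
   forming a multiresolution analysis with wavelet [psi]. *)
Definition regular_wavelet (S : nat) (phi psi : R -> R) : Prop :=
  [/\ smooth_decay S phi, smooth_decay S psi,
      forall m, (m < S)%N -> \int[lebesgue_measure]_x (x ^+ m * psi x) = 0 &
      orthonormal_basis (@lebesgue_measure R) (wavelet_system phi psi)].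

(* The sum of f (x + m) over all integers m, which converges absolutely for the
   rapidly decreasing functions used here. *)
Definition periodize (f : R -> R) (x : R) : R :=
  lim ((\sum_(i < N.*2.+1) f (x + i%:R - N%:R)) @[N --> \oo]).

Section torus_functions.
Variable d : nat.
Implicit Types (f g : 'rV[R]_d -> R) (p : \bar R).

Local Notation mu := (torus_measure d).

Definition periodic f : Prop := forall x i, f (x + 'e_i) = f x.

(* Functions on the torus are 1-periodic functions on R^d, integrated over
   [0,1)^d; elements of L^p are represented by Borel functions. *)
Definition torus_L p : set ('rV[R]_d -> R) :=
  [set f | periodic f /\ f \in Lfun mu p].

Definition Lq_norm p f : \bar R := 'N[mu]_p [EFin \o f].

Definition torus_C1 f : Prop :=
  [/\ periodic f, continuous f, forall x i, derivable f x 'e_i &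
      forall i, continuous ('D_('e_i) f)].

Definition divergence (h : 'I_d -> 'rV[R]_d -> R) (x : 'rV[R]_d) : R :=
  \sum_(i < d) 'D_('e_i) (h i) x.

(* The pointwise norm of the vector field is the Euclidean one (the norm of
   the library on ['rV_d] is the maximum norm). *)
Definition BV_seminorm g : \bar R :=
  ereal_sup [set (\int[mu]_x (g x * divergence h x))%:E |
    h in [set h : 'I_d -> 'rV[R]_d -> R | (forall i, torus_C1 (h i)) /\
           forall x, Num.sqrt (\sum_(i < d) h i x ^+ 2) <= 1]].

Definition BV : set ('rV[R]_d -> R) :=
  [set g | torus_L 1%:E g /\ (BV_seminorm g < +oo)%E].

Definition BV_ball (L : R) : set ('rV[R]_d -> R) :=
  [set g | [/\ BV g, torus_L +oo%E g, (Lq_norm +oo g <= L%:E)%E &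
              (BV_seminorm g <= L%:E)%E]].

Definition wavelet (phi psi : R -> R) (j : nat) (k : {ffun 'I_d -> 'I_(2 ^ j)})
    (e : {ffun 'I_d -> bool}) (x : 'rV[R]_d) : R :=
  \prod_(i < d)
    periodize (dilate (if e i then psi else phi) j (k i : nat)) (x ord0 i).

Definition besov_norm (phi psi : R -> R) g : \bar R :=
  ereal_sup [set r | exists (j : nat) (k : {ffun 'I_d -> 'I_(2 ^ j)})
                            (e : {ffun 'I_d -> bool}),
    ((j == 0)%N || [exists i, e i]) /\
    r = `|inner mu (wavelet phi psi k e) g|%:E].

Section dictionary.
Variables (Omega : countType) (Phi : Omega -> 'rV[R]_d -> R).

(* The index n ranges over n >= 2. *)
Record dictionary_assumption (phi psi : R -> R) (On : nat -> {fset Omega})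
    (Gamma : R) : Prop := {
  dictionary_L2 : forall w, torus_L 2%:E (Phi w);
  dictionary_normalized : forall w, Lq_norm 2%:E (Phi w) = 1%E;
  dictionary_Gamma_gt0 : 0 < Gamma;
  dictionary_card : exists (Q : {poly R}) (c : R), 0 < c /\
    forall n, (2 <= n)%N ->
      c * n%:R `^ Gamma <= #|` On n|%:R <= Q.[n%:R];
  dictionary_besov : exists C : R, 0 < C /\
    forall n, (2 <= n)%N -> forall g, torus_L +oo%E g ->
      (besov_norm phi psi g <=
       (C * \big[Num.max/0]_(w <- On n) `|inner mu (Phi w) g|)%:E +
       (C / Num.sqrt n%:R)%:E * Lq_norm +oo g)%E }.

Definition feasible (A : {fset Omega}) (M gamma : R) (y : Omega -> R) :
    set ('rV[R]_d -> R) :=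
  [set g | [/\ BV g, torus_L +oo%E g, (Lq_norm +oo g <= M%:E)%E &
    \big[Num.max/0]_(w <- A) `|inner mu (Phi w) g - y w| <= gamma]].

Definition TV_solution A M gamma y g : Prop :=
  (feasible A M gamma y !=set0 ->
     feasible A M gamma y g /\
     forall h, feasible A M gamma y h ->
       (BV_seminorm g <= BV_seminorm h)%E) /\
  (feasible A M gamma y = set0 -> g = cst 0).

Definition TV_estimator A M gamma
    (fhat : (Omega -> R) -> 'rV[R]_d -> R) : Prop :=
  forall y, TV_solution A M gamma y (fhat y).

End dictionary.

Definition convergence_rate (q : R) (n : nat) : R :=
  n%:R `^ (- Num.min (d.+2%:R^-1) ((d%:R * q)^-1)) * ln n%:R ^+ (3 - minn d 2).

End torus_functions.

Section noise.
Context d0 (T : measurableType d0) (P : probability T R).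

(* The library's [normal_prob m 0] is not the Dirac mass at [m], so degenerate
   Gaussian laws are added by hand. *)
Definition gaussian (X : T -> R) : Prop := exists m : R,
  (forall A : set (measurableTypeR R), measurable A ->
     P (X @^-1` A) = \d_m A) \/
  (exists2 s : R, 0 < s & forall A : set (measurableTypeR R), measurable A ->
     P (X @^-1` A) = normal_prob m s A).

(* [W f] is the stochastic integral of f, i.e. [W] is the isonormal Gaussian
   process on L^2 of the torus; the covariance forces functions that agree
   almost everywhere to have almost surely equal integrals. *)
Definition white_noise d (W : ('rV[R]_d -> R) -> {RV P >-> R}) : Prop :=
  [/\ forall m (c : 'I_m -> R) (f : 'I_m -> 'rV[R]_d -> R),
        (forall i, torus_L 2%:E (f i)) ->
        gaussian (fun t => \sum_(i < m) c i * W (f i) t),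
      forall f, torus_L 2%:E f -> ('E_P[W f] = 0)%E &
      forall f g, torus_L 2%:E f -> torus_L 2%:E g ->
        covariance P (W f) (W g) = (inner (torus_measure d) f g)%:E].

(* Expectation of a nonnegative [X] that need not be measurable: an arbitrary
   choice of minimizers may lead to a non-measurable loss.  It is the usual
   expectation when [X] is measurable (outer_expectationE). *)
Definition outer_expectation (X : T -> \bar R) : \bar R :=
  ereal_inf [set (\int[P]_t Y t)%E |
    Y in [set Y : T -> \bar R | measurable_fun setT Y /\
                                 forall t, (X t <= Y t)%E]].

Lemma outer_expectationE (X : T -> \bar R) :
  measurable_fun setT X -> (forall t, (0 <= X t)%E) ->
  outer_expectation X = (\int[P]_t X t)%E.
Proof.
move=> mX X0; apply/eqP; rewrite eq_le; apply/andP; split.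
  by apply: ereal_inf_lbound; exists X.
apply: le_ereal_inf_tmp => _ [Y [mY XY] <-].
by apply: ge0_le_integral => // t _; rewrite (le_trans (X0 t)).
Qed.

End noise.

End torus.

Arguments torus_measure {R} d.

(* Main.v *)
Require Import Defs.
From mathcomp Require Import all_boot all_order all_algebra finmap.
From mathcomp Require Import all_classical all_reals all_analysis.
From mathcomp Require Import measurable_realfun ess_sup_inf.
From mathcomp Require Import ring lra zify.

(** Let N be the number of dictionary elements. With probability at least
    1 - N^(1 - kappa^2) all N normalised noise coefficients are at most
    kappa sqrt (2 ln N), by the union bound and the Gaussian tail estimate
    exp (- t^2 / 2) ([noise_event], [standard_gaussian_tail]). On that event, as
    soon as L <= ln n, every f in the ball is feasible, so the estimate has total
    variation at most L, and the dictionary coefficients of the error G, the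
    difference of the estimate and f, are at most 2 gamma_n
    ([TV_solution_feasible]). What remains for (a) is deterministic
    ([dictionary_Lq_bound]): G has sup norm at most 2 ln n and total variation at
    most 2 L, and since ln N is at most of order ln n ([threshold_bound]) the
    assumption on the dictionary bounds all its wavelet coefficients by some
    delta of order ln n / sqrt n.

    The L^q bound interpolates between these pieces of information. Let T_J be the
    orthogonal projection onto the periodic scaling functions of level J. Then
    |T_J G| <= A delta 2^(d J / 2) pointwise and
    |G - T_J G|_1 <= K 2^(-J) |G|_BV ([wavelet_approximation]). At a threshold u_j of
    order delta 2^(d j / 2) the first bound leaves exceedances of G to G - T_j G
    only, and the second makes the measure of the set where |G| > u_j of order
    2^(-j) / u_j ([exceedance_bound]). So each of the layers u_j < |G| <= u_{j+1}
    contributes about delta^(2/d) to the moment of order 1 + 2 / d, and there are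
    O(ln n) layers below 2 ln n. The other exponents follow from the sup bound and
    from the monotonicity of L^q norms on a probability space ([Lq_rate]).

    For the sup bound, T_{J+1} - T_J is the sum of the wavelet blocks of level J,
    and localised wavelets overlap boundedly ([mra_sup_bound]). The splitting rests
    on the identity of [pkernelS] between the kernels of the one-dimensional
    projections: the scaling functions and wavelets of level J are 2^(J+1)
    orthonormal functions in the span of 2^(J+1) scaling functions of level J + 1,
    and orthonormal families with the same span have the same kernel
    ([kernel_change_of_basis]). That they lie in this span follows from the
    completeness of the wavelet system on the line ([two_scale]).

    For the L^1 bound, pair T_{J+1} G - T_J G with its own sign and move the
    symmetric operator to the sign. The wavelet psi is the derivative of a
    localised function ([tame_antiderivative]), so G is integrated against the
    divergence of a smooth field of size 2^(-J), which the definition of the total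
    variation controls ([mra_diff_L1]). These differences are summed over the
    levels from J on, using that T_J G tends to G in L^1 ([resolved_integrable]): the
    projections are uniformly bounded on L^1, and on Lipschitz functions they
    converge since their kernels have mass one and concentrate on the diagonal
    ([pproj_approx]).

    For (b), the loss never exceeds 4 ln n, and the probability N^(1 - kappa^2) of
    the bad event is at most a multiple of n^(Gamma (1 - kappa^2)), which the
    condition on kappa turns into at most n^(-1 / (d + 2)). *)

Set Implicit Arguments.
Unset Strict Implicit.
Unset Printing Implicit Defensive.

Import Order.TTheory GRing.Theory Num.Theory.
Import numFieldNormedType.Exports.

Local Open Scope classical_set_scope.
Local Open Scope ring_scope.

(** * Quadratic decay and periodisation *)

Lemma eq_ler (disp : Order.disp_t) (T : porderType disp) (x y : T) :
  x = y -> (x <= y)%O.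
Proof. by move=> ->. Qed.

Section decay_functions.
Context {R : realType}.
Implicit Types (u v : R -> R) (x y t C : R).

Definition decay t : R := ((1 + `|t|) ^+ 2)^-1.

(** [sat] is a bounded primitive of [decay], against which the sums of [decay]
    over arithmetic progressions of step one telescope. *)
Definition sat t : R := t / (1 + `|t|).

Definition tame C u : Prop := forall x, `|u x| <= C * decay x.

Lemma decay_gt0 t : 0 < decay t.
Proof. by rewrite invr_gt0 exprn_gt0// ltr_pwDl. Qed.

Lemma decay_ge0 t : 0 <= decay t.
Proof. exact/ltW/decay_gt0. Qed.

Lemma decay_le1 t : decay t <= 1.
Proof.
by rewrite invf_le1 ?exprn_gt0 ?ltr_pwDl// expr_ge1 ?lerDl.
Qed.

Lemma sat_bound t : -1 <= sat t <= 1.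
Proof.
rewrite /sat ler_pdivrMr ?ltr_pwDl// ler_pdivlMr ?ltr_pwDl//.
rewrite mulN1r mul1r; have := ler_norm t; have := ler_norm (- t).
by rewrite normrN; lra.
Qed.

(** [decay] is the derivative of [sat], and over a unit step it drops by a
    factor of at most four, since 1 + |x| <= 2 (1 + |t|) for x in [t, t + 1]. *)
Lemma decay_telescope t : decay t <= 4 * (sat (t + 1) - sat t).
Proof.
have h0 : 0 < 1 + `|t| by rewrite ltr_pwDl.
have h1 : 0 < 1 + `|t + 1| by rewrite ltr_pwDl.
have -> : 4 * (sat (t + 1) - sat t) =
  4 * ((t + 1) * (1 + `|t|) - t * (1 + `|t + 1|)) / ((1 + `|t|) * (1 + `|t + 1|)).
  by rewrite /sat; field; rewrite !gt_eqF.
rewrite /decay ler_pdivlMr ?mulr_gt0// mulrC ler_pdivrMr ?exprn_gt0//.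
have := ger0_norm; case: (lerP 0 t) => t0 _.
  have -> : `|t| = t by rewrite ger0_norm.
  have -> : `|t + 1| = t + 1 by rewrite ger0_norm//; lra.
  by nra.
have [t1|t1] := lerP 0 (t + 1).
  have -> : `|t| = - t by rewrite ltr0_norm.
  have -> : `|t + 1| = t + 1 by rewrite ger0_norm//; lra.
  set g := (t + 1) * (1 - t) - t * (1 + (t + 1)).
  have g1 : 1 <= g by rewrite /g; nra.
  apply: (@le_trans _ _ (4 * 1 * (1 - t) ^+ 2)); first by nra.
  by rewrite ler_wpM2r ?sqr_ge0// ler_wpM2l.
have -> : `|t| = - t by rewrite ltr0_norm.
have -> : `|t + 1| = - (t + 1) by rewrite ltr0_norm//; lra.
by nra.
Qed.

Lemma sum_decay_sat (n : nat) t :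
  \sum_(i < n) decay (t + i%:R) <= 4 * (sat (t + n%:R) - sat t).
Proof.
elim: n => [|n IHn]; first by rewrite big_ord0 addr0 subrr mulr0.
rewrite big_ord_recr/=; have := decay_telescope (t + n%:R).
by rewrite -addrA natr1; lra.
Qed.

Lemma sum_decay (n : nat) t : \sum_(i < n) decay (t + i%:R) <= 8.
Proof.
apply: le_trans (sum_decay_sat n t) _.
by have /andP[] := sat_bound t; have /andP[] := sat_bound (t + n%:R); lra.
Qed.

Lemma decayN t : decay (- t) = decay t.
Proof. by rewrite /decay normrN. Qed.

(** From 1 + |x - y| <= (1 + |x|) (1 + |y|): a product of two bumps remembers
    the distance of their centres. *)
Lemma decay_mul x y : decay x * decay y <= decay (x - y).
Proof.
rewrite /decay -invfM lef_pV2 ?posrE ?exprn_gt0 ?mulr_gt0 ?exprn_gt0 ?ltr_pwDl//.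
rewrite -exprMn lerXn2r ?nnegrE ?addr_ge0 ?mulr_ge0 ?addr_ge0//.
have := ler_normB x y; have := normr_ge0 x; have := normr_ge0 y; nra.
Qed.

Lemma decayX_le n x : decay x ^+ n.+1 <= decay x.
Proof. by rewrite exprS ler_piMr ?decay_ge0// exprn_ile1 ?decay_ge0 ?decay_le1. Qed.

Lemma tame_ge0 C u : tame C u -> 0 <= C.
Proof.
move=> /(_ 0) /(le_trans (normr_ge0 _)).
by rewrite pmulr_lge0// decay_gt0.
Qed.

Lemma tame_bound C u x : tame C u -> `|u x| <= C.
Proof.
move=> h; apply: le_trans (h x) _; rewrite ler_piMr ?decay_le1//.
exact: tame_ge0 h.
Qed.

Lemma tame_norm C u : tame C u -> tame C (fun x => `|u x|).
Proof. by move=> h x; rewrite normr_id. Qed.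

Lemma tame_le C C' u : C <= C' -> tame C u -> tame C' u.
Proof.
by move=> CC' h x; apply: le_trans (h x) _; rewrite ler_wpM2r ?decay_ge0.
Qed.

Lemma tameZ C u a : tame C u -> tame (`|a| * C) (fun x => a * u x).
Proof. by move=> h x; rewrite normrM -mulrA ler_wpM2l. Qed.

Lemma tameD C C' u v : tame C u -> tame C' v -> tame (C + C') (fun x => u x + v x).
Proof.
by move=> h k x; rewrite mulrDl; apply: le_trans (ler_normD _ _) (lerD _ _).
Qed.

Lemma tameB C C' u v : tame C u -> tame C' v -> tame (C + C') (fun x => u x - v x).
Proof.
by move=> h k x; rewrite mulrDl; apply: le_trans (ler_normB _ _) (lerD _ _).
Qed.

(** A dilation by a factor of at least one only narrows the bump, and a shift by
    b costs a factor that depends on b alone. *)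
Lemma decay_affine (a b : R) : 1 <= a -> forall x,
  decay (a * x - b) <= (1 + `|b|) ^+ 2 * decay x.
Proof.
move=> a1 x; rewrite /decay ler_pdivlMr ?exprn_gt0 ?ltr_pwDl// mulrC.
rewrite ler_pdivrMr ?exprn_gt0 ?ltr_pwDl// -exprMn lerXn2r ?nnegrE ?mulr_ge0 ?addr_ge0//.
have h : `|x| <= `|a * x - b| + `|b|.
  apply: (@le_trans _ _ `|a * x|).
    by rewrite normrM (ger0_norm (le_trans ler01 a1)) ler_peMl.
  by have := ler_normD (a * x - b) b; rewrite subrK.
by have := normr_ge0 b; have := normr_ge0 (a * x - b); nra.
Qed.

Lemma decay_double x : decay x <= 4 * decay (2 * x).
Proof.
rewrite /decay ler_pdivlMr ?exprn_gt0 ?ltr_pwDl// mulrC ler_pdivrMr ?exprn_gt0 ?ltr_pwDl//.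
rewrite normrM (ger0_norm (ler0n _ 2)); have := normr_ge0 x; nra.
Qed.

Lemma decay_double_le x : decay (2 * x) <= decay x.
Proof.
rewrite /decay lef_pV2 ?posrE ?exprn_gt0 ?ltr_pwDl// lerXn2r ?nnegrE ?addr_ge0//.
by rewrite lerD2l normrM (ger0_norm (ler0n _ 2)) ler_peMl// ler1n.
Qed.

Lemma rapidly_decayX N u : rapidly_decreasing u ->
  exists C, 0 <= C /\ forall x, `|u x| <= C * decay x ^+ N.
Proof.
move=> /(_ (2 * N)%N)[C h]; exists C; split.
  by have := h 0; apply: le_trans; rewrite mulr_ge0// exprn_ge0// addr_ge0.
move=> x; rewrite /decay -exprVn -exprM exprVn ler_pdivlMr ?exprn_gt0 ?ltr_pwDl//.
by rewrite mulrC.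
Qed.

Lemma rapidly_tame u : rapidly_decreasing u -> exists C, tame C u.
Proof.
move=> /(_ 2%N)[C h]; exists C => x; rewrite /decay ler_pdivlMr ?exprn_gt0 ?ltr_pwDl//.
by rewrite mulrC.
Qed.

End decay_functions.

Section periodization.
Context {R : realType}.
Implicit Types (u v : R -> R) (x y t C : R).

Definition psum u (N : nat) x := \sum_(i < N.*2.+1) u (x + i%:R - N%:R).

Lemma cvgn_le (f : nat -> R) (l B : R) :
  f n @[n --> \oo] --> l -> (forall n, f n <= B) -> l <= B.
Proof.
move=> fl fB; rewrite -(cvg_lim (@Rhausdorff R) fl).
by apply: limr_le; [apply/cvg_ex; exists l | near=> N; exact: fB].
Unshelve. all: by end_near. Qed.

Lemma cvgn_sum (I : finType) (f : I -> nat -> R) (l : I -> R) :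
  (forall i, f i n @[n --> \oo] --> l i) ->
  \sum_i f i n @[n --> \oo] --> \sum_i l i.
Proof.
move=> fl; rewrite -(_ : \sum_i (fun n => f i n) = fun n => \sum_i f i n); last first.
  by apply/funext => n; rewrite fct_sumE.
by elim/big_ind2 : _ => // [|g a h b ga hb]; [exact: cvg_cst | exact: cvgD].
Qed.

Lemma cvgn_eq0 (f : nat -> R) (l : R) :
  f n @[n --> \oo] --> l -> (forall n, f n = 0) -> l = 0.
Proof.
move=> fl f0; apply/eqP; rewrite eq_le; apply/andP; split.
  by apply: cvgn_le fl _ => n; rewrite f0.
rewrite -oppr_le0; apply: (@cvgn_le (fun n => - f n)); first exact: cvgN.
by move=> n; rewrite f0 oppr0.
Qed.

Lemma psumS u N x :
  psum u N.+1 x = psum u N x + (u (x + N.+1%:R) + u (x - N.+1%:R)).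
Proof.
rewrite /psum doubleS; set n := N.*2.+2.
rewrite big_ord_recl big_ord_recr /=.
rewrite (_ : x + 0%:R - N.+1%:R = x - N.+1%:R); last by rewrite addr0.
rewrite [LHS]addrA (addrC (u (x - _)) (\sum_(i < _) _)) -addrA (addrC (u (x - _))).
congr (_ + (u _ + u _)).
- apply: eq_bigr => i _; congr u.
  by rewrite /fintype.bump/= natrD -(natr1 N); ring.
- by rewrite /fintype.bump/= add1n -[N.*2.+2]addn2 -muln2 natrD natrM -(natr1 N); ring.
Qed.

Lemma psumD u v N x : psum (fun x => u x + v x) N x = psum u N x + psum v N x.
Proof. by rewrite /psum big_split. Qed.

Lemma psumZ a u N x : psum (fun x => a * u x) N x = a * psum u N x.
Proof. by rewrite /psum mulr_sumr. Qed.

Lemma psum_norm u N x : `|psum u N x| <= psum (fun x => `|u x|) N x.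
Proof. exact: ler_norm_sum. Qed.

Lemma psum_decay N x : psum decay N x <= 8.
Proof.
rewrite /psum; under eq_bigr do rewrite addrAC.
exact: sum_decay.
Qed.

Lemma psum_tame C u N x : tame C u -> psum (fun x => `|u x|) N x <= 8 * C.
Proof.
move=> h; apply: (@le_trans _ _ (C * psum decay N x)).
  by rewrite -psumZ; apply: ler_sum => i _; exact: h.
by rewrite mulrC ler_wpM2r ?psum_decay// (tame_ge0 h).
Qed.

Lemma cvg_periodize_ge0 C u x : (forall y, 0 <= u y) -> tame C u ->
  cvg (psum u N x @[N --> \oo]).
Proof.
move=> u0 h; apply: nondecreasing_is_cvgn.
  by apply/nondecreasing_seqP => N; rewrite psumS lerDl addr_ge0.
exists (8 * C) => _ [N _ <-].
apply: le_trans (psum_tame N x h); apply: ler_sum => i _; exact: ler_norm.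
Qed.

(** The partial sums of |u| + u and of |u| are monotone and bounded. *)
Lemma cvg_periodize C u x : tame C u ->
  psum u N x @[N --> \oo] --> periodize u x.
Proof.
move=> h; have h1 : cvg (psum u N x @[N --> \oo]); last exact: h1.
have -> : (fun N => psum u N x) =
   (fun N => psum (fun x => `|u x| + u x) N x + (-1) * psum (fun x => `|u x|) N x).
  by apply/funext => N; rewrite psumD mulN1r addrAC subrr add0r.
apply: is_cvgD.
  apply: (@cvg_periodize_ge0 (C + C)).
    by move=> y; have := ler_norm (- u y); rewrite normrN; lra.
  exact: tameD (tame_norm h) h.
apply: is_cvgMr; apply: (@cvg_periodize_ge0 C) => //; exact: tame_norm.
Qed.

Arguments cvg_periodize {C u} x _.

Lemma periodize_unique C u x l : tame C u ->
  psum u N x @[N --> \oo] --> l -> periodize u x = l.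
Proof. by move=> _ h; exact/cvg_lim. Qed.

Lemma periodizeD C C' u v x : tame C u -> tame C' v ->
  periodize (fun x => u x + v x) x = periodize u x + periodize v x.
Proof.
move=> hu hv; apply: periodize_unique (tameD hu hv) _.
by under eq_fun do rewrite psumD; apply: cvgD; exact: cvg_periodize.
Qed.

Lemma periodizeZ C u a x : tame C u ->
  periodize (fun x => a * u x) x = a * periodize u x.
Proof.
move=> hu; apply: periodize_unique (tameZ a hu) _.
by under eq_fun do rewrite psumZ; apply: cvgMr; exact: cvg_periodize hu.
Qed.

(** The remainder is controlled by that of the series of [decay], so its rate of
    convergence is common to all functions of the same tameness. *)
Lemma psum_tail C u N x : tame C u ->
  `|periodize u x - psum u N x| <= C * (periodize decay x - psum decay N x).
Proof.
move=> hu; have hd : tame 1 (@decay R) by move=> y; rewrite mul1r ger0_norm// decay_ge0.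
have step M : `|psum u (M + N) x - psum u N x| <= C * (psum decay (M + N) x - psum decay N x).
  elim: M => [|M IHM]; first by rewrite !subrr normr0 mulr0.
  rewrite addSn !psumS addrAC (addrAC (psum decay _ _)) mulrDr.
  apply: le_trans (ler_normD _ _) _; apply: lerD IHM _.
  by rewrite mulrDr; apply: le_trans (ler_normD _ _) _; apply: lerD; exact: hu.
rewrite -subr_le0.
apply: (@cvgn_le (fun M => `|psum u (M + N) x - psum u N x| - C * (psum decay (M + N) x - psum decay N x))).
  apply: cvgB.
    apply: cvg_norm; apply: cvgB; last exact: cvg_cst.
    by rewrite (cvg_shiftn N (fun M => psum u M x)); exact: cvg_periodize hu.
  apply: cvgMr; apply: cvgB; last exact: cvg_cst.
  by rewrite (cvg_shiftn N (fun M => psum decay M x)); exact: cvg_periodize hd.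
by move=> M; rewrite subr_le0.
Qed.

Lemma cvg_psum_tail x : periodize decay x - psum decay N x @[N --> \oo] --> (0 : R).
Proof.
have hd : tame 1 (@decay R) by move=> y; rewrite mul1r ger0_norm// decay_ge0.
rewrite -[X in _ --> X](subrr (periodize (@decay R) x)); apply: cvgB; first exact: cvg_cst.
exact: cvg_periodize hd.
Qed.

Lemma cvg_tame0 C u x : tame C u ->
  u (x + N.+1%:R) @[N --> \oo] --> (0 : R) /\ u (x - N.+1%:R) @[N --> \oo] --> (0 : R).
Proof.
move=> hu; have hn := cvg_periodize x (tame_norm hu).
have h0 : psum (fun x => `|u x|) N.+1 x - psum (fun x => `|u x|) N x @[N --> \oo] --> (0 : R).
  rewrite -(subrr (periodize (fun x => `|u x|) x)); apply: cvgB => //.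
  by rewrite (cvg_shiftS (fun N => psum (fun x => `|u x|) N x)).
have hs (v : nat -> R) : (forall N, `|v N| <= psum (fun x => `|u x|) N.+1 x - psum (fun x => `|u x|) N x) ->
    v N @[N --> \oo] --> (0 : R).
  move=> hv; apply/cvgr0Pnorm_le => e e0.
  move/cvgr0Pnorm_le : h0 => /(_ e e0); apply: filterS => N.
  by apply: le_trans; apply: le_trans (hv N) (ler_norm _).
by split; apply: hs => N; rewrite psumS addrAC subrr add0r ?lerDl ?lerDr.
Qed.

Lemma sum_ordS (F : nat -> R) n :
  \sum_(i < n) F i.+1 = \sum_(i < n) F i + (F n - F 0%N).
Proof.
elim: n => [|n IHn]; first by rewrite !big_ord0 subrr addr0.
by rewrite !big_ord_recr/= IHn; ring.
Qed.

(** Translating by one exchanges the first term of the window for the one beyond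
    its end, and both tend to 0. *)
Lemma periodizeS C u x : tame C u -> periodize u (x + 1) = periodize u x.
Proof.
move=> hu; apply: periodize_unique (hu) _.
rewrite -(cvg_shiftS (fun N => psum u N (x + 1))).
have -> : (fun N => psum u N.+1 (x + 1)) =
    (fun N => psum u N.+1 x + (u ((x + 1) + N.+1%:R) - u (x - N.+1%:R))).
  apply/funext => N; rewrite /psum.
  under eq_bigr => i _ do rewrite -[x + 1 + i%:R]addrA (addrC 1) natr1.
  rewrite (sum_ordS (fun i => u (x + i%:R - N.+1%:R))); congr (_ + (u _ - u _)).
    by rewrite -[N.+1.*2.+1]addn1 -muln2 natrD natrM; ring.
  by rewrite addr0.
rewrite (_ : periodize u x = periodize u x + (0 - 0)); last by rewrite subrr addr0.
apply: cvgD; first by rewrite (cvg_shiftS (fun N => psum u N x)); exact: cvg_periodize hu.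
by apply: cvgB; [have [] := cvg_tame0 (x + 1) hu | have [] := cvg_tame0 x hu].
Qed.

Lemma periodic1_natr u (m : nat) x : (forall x, u (x + 1) = u x) -> u (x + m%:R) = u x.
Proof. by move=> u1; elim: m => [|m IHm]; rewrite ?addr0// -natr1 addrA u1. Qed.

Lemma periodic1_intr u (m : int) x : (forall x, u (x + 1) = u x) -> u (x + m%:~R) = u x.
Proof.
move=> u1; case: m => m; first exact: periodic1_natr.
by rewrite NegzE mulrNz -(periodic1_natr m.+1 (x - _) u1) subrK.
Qed.

Lemma periodize_int C u x (m : int) : tame C u ->
  periodize u (x - m%:~R) = periodize u x.
Proof. by move=> hu; rewrite -mulrNz periodic1_intr// => y; exact: periodizeS hu. Qed.

Lemma tame_dilate C u j (k : int) : tame C u ->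
  tame (Num.sqrt 2 ^+ j * (C * (1 + `|k%:~R|) ^+ 2)) (dilate u j k).
Proof.
move=> hu x; rewrite /dilate normrM ger0_norm ?exprn_ge0 ?sqrtr_ge0// -mulrA.
rewrite ler_wpM2l ?exprn_ge0 ?sqrtr_ge0//; apply: le_trans (hu _) _.
rewrite -mulrA ler_wpM2l ?(tame_ge0 hu)// decay_affine//.
by rewrite exprn_ege1// ler1n.
Qed.

Lemma dilate_shift u j (k m : int) x :
  dilate u j (k + 2 ^+ j * m) x = dilate u j k (x - m%:~R).
Proof.
rewrite /dilate; congr (_ * u _).
by rewrite intrD intrM rmorphXn/=; ring.
Qed.

(** A translation by one moves the index of a dilate of level j by 2 ^ j. *)
Lemma periodize_dilate_mod C u j (k m : int) x : tame C u ->
  periodize (dilate u j (k + 2 ^+ j * m)) x = periodize (dilate u j k) x.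
Proof.
move=> hu; rewrite -[RHS](periodize_int x m (tame_dilate j k hu)).
by rewrite /periodize; congr (lim (_ @ \oo)); apply/funext => N;
   apply: eq_bigr => i _; rewrite dilate_shift; congr dilate; ring.
Qed.

(** Over all [k < 2 ^ j] and all integer translations the arguments of the
    dilates run through one arithmetic progression of step one. *)
Lemma sum_psum_dilate C u j N x : tame C u ->
  \sum_(k < 2 ^ j) psum (fun x => `|dilate u j (k : nat) x|) N x
    <= 8 * C * Num.sqrt 2 ^+ j.
Proof.
move=> hu; have C0 := tame_ge0 hu.
rewrite /psum exchange_big/=.
pose s (i : nat) : R := sat (2 ^+ j - 2 ^+ j * (x + i%:R - N%:R)).
apply: (@le_trans _ _ (\sum_(i < N.*2.+1) Num.sqrt 2 ^+ j * C * (4 * (s i - s i.+1)))).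
  apply: ler_sum => i _; set y := x + i%:R - N%:R.
  apply: (@le_trans _ _ (\sum_(k < 2 ^ j) Num.sqrt 2 ^+ j * C * decay (- (2 ^+ j * y) + k%:R))).
    apply: ler_sum => k _; rewrite /dilate normrM ger0_norm ?exprn_ge0 ?sqrtr_ge0//.
    rewrite -mulrA ler_wpM2l ?exprn_ge0 ?sqrtr_ge0//.
    by apply: le_trans (hu _) _; rewrite -decayN opprB addrC.
  rewrite -mulr_sumr ler_wpM2l ?mulr_ge0 ?exprn_ge0 ?sqrtr_ge0//.
  apply: le_trans (sum_decay_sat _ _) _.
  rewrite /s ler_wpM2l// natrX; apply: eq_ler.
  by congr (sat _ - sat _); rewrite /y -?natr1; ring.
rewrite -mulr_sumr -mulr_sumr.
rewrite -(big_mkord xpredT (fun i => s i - s i.+1)).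
rewrite (eq_bigr (fun i => - (s i.+1 - s i))); last by move=> i _; rewrite opprB.
rewrite sumrN telescope_sumr//.
rewrite -mulrA mulrC -mulrA (mulrC 8) -mulrA.
have := sat_bound (2 ^+ j - 2 ^+ j * (x + (N.*2.+1)%:R - N%:R)).
have := sat_bound (2 ^+ j - 2 ^+ j * (x + 0%:R - N%:R)).
rewrite -/(s _) -/(s _) => /andP[a1 a2] /andP[b1 b2].
rewrite mulrCA; have e0 : 0 <= Num.sqrt 2 ^+ j * C :> R by rewrite mulr_ge0 ?exprn_ge0 ?sqrtr_ge0.
rewrite opprB; nra.
Qed.

Lemma sum_periodize_dilate C u j x : tame C u ->
  \sum_(k < 2 ^ j) `|periodize (dilate u j (k : nat)) x| <= 8 * C * Num.sqrt 2 ^+ j.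
Proof.
move=> hu; apply: (@cvgn_le (fun N => \sum_(k < 2 ^ j) `|psum (dilate u j (k : nat)) N x|)).
  by apply: cvgn_sum => k; apply: cvg_norm; exact: cvg_periodize (tame_dilate _ _ hu).
move=> N; apply: le_trans (sum_psum_dilate j N x hu).
by apply: ler_sum => k _; exact: psum_norm.
Qed.

End periodization.

Section periodization_derivative.
Context {R : realType}.
Implicit Types (u v f g : R -> R) (x y t C : R).

Lemma is_derive_continuous f g : (forall x, is_derive x 1 f (g x)) -> continuous f.
Proof.
by move=> fg x; have /@ex_derive/derivable1_diffP/differentiable_continuous := fg x.
Qed.

Lemma mean_value f g x y : (forall x, is_derive x 1 f (g x)) -> x < y ->
  exists2 c, c \in `]x, y[ & f y - f x = g c * (y - x).
Proof.
move=> fg xy; apply: (@MVT _ f g) => //.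
apply: continuous_subspaceT; exact: is_derive_continuous fg.
Qed.

Lemma derive_lipschitz f g C : (forall x, is_derive x 1 f (g x)) ->
  (forall x, `|g x| <= C) -> forall x y, `|f x - f y| <= C * `|x - y|.
Proof.
move=> fg gC; suff h x y : x < y -> `|f y - f x| <= C * `|y - x|.
  move=> x y; case: (ltgtP x y) => [xy|yx|->].
  - by rewrite distrC (distrC x) h.
  - exact: h.
  - by rewrite !subrr normr0 mulr0.
by move=> /(mean_value fg)[c _ ->]; rewrite normrM ler_wpM2r.
Qed.

(** Together with [taylor_is_derive] this characterises the functions with a
    Lipschitz derivative by a second order Taylor bound, which unlike
    derivability survives pointwise limits. *)
Lemma derive_taylor f g C : (forall x, is_derive x 1 f (g x)) ->
  (forall x y, `|g x - g y| <= C * `|x - y|) ->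
  forall x h, `|f (x + h) - f x - h * g x| <= C * h ^+ 2.
Proof.
move=> fg gC x h.
have C0 : 0 <= C by have := le_trans (normr_ge0 _) (gC 1 0); rewrite subr0 normr1 mulr1.
have [c ch ->] : exists2 c, `|c - x| <= `|h| & f (x + h) - f x = h * g c.
  case: (ltgtP 0 h) => [h0|h0|<-].
  - have [|c /[!in_itv]/= /andP[c1 c2] e] := mean_value fg (x := x) (y := x + h).
      by rewrite ltrDl.
    by exists c; [rewrite !gtr0_norm//; lra | rewrite e; ring].
  - have [|c /[!in_itv]/= /andP[c1 c2] e] := mean_value fg (x := x + h) (y := x).
      by rewrite gtrDl.
    exists c; first by rewrite !ltr0_norm//; lra.
    by rewrite -opprB e; ring.
  - by exists x; rewrite ?addr0 subrr ?normr0 ?mul0r.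
rewrite -mulrBr normrM -(real_normK (num_real h)) expr2 mulrCA ler_wpM2l//.
by apply: le_trans (gC _ _) _; rewrite ler_wpM2l.
Qed.

Lemma taylor_is_derive f g C : (forall x h, `|f (x + h) - f x - h * g x| <= C * h ^+ 2) ->
  forall x, is_derive x 1 f (g x).
Proof.
move=> H x.
have C0 : 0 <= C by have := le_trans (normr_ge0 _) (H x 1); rewrite expr1n mulr1.
have C1 : 0 < C + 1 by rewrite ltr_wpDl.
have cv : (fun h : R => h^-1 *: (f (h *: 1 + x) - f x)) @ 0^' --> g x.
  apply/cvgrPdist_le => e e0; near=> h.
  have h0 : h != 0 by near: h; exact: nbhs_dnbhs_neq.
  rewrite /GRing.scale/= mulr1 (addrC h) distrC.
  have -> : h^-1 * (f (x + h) - f x) - g x = h^-1 * (f (x + h) - f x - h * g x).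
    by field.
  rewrite normrM normfV ler_pdivrMl ?normr_gt0//.
  apply: le_trans (H x h) _.
  rewrite -(real_normK (num_real h)) expr2 mulrCA ler_wpM2l//.
  apply: (@le_trans _ _ ((C + 1) * `|h|)); first by rewrite ler_wpM2r// lerDl.
  rewrite -ler_pdivlMl// mulrC; near: h; apply: dnbhs0_le.
  by rewrite divr_gt0.
apply: DeriveDef; first by apply/cvg_ex; exists (g x).
exact/cvg_lim.
Unshelve. all: by end_near. Qed.

Lemma is_derive_affine u v : (forall x, is_derive x 1 u (v x)) ->
  forall a b x, is_derive x 1 (fun x => u (a * x - b)) (a * v (a * x - b)).
Proof.
move=> uv a b x; rewrite mulrC.
have h : is_derive x 1 (fun x : R => a * x - b) a.
  by apply: (@taylor_is_derive _ (cst a) 0) => y k; rewrite mul0r normr_le0 /=; apply/eqP; ring.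
exact: (@is_derive1_comp _ u).
Qed.

Lemma is_derive_psum u v N x : (forall x, is_derive x 1 u (v x)) ->
  is_derive x 1 (psum u N) (psum v N x).
Proof.
move=> uv.
have -> : psum u N = \sum_(i < N.*2.+1) (fun x => u (x + i%:R - N%:R)).
  by apply/funext => y; rewrite /psum fct_sumE.
apply: is_derive_sum => i.
have /(_ 1 (N%:R - i%:R) x) := is_derive_affine uv.
rewrite mul1r; congr (is_derive _ _ _ (v _)); last by rewrite mul1r; ring.
by apply/funext => y; congr u; ring.
Qed.

Lemma periodize_lipschitz u v C C' : (forall x, is_derive x 1 u (v x)) ->
  tame C u -> tame C' v ->
  forall x y, `|periodize u x - periodize u y| <= 8 * C' * `|x - y|.
Proof.
move=> uv hu hv x y.
apply: (@cvgn_le _ (fun N => `|psum u N x - psum u N y|)).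
  by apply: cvg_norm; apply: cvgB; exact: cvg_periodize hu.
move=> N; apply: derive_lipschitz; first by move=> z; exact: is_derive_psum.
by move=> z; apply: le_trans (psum_norm _ _ _) (psum_tame _ _ hv).
Qed.

(** Termwise differentiation: the partial sums satisfy a second order Taylor
    bound with a common constant, which passes to the pointwise limit. *)
Lemma is_derive_periodize u v w C C' C'' : (forall x, is_derive x 1 u (v x)) ->
  (forall x, is_derive x 1 v (w x)) ->
  tame C u -> tame C' v -> tame C'' w ->
  forall x, is_derive x 1 (periodize u) (periodize v x).
Proof.
move=> uv vw hu hv hw; apply: (@taylor_is_derive _ _ (8 * C'')) => x h.
apply: (@cvgn_le _ (fun N => `|psum u N (x + h) - psum u N x - h * psum v N x|)).
  apply: cvg_norm; apply: cvgB.
    by apply: cvgB; exact: cvg_periodize hu.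
  by apply: cvgMr; exact: cvg_periodize hv.
move=> N; apply: derive_taylor; first by move=> z; exact: is_derive_psum.
apply: derive_lipschitz; first by move=> z; exact: is_derive_psum.
by move=> z; apply: le_trans (psum_norm _ _ _) (psum_tame _ _ hw).
Qed.

End periodization_derivative.

(** * Integration on the line and over one period *)

Section real_integral.
Context d (T : measurableType d) {R : realType}.
Variable mu : {measure set T -> \bar R}.
Implicit Types (f g : T -> R) (D : set T).

Lemma integrable_mfun D f : mu.-integrable D (EFin \o f) -> measurable_fun D f.
Proof. by move=> /measurable_int /measurable_EFinP. Qed.

Lemma le_integrable_real D f g : measurable D -> measurable_fun D f ->
  (forall x, D x -> `|f x| <= g x) -> mu.-integrable D (EFin \o g) ->
  mu.-integrable D (EFin \o f).
Proof.
move=> mD mf fg; apply: le_integrable => //; first exact/measurable_EFinP.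
move=> x Dx; rewrite /= lee_fin; apply: le_trans (fg x Dx) (ler_norm _).
Qed.

Lemma integrable_mulbd D f g B : measurable D -> measurable_fun D f ->
  (forall x, D x -> `|f x| <= B) -> mu.-integrable D (EFin \o g) ->
  mu.-integrable D (EFin \o (fun x => f x * g x)).
Proof.
move=> mD mf fB ig.
apply: (@le_integrable_real _ _ (fun x => B * `|g x|)) => //.
- by apply: measurable_funM => //; exact: integrable_mfun ig.
- by move=> x Dx; rewrite normrM ler_wpM2r// fB.
have := integrableZl mD B (integrable_norm ig).
by congr (mu.-integrable _ _); apply/funext => x; rewrite /= EFinM.
Qed.

Lemma integrable_mulr D f a : measurable D -> mu.-integrable D (EFin \o f) ->
  mu.-integrable D (EFin \o (fun x => a * f x)).
Proof.
move=> mD fi; have := integrableZl mD a fi.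
by congr (mu.-integrable _ _); apply/funext => x; rewrite /= EFinM.
Qed.

Lemma integrable_add D f g : measurable D -> mu.-integrable D (EFin \o f) ->
  mu.-integrable D (EFin \o g) -> mu.-integrable D (EFin \o (fun x => f x + g x)).
Proof.
by move=> mD fi gi; have := integrableD mD fi gi.
Qed.

Lemma integrable_subr D f g : measurable D -> mu.-integrable D (EFin \o f) ->
  mu.-integrable D (EFin \o g) -> mu.-integrable D (EFin \o (fun x => f x - g x)).
Proof.
by move=> mD fi gi; have := integrableB mD fi gi.
Qed.

Lemma integrable_sumr (I : Type) (s : seq I) D (f : I -> T -> R) : measurable D ->
  (forall i, mu.-integrable D (EFin \o f i)) ->
  mu.-integrable D (EFin \o (fun x => \sum_(i <- s) f i x)).
Proof.
move=> mD fi; have := integrable_sum mD s (P := xpredT) (fun i _ => fi i).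
by congr (mu.-integrable _ _); apply/funext => x; rewrite /= sumEFin.
Qed.

Lemma Rintegral_sum (I : Type) (s : seq I) D (f : I -> T -> R) : measurable D ->
  (forall i, mu.-integrable D (EFin \o f i)) ->
  \int[mu]_(x in D) (\sum_(i <- s) f i x) = \sum_(i <- s) \int[mu]_(x in D) f i x.
Proof.
move=> mD fi; elim: s => [|i s IHs].
  rewrite big_nil (_ : (fun x => _) = cst 0) ?Rintegral_cst//; last first.
    by apply/funext => x; rewrite big_nil.
  by rewrite mul0r.
rewrite big_cons -IHs -RintegralD//; last exact: integrable_sumr.
by apply: eq_Rintegral => x _; rewrite big_cons.
Qed.

Lemma le_norm_Rintegral D f g : measurable D -> measurable_fun D f ->
  (forall x, D x -> `|f x| <= g x) -> mu.-integrable D (EFin \o g) ->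
  `|\int[mu]_(x in D) f x| <= \int[mu]_(x in D) g x.
Proof.
move=> mD mf fg ig; have fi := le_integrable_real mD mf fg ig.
apply: le_trans (le_normr_Rintegral mD fi) _.
by apply: le_Rintegral => //; exact: (integrable_norm fi).
Qed.

Lemma dominated_cvg_real D (f_ : nat -> T -> R) f g : measurable D ->
  (forall n, measurable_fun D (f_ n)) -> measurable_fun D f ->
  (forall x, D x -> f_ n x @[n --> \oo] --> f x) ->
  mu.-integrable D (EFin \o g) -> (forall n x, D x -> `|f_ n x| <= g x) ->
  \int[mu]_(x in D) f_ n x @[n --> \oo] --> \int[mu]_(x in D) f x.
Proof.
move=> mD mf_ mf ff gi fg.
have [//|//||||i _ h] := @dominated_convergence _ _ _ mu D mD (fun n => EFin \o f_ n) (EFin \o f) (EFin \o g).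
- by move=> n; exact/measurable_EFinP.
- exact/measurable_EFinP.
- by apply: aeW => x Dx; apply/fine_cvgP; split; [exact: nearW | exact: ff].
- exact: gi.
- by apply: aeW => x n Dx; rewrite /= lee_fin; exact: fg.
rewrite /Rintegral; apply: fine_cvg.
rewrite fineK//; exact: integrable_fin_num.
Qed.

End real_integral.

Section probability_integral.
Context {R : realType}.

Lemma Rintegral_cst1 d (T : measurableType d) (P : probability T R) (c : R) :
  \int[P]_x c = c.
Proof.
rewrite (_ : (fun=> c) = cst c)// Rintegral_cst//.
apply: (@eq_trans _ _ (c * fine 1%E)); last by rewrite mulr1.
by congr (_ * fine _); exact: probability_setT.
Qed.

Lemma integrable_bounded d (T : measurableType d) (P : probability T R) (f : T -> R) B :
  measurable_fun setT f -> (forall x, `|f x| <= B) -> P.-integrable setT (EFin \o f).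
Proof.
move=> mf fB; apply: (@le_integrable_real _ _ _ P _ _ (cst B)) => //.
exact: finite_measure_integrable_cst.
Qed.

End probability_integral.
Arguments integrable_bounded {R d T P f B} _ _.

Section lebesgue_affine.
Context {R : realType}.
Local Notation leb := (@lebesgue_measure R).
Variables (a b : R).
Hypothesis a_gt0 : 0 < a.

Let aff (x : measurableTypeR R) : measurableTypeR R := a * x + b.

Let measurable_aff : measurable_fun setT aff.
Proof. by apply: measurable_funD => //; exact: measurable_funM. Qed.

Let push : {measure set (measurableTypeR R) -> \bar R}.
Proof.
refine [the {measure set (measurableTypeR R) -> \bar R} of pushforward leb aff].
exact: measurable_aff.
Defined.

Let scaled : {measure set (measurableTypeR R) -> \bar R} :=
  mscale (NngNum (ltW a_gt0)) push.

(** By uniqueness of the Lebesgue measure it is enough to compare the two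
    measures on half-open intervals. *)
Lemma lebesgue_affine (A : set (measurableTypeR R)) : measurable A ->
  leb A = scaled A.
Proof.
apply: lebesgue_measure_unique => X [[u v] /= _ <-].
rewrite /scaled/= /mscale/= /pushforward/=.
have -> : aff @^-1` `]u, v]%classic = `](u - b) / a, (v - b) / a]%classic.
  apply/seteqP; split => x /=; rewrite !in_itv/= /aff.
    by rewrite ltr_pdivrMr// ler_pdivlMr// ltrBlDr lerBrDr mulrC.
  by rewrite ltr_pdivrMr// ler_pdivlMr// ltrBlDr lerBrDr mulrC.
rewrite !lebesgue_measure_itv/= !lte_fin ltr_pM2r ?invr_gt0// ltrD2r.
case: ifP => // _; last by rewrite mule0.
by rewrite -!EFinB -EFinM; congr (_%:E); field; rewrite gt_eqF.
Qed.

Lemma ge0_integral_affine (f : R -> \bar R) : measurable_fun setT f ->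
  (forall x, 0 <= f x)%E ->
  (\int[leb]_x f x = a%:E * \int[leb]_x f (a * x + b)%R)%E.
Proof.
move=> mf f0.
rewrite (eq_measure_integral scaled); last by move=> A mA _; exact: lebesgue_affine.
rewrite ge0_integral_mscale//= ge0_integral_pushforward//.
Qed.

Lemma integrable_affine (f : R -> R) : leb.-integrable setT (EFin \o f) ->
  leb.-integrable setT (EFin \o (fun x => f (a * x + b))).
Proof.
move=> /integrableP[mf fi].
have mf' : measurable_fun setT f by exact/measurable_EFinP.
apply/integrableP; split.
  by apply/measurable_EFinP; apply: (measurableT_comp mf').
have mn : measurable_fun setT (fun x => `|f x|%:E).
  by apply/measurable_EFinP; exact: measurableT_comp.
move: fi; rewrite /= (@ge0_integral_affine (fun x => `|f x|%:E) mn) => [h|x]; last first.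
  by rewrite lee_fin.
rewrite ltNge leye_eq; apply/negP => /eqP e.
by move: h; rewrite e gt0_muley ?lte_fin// ltxx.
Qed.

Lemma Rintegral_affine (f : R -> R) : leb.-integrable setT (EFin \o f) ->
  \int[leb]_x f (a * x + b) = a^-1 * \int[leb]_x f x.
Proof.
move=> fi.
have mf := measurable_int _ fi.
suff e : (\int[leb]_x (f x)%:E = a%:E * \int[leb]_x (f (a * x + b))%:E)%E.
  rewrite /Rintegral e fineM//= ?mulKf ?gt_eqF//.
  by apply: integrable_fin_num => //; exact: integrable_affine.
have fi' := integrable_affine fi.
rewrite integralE (ge0_integral_affine (f := (_^\+)%E))//; last exact: measurable_funepos.
rewrite (ge0_integral_affine (f := (_^\-)%E))//; last exact: measurable_funeneg.
set p := (X in (_ * X - _ = _)%E); set n := (X in (_ - _ * X = _)%E).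
have -> : (\int[leb]_x (f (a * x + b))%:E = p - n)%E.
  by apply: (eq_trans (integralE _ _ _)); congr (_ - _)%E; apply: eq_integral => x _;
    rewrite ?funeposE ?funenegE.
have nfin : n \is a fin_num.
  have := integrable_neg_fin_num measurableT fi'; congr (_ \is a fin_num).
  by apply: eq_integral => x _; rewrite ?funenegE.
clearbody p n => {mf fi fi'}.
by rewrite muleBr// fin_num_adde_defl// fin_numN.
Qed.

End lebesgue_affine.

Section unit_interval.
Context {R : realType}.
Local Notation leb := (@lebesgue_measure R).
Local Notation U := (uniform_prob (@ltr01 R)).

Lemma Rintegral_uniform (f : R -> R) : measurable_fun setT f ->
  \int[U]_x f x = \int[leb]_(x in `[0, 1[) f x.
Proof.
move=> mf.
have mfE : measurable_fun setT (EFin \o f) by exact/measurable_EFinP.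
rewrite /Rintegral; congr fine.
rewrite integral_itv_bndo_bndc; last by apply: (measurable_funS measurableT).
rewrite integralE [RHS]integralE.
have h (g : R -> \bar R) : measurable_fun setT g -> (forall x, 0 <= g x)%E ->
    (\int[U]_x g x = \int[leb]_(x in `[0%R, 1%R]) g x)%E.
  by move=> mg g0; rewrite integral_uniform// subr0 invr1 mul1e.
by rewrite !h//; [exact: measurable_funeneg | exact: measurable_funepos].
Qed.

Lemma measurable_decay : measurable_fun setT (@decay R).
Proof.
apply: continuous_measurable_fun => x.
apply: cvgV; first by rewrite gt_eqF// exprn_gt0// ltr_pwDl.
apply: (@cvg_comp _ _ _ (fun x : R => 1 + `|x|) (fun y => y ^+ 2)); last exact: sqr_continuous.
by apply: cvgD; [exact: cvg_cst | exact: cvg_norm].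
Qed.

(** [decay] is dominated by 1 / (1 + x^2), whose primitive is the bounded
    function atan. *)
Lemma integrable_decay : leb.-integrable setT (EFin \o @decay R).
Proof.
have mb : measurable_fun setT (EFin \o @decay R).
  by apply/measurable_EFinP; exact: measurable_decay.
apply/integrableP; split => //.
under eq_integral do rewrite /= ger0_norm ?decay_ge0//.
apply: (@le_lt_trans _ _ (\int[leb]_x ((oneDsqr x)^-1)%:E)%E).
  apply: ge0_le_integral => //=.
  - by move=> x _; rewrite lee_fin decay_ge0.
  - by apply/measurable_EFinP; apply: continuous_measurable_fun; exact: continuous_oneDsqrV.
  - move=> x _; rewrite lee_fin /decay lef_pV2 ?posrE ?exprn_gt0 ?ltr_pwDl ?oneDsqr_gt0//.
    rewrite /oneDsqr -(real_normK (num_real x)) sqrrD expr1n mul1r lerD2r lerDl.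
      by rewrite mulrn_wge0// normr_ge0.
    exact: (sqr_ge0 (x : R)).
rewrite ge0_symfun_integralT.
- rewrite -set_itvcy integral0y_oneDsqr -EFinM ltry//.
- by move=> x; rewrite invr_ge0 ltW// oneDsqr_gt0.
- exact: continuous_oneDsqrV.
- by move=> x; rewrite /oneDsqr/= sqrrN.
Qed.

Lemma integrable_tame (C : R) (u : R -> R) : measurable_fun setT u -> tame C u ->
  leb.-integrable setT (EFin \o u).
Proof.
move=> mu hu; apply: (@le_integrable_real _ _ _ leb _ _ (fun x => C * decay x)) => //.
exact: integrable_mulr integrable_decay.
Qed.

Lemma measurable_psum (u : R -> R) N : measurable_fun setT u ->
  measurable_fun setT (psum u N).
Proof.
move=> mu; apply: measurable_sum => i.
by apply: (measurableT_comp mu); apply: measurable_funB => //; exact: measurable_funD.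
Qed.

Lemma measurable_periodize (C : R) (u : R -> R) : measurable_fun setT u -> tame C u ->
  measurable_fun setT (periodize u).
Proof.
move=> mu hu; apply: (@measurable_fun_cvg _ _ _ _ (psum u)).
- by move=> N; exact: measurable_psum.
- by move=> x _; exact: cvg_periodize hu.
Qed.

Lemma sum_indic_itv (n : nat) (a x : R) :
  \sum_(i < n) (\1_(`[a + i%:R, a + i%:R + 1[%classic : set R) x : R) = \1_(`[a, a + n%:R[%classic : set R) x.
Proof.
rewrite indicE; elim: n => [|n IHn].
  by rewrite big_ord0 addr0 memNset//= in_itv/=; case: ltgtP.
rewrite big_ord_recr/= IHn indicE -natr1 addrA -natrD; congr (_%:R).
rewrite !mem_setE !in_itv/=; have := ler0n R n.
by case: (lerP a x) => ?; case: (ltrP x (a + n%:R)) => ? ?;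
  case: (ltrP x (a + n%:R + 1)) => ? //=; rewrite ?(_ : a + n%:R <= x) ?(_ : a + n%:R <= x = false)//;
  try (exfalso; lra); try lra; apply/negbTE; rewrite -ltNge; lra.
Qed.

(** Unfolding: integrating a periodised function against a periodic one over a
    period amounts to integrating over the whole line. *)
Lemma integral_periodize (C B : R) (u v : R -> R) :
  measurable_fun setT u -> tame C u ->
  measurable_fun setT v -> (forall x, `|v x| <= B) -> (forall x, v (x + 1) = v x) ->
  \int[U]_x (periodize u x * v x) = \int[leb]_x (u x * v x).
Proof.
move=> mu hu mv vB v1.
have B0 : 0 <= B := le_trans (normr_ge0 _) (vB 0).
have vz (i N : nat) x : v (x + i%:R - N%:R) = v x.
  by rewrite -(periodic1_natr N _ v1) subrK periodic1_natr.
have iuv : leb.-integrable setT (EFin \o (fun x => u x * v x)).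
  have := @integrable_mulbd _ _ _ leb _ _ _ _ measurableT mv (fun x _ => vB x) (integrable_tame mu hu).
  by congr (leb.-integrable _ _); apply/funext => x /=; rewrite mulrC.
rewrite Rintegral_uniform; last first.
  by apply: measurable_funM => //; exact: measurable_periodize hu.
have mI : measurable (`[0, 1[%classic : set R) by exact: measurable_itv.
have mpv N : measurable_fun setT (fun x => psum u N x * v x).
  by apply: measurable_funM => //; exact: measurable_psum.
have c1 : \int[leb]_(x in `[0, 1[) (psum u N x * v x) @[N --> \oo] -->
    \int[leb]_(x in `[0, 1[) (periodize u x * v x).
  apply: (@dominated_cvg_real _ _ _ _ _ _ _ (cst (8 * C * B))) => //.
  - by move=> n; apply: (measurable_funS measurableT) => //; exact: mpv.
  - by apply: (measurable_funS measurableT) => //; apply: measurable_funM => //; exact: measurable_periodize hu.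
  - by move=> x _; apply: cvgMl; exact: cvg_periodize hu.
  - apply: measurable_bounded_integrable => //.
      by rewrite /= lebesgue_measure_itv/= lte_fin ltr01 -EFinB ltry.
    exact: bounded_cst.
  - move=> N x _; rewrite normrM ler_pM//.
    exact: le_trans (psum_norm _ _ _) (psum_tame _ _ hu).
(* translating the terms of the window glues the unit intervals together into
   the interval from - N to N + 1 *)
have e1 N : \int[leb]_(x in `[0, 1[) (psum u N x * v x) =
    \int[leb]_x (\1_(`[- N%:R, - N%:R + (N.*2.+1)%:R[%classic : set R) x * (u x * v x)).
  transitivity (\int[leb]_x (\sum_(i < N.*2.+1)
     \1_(`[- N%:R + i%:R, - N%:R + i%:R + 1[%classic : set R) x * (u x * v x))); last first.
    by apply: eq_Rintegral => x _; rewrite -mulr_suml sum_indic_itv.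
  have ii (a b : R) : leb.-integrable setT (EFin \o (fun x => \1_(`[a, b[%classic : set R) x * (u x * v x))).
    apply: (@integrable_mulbd _ _ _ leb _ _ _ 1) => // x _.
    by rewrite indicE; case: (_ \in _); rewrite ?normr1 ?normr0.
  rewrite Rintegral_sum//.
  transitivity (\int[leb]_x (\sum_(i < N.*2.+1)
     (\1_(`[- N%:R + i%:R, - N%:R + i%:R + 1[%classic : set R) (1 * x + (i%:R - N%:R)) *
       (u (1 * x + (i%:R - N%:R)) * v (1 * x + (i%:R - N%:R)))))).
    rewrite Rintegral_mkcond; apply: eq_Rintegral => x _; rewrite patchE.
    case: ifPn => [|]; rewrite mem_setE in_itv/= => h.
      rewrite mulr_suml; apply: eq_bigr => i _.
      rewrite indicE mem_setE in_itv/= mul1r !addrA vz.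
      rewrite (_ : _ <= _ < _) ?mul1r//.
      by move: h => /andP[h0 h1]; apply/andP; split; lra.
    rewrite big1// => i _; rewrite indicE mem_setE in_itv/= mul1r.
    rewrite (_ : _ <= _ < _ = false) ?mul0r//; apply: contraNF h => /andP[h0 h1].
    by apply/andP; split; lra.
  rewrite Rintegral_sum//; last first.
    by move=> i; exact: (integrable_affine (i%:R - N%:R) ltr01 (ii _ _)).
  by apply: eq_bigr => i _; rewrite (Rintegral_affine _ ltr01 (ii _ _)) invr1 mul1r.
have c2 : \int[leb]_x (\1_(`[- N%:R, - N%:R + (N.*2.+1)%:R[%classic : set R) x * (u x * v x)) @[N --> \oo]
    --> \int[leb]_x (u x * v x).
  apply: (@dominated_cvg_real _ _ _ leb setT (fun N x =>
    \1_(`[- N%:R, - N%:R + (N.*2.+1)%:R[%classic : set R) x * (u x * v x))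
    (fun x => u x * v x) (fun x => `|u x * v x|)) => //.
  - by move=> n; apply: measurable_funM => //; exact: measurable_funM.
  - exact: measurable_funM.
  - move=> x _; apply: cvg_near_cst; near=> N.
    rewrite indicE mem_setE in_itv/= (_ : _ <= _ < _) ?mul1r//.
    have xN : `|x| <= N%:R by near: N; exact: nbhs_infty_ger.
    have := ler_norm x; have := ler_norm (- x); rewrite normrN => h1 h2.
    rewrite -natr1 -muln2 natrM; apply/andP; split; lra.
  - exact: integrable_norm iuv.
  - move=> N x _; rewrite normrM ler_piMl// indicE.
    by case: (_ \in _); rewrite ?normr1 ?normr0.
by move: c1; under eq_fun do rewrite e1; move=> c1; exact: (cvg_unique _ c1 c2).
Unshelve. all: by end_near. Qed.

End unit_interval.

(** * The two-scale expansion on the line *)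

Section scaling.
Context {R : realType}.
Local Notation leb := (@lebesgue_measure R).
Implicit Types (u v : R -> R).

Lemma sqrt2X j : Num.sqrt 2 ^+ j * Num.sqrt 2 ^+ j = 2 ^+ j :> R.
Proof. by rewrite -exprMn -expr2 sqr_sqrtr. Qed.

Lemma dilateD u J j k x : dilate u (J + j) k x = Num.sqrt 2 ^+ J * dilate u j k (2 ^+ J * x).
Proof. by rewrite /dilate exprD mulrA [2 ^+ (J + j)]exprD mulrCA mulrA. Qed.

Lemma measurable_dilate u j (k : int) : measurable_fun setT u ->
  measurable_fun setT (dilate u j k).
Proof.
move=> mu; apply: measurable_funM => //; apply: (measurableT_comp mu).
by apply: measurable_funB => //; exact: measurable_funM.
Qed.

Lemma integrable_mul_tame C C' u v : measurable_fun setT u -> tame C u ->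
  measurable_fun setT v -> tame C' v -> leb.-integrable setT (EFin \o (fun x => u x * v x)).
Proof.
move=> mu hu mv hv.
exact: (@integrable_mulbd _ _ _ leb _ _ _ C measurableT mu (fun x _ => tame_bound x hu) (integrable_tame mv hv)).
Qed.

(** Dilation by 2 ^ J is unitary. *)
Lemma integral_dilate C C' u v J i j k m : measurable_fun setT u -> tame C u ->
  measurable_fun setT v -> tame C' v ->
  \int[leb]_x (dilate u (J + i) k x * dilate v (J + j) m x) =
  \int[leb]_x (dilate u i k x * dilate v j m x).
Proof.
move=> mu hu mv hv; have p0 : 0 < 2 ^+ J :> R by rewrite exprn_gt0.
have ii : leb.-integrable setT (EFin \o (fun x => dilate u i k x * dilate v j m x)).
  exact: (integrable_mul_tame (measurable_dilate _ _ mu) (tame_dilate _ _ hu)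
    (measurable_dilate _ _ mv) (tame_dilate _ _ hv)).
transitivity (2 ^+ J * \int[leb]_x (dilate u i k (2 ^+ J * x + 0) * dilate v j m (2 ^+ J * x + 0))).
  rewrite -RintegralZl//; last exact: (integrable_affine 0 p0 ii).
  by apply: eq_Rintegral => x _; rewrite addr0 !dilateD -sqrt2X; ring.
by rewrite (Rintegral_affine 0 p0 ii) mulVKf// gt_eqF.
Qed.

(** Otherwise g would be nonzero on a ball, which has positive measure. *)
Lemma continuous_ae0 (g : R -> R) : continuous g ->
  {ae leb, forall x, g x = 0} -> forall x, g x = 0.
Proof.
move=> cg [N [mN N0 gN]] x; apply/eqP; apply: contraT => gx.
have [e /= e0 he] : nbhs x [set y | g y != 0].
  have /cvgr_neq0 := cg x; apply => //.
have : (leb (ball x e) <= leb N)%E.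
  apply: le_measure; rewrite ?inE//; first exact: measurable_ball.
  by move=> y /he /= gy; apply: gN => /= gy0; rewrite gy0 eqxx in gy.
by rewrite N0 lebesgue_measure_ball ?(ltW e0)// lee_fin leNgt pmulrn_lgt0// e0.
Qed.

Lemma lipschitz_continuous (g : R -> R) C :
  (forall x y, `|g x - g y| <= C * `|x - y|) -> continuous g.
Proof.
move=> gC x; have C0 : 0 <= C by have := le_trans (normr_ge0 _) (gC 1 0); rewrite subr0 normr1 mulr1.
apply/cvgrPdist_le => e e0; near=> y.
apply: le_trans (gC _ _) _; apply: (@le_trans _ _ ((C + 1) * `|x - y|)).
  by rewrite ler_wpM2r// lerDl.
rewrite -ler_pdivlMl ?ltr_wpDl// mulrC; near: y.
by apply: cvgr_dist_le; [exact: cvg_id | rewrite divr_gt0// ltr_wpDl].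
Unshelve. all: by end_near. Qed.

Lemma tame_Lfun2 C u : measurable_fun setT u -> tame C u -> u \in Lfun leb 2%:E.
Proof.
move=> mu hu; rewrite inE; apply/andP; split; rewrite inE//=.
rewrite /finite_norm unlock /Lnorm poweR_lty//.
have := integrable_mul_tame mu hu mu hu => /integrableP[_].
apply: le_lt_trans; apply: eq_ler.
apply: eq_integral => x _; rewrite /= powR_mulrn// normrM expr2//.
Qed.

End scaling.

Section two_scale.
Context {R : realType}.
Local Notation leb := (@lebesgue_measure R).
Variables (phi psi : R -> R).
Hypothesis basis : orthonormal_basis leb (wavelet_system phi psi).
Variables (Cphi Cpsi : R).
Hypotheses (hphi : tame Cphi phi) (hpsi : tame Cpsi psi).
Hypotheses (mphi : measurable_fun setT phi) (mpsi : measurable_fun setT psi).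

Lemma inner_phi_phi J k m :
  \int[leb]_x (dilate phi J k x * dilate phi J m x) = (k == m)%:R.
Proof.
rewrite -(addn0 J) (integral_dilate _ _ _ _ _ mphi hphi mphi hphi).
by have [_ /(_ (inl k) (inl m))] := basis.
Qed.

Lemma inner_psi_psi J k m :
  \int[leb]_x (dilate psi J k x * dilate psi J m x) = (k == m)%:R.
Proof.
have [_ /(_ (inr (J, k)) (inr (J, m))) + _] := basis; rewrite /inner/= => ->.
by congr (nat_of_bool _)%:R; apply/eqP/eqP => [[//]|->].
Qed.

Lemma inner_phi_psi J j k m :
  \int[leb]_x (dilate phi J k x * dilate psi (J + j) m x) = 0.
Proof.
rewrite -{1}(addn0 J) (integral_dilate _ _ _ _ _ mphi hphi mpsi hpsi).
by have [_ /(_ (inl k) (inr (j, m)))] := basis.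
Qed.

(** The system that starts at level one is the dilate of the given basis, hence
    it is complete as well. *)
Lemma level1_complete C r : continuous r -> tame C r ->
  (forall k, \int[leb]_x (dilate phi 1 k x * r x) = 0) ->
  (forall j k, \int[leb]_x (dilate psi j.+1 k x * r x) = 0) ->
  forall x, r x = 0.
Proof.
move=> cr hr rphi rpsi.
have mr : measurable_fun setT r by exact: continuous_measurable_fun.
have h0 : (0 : R) < 2^-1 by [].
have half u Cu j k : measurable_fun setT u -> tame Cu u ->
    \int[leb]_x (dilate u j k x * r (2^-1 * x + 0)) =
    Num.sqrt 2 * \int[leb]_x (dilate u j.+1 k x * r x).
  move=> mu hu.
  have ii : leb.-integrable setT (EFin \o (fun x => dilate u j.+1 k x * r x)).
    exact: (integrable_mul_tame (measurable_dilate _ _ mu) (tame_dilate _ _ hu) mr hr).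
  transitivity ((Num.sqrt 2)^-1 * \int[leb]_x (dilate u j.+1 k (2^-1 * x + 0) * r (2^-1 * x + 0))).
    rewrite -RintegralZl//; last exact: (integrable_affine 0 h0 ii).
    apply: eq_Rintegral => x _; rewrite addr0 -[j.+1]add1n dilateD !expr1.
    by rewrite mulVKf ?pnatr_eq0// !mulrA mulVf ?mul1r// gt_eqF// sqrtr_gt0.
  rewrite (Rintegral_affine 0 h0 ii) invrK mulrA; congr (_ * _).
  apply: (mulfI (x := Num.sqrt 2)); first by rewrite gt_eqF// sqrtr_gt0.
  rewrite mulrA mulfV ?mul1r; first by rewrite -expr2 sqr_sqrtr.
  by rewrite gt_eqF// sqrtr_gt0.
have r0 : {ae leb, forall x, r (2^-1 * x + 0) = 0}.
  have [_ _ h] := basis; apply: (h (fun x => r (2^-1 * x + 0))).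
    have hr2 : tame (4 * C) (fun x => r (2^-1 * x + 0)).
      move=> x; apply: le_trans (hr _) _; rewrite addr0 mulrC -mulrA mulrCA.
      rewrite mulrC ler_wpM2l ?(tame_ge0 hr)//.
      by have := decay_double (2^-1 * x); rewrite mulVKf ?pnatr_eq0.
    apply: tame_Lfun2 hr2; apply: (measurableT_comp mr).
    by apply: measurable_funD => //; exact: measurable_funM.
  case=> [k|[j k]] /=; rewrite /inner.
    by rewrite (half _ _ _ _ mphi hphi) rphi mulr0.
  by rewrite (half _ _ _ _ mpsi hpsi) rpsi mulr0.
move=> x; have := @continuous_ae0 _ (fun x => r (2^-1 * x + 0)) _ r0 (2 * x).
rewrite mulKf ?pnatr_eq0// addr0; apply => y.
apply: (@continuous_comp R R R (fun x => 2^-1 * x + 0) r); last exact: cr.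
apply: cvgD; last exact: cvg_cst.
by apply: cvgMr; exact: cvg_id.
Qed.

Section expansion.
Variables (phi' u : R -> R) (C4 C' Cu : R).
Hypotheses (dphi : forall x : R, is_derive x 1 phi (phi' x)) (hphi' : tame C' phi').
Hypotheses (C4_ge0 : 0 <= C4) (hphi4 : forall x, `|phi x| <= C4 * decay x ^+ 2).
Hypotheses (Cu_ge0 : 0 <= Cu) (hu6 : forall x, `|u x| <= Cu * decay x ^+ 3).
Hypotheses (cu : continuous u).

Let mu : measurable_fun setT u. Proof. exact: continuous_measurable_fun. Qed.

Let hu : tame Cu u.
Proof.
by move=> x; apply: le_trans (hu6 x) _; rewrite ler_wpM2l// decayX_le.
Qed.

(** The coefficient of u on the translate by t of the scaling function of level
    one. With t real instead of an integer the expansion becomes a periodisation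
    in t, taken at 0, to which the bounds on periodised tame functions apply. *)
Definition coef (t : R) : R := \int[leb]_y (u y * (Num.sqrt 2 * phi (2 * y - t))).

Let term x t := coef t * (Num.sqrt 2 * phi (2 * x - t)).

Definition expansion_sum N x := psum (term x) N 0.
Let F := expansion_sum.
Let Su x := periodize (term x) 0.

Let K := 64 * Cu * (Num.sqrt 2 * C4) * \int[leb]_y decay (2 * y).

Let idecay2 : leb.-integrable setT (EFin \o (fun y => decay (2 * y))).
Proof.
have := integrable_affine 0 (ltr0n R 2) (integrable_decay (R := R)).
by congr (leb.-integrable _ _); apply/funext => y /=; rewrite addr0.
Qed.

Let K_ge0 : 0 <= K.
Proof.
by rewrite !mulr_ge0 ?sqrtr_ge0// Rintegral_ge0// => y _; exact: decay_ge0.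
Qed.

(** The bumps of u and of the translate are centred at distances comparable with
    t, so by [decay_mul] a factor that decays in t can be pulled out of the
    integral. *)
Lemma coef_bound t : `|coef t| <= K * decay t ^+ 2.
Proof.
pose g y := 64 * Cu * (Num.sqrt 2 * C4) * decay t ^+ 2 * decay (2 * y).
have -> : K * decay t ^+ 2 = \int[leb]_y g y.
  by rewrite /g RintegralZl// /K; ring.
apply: (@le_norm_Rintegral _ _ _ leb) => //.
- apply: measurable_funM => //; apply: measurable_funM => //; apply: (measurableT_comp mphi).
  by apply: measurable_funB => //; exact: measurable_funM.
- move=> y _; rewrite normrM normrM (ger0_norm (sqrtr_ge0 _)).
  apply: (@le_trans _ _ ((Cu * (4 * decay (2 * y)) ^+ 3) * (Num.sqrt 2 * (C4 * decay (2 * y - t) ^+ 2)))).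
    apply: ler_pM => //; last by rewrite ler_wpM2l ?sqrtr_ge0.
    apply: le_trans (hu6 y) _; rewrite ler_wpM2l// lerXn2r ?nnegrE ?mulr_ge0 ?decay_ge0//.
    exact: decay_double.
  have -> : (Cu * (4 * decay (2 * y)) ^+ 3) * (Num.sqrt 2 * (C4 * decay (2 * y - t) ^+ 2)) =
    64 * Cu * (Num.sqrt 2 * C4) * (decay (2 * y) * decay (2 * y - t)) ^+ 2 * decay (2 * y) by ring.
  rewrite /g ler_wpM2r ?decay_ge0// ler_wpM2l ?mulr_ge0 ?sqrtr_ge0//.
  rewrite lerXn2r ?nnegrE ?mulr_ge0 ?decay_ge0//.
  apply: le_trans (decay_mul _ _) _.
  by rewrite (_ : 2 * y - (2 * y - t) = t)//; ring.
- exact: (@integrable_mulr _ _ _ leb).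
Qed.

Let K' := K * Num.sqrt 2 * C4.

Let K'_ge0 : 0 <= K'. Proof. exact: mulr_ge0 (mulr_ge0 K_ge0 (sqrtr_ge0 _)) C4_ge0. Qed.

(** One power of [decay t] makes the series converge; the other one combines
    with the bump in 2 x - t into decay in x. *)
Let term_tame x : tame (K' * decay x) (term x).
Proof.
move=> t; rewrite /term normrM normrM (ger0_norm (sqrtr_ge0 _)).
apply: (@le_trans _ _ (K * decay t ^+ 2 * (Num.sqrt 2 * (C4 * decay (2 * x - t))))).
  apply: ler_pM; rewrite ?mulr_ge0 ?sqrtr_ge0//; first exact: coef_bound.
  rewrite ler_wpM2l ?sqrtr_ge0//; apply: le_trans (hphi4 _) _.
  by rewrite ler_wpM2l// decayX_le.
have -> : K * decay t ^+ 2 * (Num.sqrt 2 * (C4 * decay (2 * x - t))) =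
   K' * (decay (2 * x - t) * decay (- t)) * decay t by rewrite decayN /K'; ring.
rewrite ler_wpM2r ?decay_ge0// ler_wpM2l//; apply: le_trans (decay_mul _ _) _.
by rewrite opprK subrK decay_double_le.
Qed.

Let F_bound N x : `|F N x| <= 8 * K' * decay x.
Proof.
by apply: le_trans (psum_norm _ _ _) _; rewrite -mulrA; exact: psum_tame (term_tame x).
Qed.

Let Su_bound x : `|Su x| <= 8 * K' * decay x.
Proof.
apply: (@cvgn_le _ (fun N => `|F N x|)) => //.
by apply: cvg_norm; exact: cvg_periodize (term_tame x).
Qed.

Let F_lip N x y : `|F N x - F N y| <= 8 * (K * 2 * Num.sqrt 2 * C') * `|x - y|.
Proof.
apply: (@derive_lipschitz _ _ (fun x => \sum_(i < N.*2.+1) coef (0 + i%:R - N%:R) *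
   (Num.sqrt 2 * (2 * phi' (2 * x - (0 + i%:R - N%:R)))))).
  move=> z; rewrite /F /expansion_sum /psum.
  have -> : (fun x => \sum_(i < N.*2.+1) term x (0 + i%:R - N%:R)) =
      \sum_(i < N.*2.+1) (fun x => term x (0 + i%:R - N%:R)).
    by apply/funext => w; rewrite fct_sumE.
  apply: is_derive_sum => i; set t := 0 + i%:R - N%:R.
  have := is_deriveZ (coef t * Num.sqrt 2) (is_derive_affine dphi 2 t z).
  rewrite /GRing.scale/= -mulrA; congr (is_derive _ _ _ _).
  by apply/funext => w; rewrite /term mulrA.
move=> z; apply: le_trans (ler_norm_sum _ _ _) _.
apply: (@le_trans _ _ (\sum_(i < N.*2.+1) (K * 2 * Num.sqrt 2 * C') * decay (0 + i%:R - N%:R))).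
  apply: ler_sum => i _; set t := 0 + i%:R - N%:R.
  rewrite !normrM (ger0_norm (sqrtr_ge0 _)) (ger0_norm (ler0n _ 2)).
  have -> : K * 2 * Num.sqrt 2 * C' * decay t = (K * decay t) * (Num.sqrt 2 * (2 * C')) by ring.
  apply: ler_pM; rewrite ?mulr_ge0 ?sqrtr_ge0//.
    apply: le_trans (coef_bound t) _.
    by rewrite ler_wpM2l// decayX_le.
  by rewrite ler_wpM2l ?sqrtr_ge0// ler_wpM2l// (tame_bound _ hphi').
rewrite -mulr_sumr mulrC; apply: ler_wpM2r; last exact: psum_decay.
exact: mulr_ge0 (mulr_ge0 (mulr_ge0 K_ge0 (ler0n _ 2)) (sqrtr_ge0 _)) (tame_ge0 hphi').
Qed.

Let Su_continuous : continuous Su.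
Proof.
apply: (@lipschitz_continuous _ _ (8 * (K * 2 * Num.sqrt 2 * C'))) => x y.
apply: (@cvgn_le _ (fun N => `|F N x - F N y|)); last by move=> N; exact: F_lip.
by apply: cvg_norm; apply: cvgB; exact: cvg_periodize (term_tame _).
Qed.

Lemma dilate1E (i N : nat) x :
  Num.sqrt 2 * phi (2 * x - (0 + i%:R - N%:R)) = dilate phi 1 (i%:Z - N%:Z) x.
Proof. by rewrite /dilate !expr1 add0r rmorphB. Qed.

Let integral_Su v Cv : measurable_fun setT v -> tame Cv v ->
  \sum_(i < N.*2.+1) coef (0 + i%:R - N%:R) *
     (\int[leb]_x (v x * dilate phi 1 (i%:Z - N%:Z) x)) @[N --> \oo] -->
  \int[leb]_x (v x * Su x).
Proof.
move=> mv hv.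
have iv (i N : nat) : leb.-integrable setT (EFin \o (fun x => v x * dilate phi 1 (i%:Z - N%:Z) x)).
  exact: integrable_mul_tame mv hv (measurable_dilate _ _ mphi) (tame_dilate _ _ hphi).
have e N : \sum_(i < N.*2.+1) coef (0 + i%:R - N%:R) *
     (\int[leb]_x (v x * dilate phi 1 (i%:Z - N%:Z) x)) = \int[leb]_x (v x * F N x).
  under eq_bigr do rewrite -RintegralZl//.
  rewrite -Rintegral_sum//; last by move=> i; exact: (@integrable_mulr _ _ _ leb).
  apply: eq_Rintegral => x _; rewrite /F /expansion_sum /psum mulr_sumr.
  by apply: eq_bigr => i _; rewrite /term dilate1E; ring.
under eq_fun do rewrite e.
have mF N : measurable_fun setT (F N).
  apply: continuous_measurable_fun; apply: (@lipschitz_continuous _ _ (8 * (K * 2 * Num.sqrt 2 * C'))).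
  exact: F_lip.
apply: (@dominated_cvg_real _ _ _ leb setT (fun N x => v x * F N x) (fun x => v x * Su x)
   (fun x => 8 * K' * `|v x|)) => //.
- by move=> N; exact: (measurable_funM mv (mF N)).
- by apply: measurable_funM => //; exact: continuous_measurable_fun.
- by move=> x _; apply: cvgMr; exact: cvg_periodize (term_tame x).
- apply: (@integrable_mulr _ _ _ leb) => //.
  exact: integrable_norm (integrable_tame mv hv).
- move=> N x _; rewrite normrM mulrC ler_wpM2r//; apply: le_trans (F_bound N x) _.
  by apply: ler_piMr; [exact: mulr_ge0 (ler0n _ 8) K'_ge0 | exact: decay_le1].
Qed.

(** The difference of u and its expansion is orthogonal to the whole system that
    starts at level one: to the scaling functions since these are orthonormal,
    to the wavelets since both u and the expansion are. *)
Lemma two_scale : (forall j k, \int[leb]_x (dilate psi j.+1 k x * u x) = 0) ->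
  forall x, u x = Su x.
Proof.
move=> upsi x; apply/eqP; rewrite -subr_eq0; apply/eqP.
have mSu : measurable_fun setT Su by exact: continuous_measurable_fun.
have hSu : tame (8 * K') Su by exact: Su_bound.
have iB v Cv : measurable_fun setT v -> tame Cv v ->
    \int[leb]_x (v x * (u x - Su x)) = \int[leb]_x (v x * u x) - \int[leb]_x (v x * Su x).
  move=> mv hv; rewrite -RintegralB//.
  - by apply: eq_Rintegral => y _; rewrite mulrBr.
  - exact: integrable_mul_tame mv hv mu hu.
  - exact: integrable_mul_tame mv hv mSu hSu.
apply: (@level1_complete _ (fun x => u x - Su x) _ (tameB hu hSu)).
- by move=> y; apply: cvgB; [exact: cu | exact: Su_continuous].
- move=> k; rewrite (iB _ _ (measurable_dilate _ _ mphi) (tame_dilate _ _ hphi)).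
  apply/eqP; rewrite subr_eq0; apply/eqP.
  have := integral_Su (measurable_dilate 1 k mphi) (tame_dilate 1 k hphi).
  apply: cvg_unique; first exact: Rhausdorff.
  apply: cvg_near_cst; near=> N.
  have kN : (`|k| <= N)%N by near: N; exact: nbhs_infty_ge.
  have kN1 : (`|(k + N%:Z)%R| < N.*2.+1)%N by lia.
  have kN2 : (`|(k + N%:Z)%R|%:Z - N%:Z = k)%R by lia.
  rewrite (bigD1 (Ordinal kN1))//= big1 ?addr0 => [|i ik]; last first.
    rewrite inner_phi_phi (_ : (k == _) = false) ?mulr0//.
    apply/negbTE; apply: contra ik => /eqP ik; apply/eqP/val_inj => /=; lia.
  rewrite kN2 inner_phi_phi eqxx mulr1 /coef; apply: eq_Rintegral => y _.
  rewrite mulrC /dilate !expr1; congr (_ * phi (_ - _) * _).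
  by rewrite add0r -[X in _ = X%:~R]kN2 rmorphB.
- move=> j k; rewrite (iB _ _ (measurable_dilate _ _ mpsi) (tame_dilate _ _ hpsi)) upsi sub0r.
  apply/eqP; rewrite oppr_eq0; apply/eqP.
  apply: (cvgn_eq0 (integral_Su (measurable_dilate j.+1 k mpsi) (tame_dilate j.+1 k hpsi))).
  move=> N; rewrite big1// => i _.
  rewrite (_ : \int[leb]_x _ = 0) ?mulr0//.
  under eq_Rintegral do rewrite mulrC.
  by rewrite -[j.+1]add1n inner_phi_psi.
Unshelve. all: by end_near. Qed.

(** The error is measured relative to [decay] so that the periodised remainder
    is small as well. *)
Lemma two_scale_tail : (forall j k, \int[leb]_x (dilate psi j.+1 k x * u x) = 0) ->
  exists e : nat -> R, (e N @[N --> \oo] --> (0 : R)) /\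
    forall N x, `|u x - expansion_sum N x| <= e N * decay x.
Proof.
move=> upsi; exists (fun N => K' * (periodize decay 0 - psum decay N 0)); split.
  by rewrite -(mulr0 K'); apply: cvgMr; exact: cvg_psum_tail.
move=> N x; rewrite (two_scale upsi) mulrAC; exact: psum_tail (term_tame x).
Qed.

End expansion.
End two_scale.

(** * Periodic dilates and their projection kernels *)

Section periodic_dilates.
Context {R : realType}.
Local Notation leb := (@lebesgue_measure R).
Local Notation U := (uniform_prob (@ltr01 R)).
Implicit Types (u v : R -> R).

Definition pdil u (j : nat) (k : int) : R -> R := periodize (dilate u j k).

Lemma pdilS C u j k x : tame C u -> pdil u j k (x + 1) = pdil u j k x.
Proof. by move=> hu; exact: periodizeS (tame_dilate _ _ hu). Qed.

Lemma measurable_pdil C u j k : measurable_fun setT u -> tame C u ->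
  measurable_fun setT (pdil u j k).
Proof.
move=> mu hu.
exact: measurable_periodize (measurable_dilate _ _ mu) (tame_dilate _ _ hu).
Qed.

Lemma sum_pdil C u j x : tame C u ->
  \sum_(k < 2 ^ j) `|pdil u j (k : nat) x| <= 8 * C * Num.sqrt 2 ^+ j.
Proof. exact: sum_periodize_dilate. Qed.

Lemma pdil_ord C u j k : tame C u ->
  exists m : 'I_(2 ^ j), pdil u j k = pdil u j (m : nat).
Proof.
move=> hu; pose n : int := 2 ^+ j.
have n0 : n != 0 by rewrite expf_neq0.
have kn : (0 <= modz k n)%R by rewrite modz_ge0.
have kn2 : (`|modz k n| < 2 ^ j)%N.
  rewrite -ltz_nat (gez0_abs kn); have := ltz_mod k n0.
  by rewrite ger0_norm ?exprn_ge0// /n -natrX natz.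
exists (Ordinal kn2); apply/funext => x /=.
by rewrite (gez0_abs kn) {1}(divz_eq k n) mulrC addrC; exact: periodize_dilate_mod hu.
Qed.

Lemma pdil_bound C u j k x : tame C u -> `|pdil u j k x| <= 8 * C * Num.sqrt 2 ^+ j.
Proof.
move=> hu; have [m ->] := pdil_ord j k hu.
by apply: le_trans (sum_pdil j x hu); rewrite (bigD1 m)//= lerDl sumr_ge0.
Qed.

Lemma integral_pdil C B u v j k : measurable_fun setT u -> tame C u ->
  measurable_fun setT v -> (forall x, `|v x| <= B) -> (forall x, v (x + 1) = v x) ->
  \int[U]_x (pdil u j k x * v x) = \int[leb]_x (dilate u j k x * v x).
Proof.
move=> mu hu mv vB v1.
exact: integral_periodize (measurable_dilate _ _ mu) (tame_dilate _ _ hu) mv vB v1.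
Qed.

Lemma integral_dilate1 C u j k : measurable_fun setT u -> tame C u ->
  \int[leb]_x dilate u j k x = (Num.sqrt 2 ^+ j)^-1 * \int[leb]_x u x.
Proof.
move=> mu hu; have p0 : 0 < 2 ^+ j :> R by rewrite exprn_gt0.
have iu := integrable_tame mu hu.
transitivity (Num.sqrt 2 ^+ j * \int[leb]_x u (2 ^+ j * x + - k%:~R)).
  by rewrite -RintegralZl//; exact: (integrable_affine _ p0 iu).
rewrite (Rintegral_affine _ p0 iu) mulrA -sqrt2X invfM mulrA mulfV ?mul1r//.
Qed.

Lemma integral_pdil1 C u j k : measurable_fun setT u -> tame C u ->
  \int[U]_x pdil u j k x = (Num.sqrt 2 ^+ j)^-1 * \int[leb]_x u x.
Proof.
move=> mu hu; rewrite -(integral_dilate1 j k mu hu).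
have := @integral_pdil C 1 u (cst 1) j k mu hu (measurable_cst _).
rewrite /cst; under eq_Rintegral do rewrite mulr1.
under [X in _ -> _ -> _ = X]eq_Rintegral do rewrite mulr1.
by apply => // x; rewrite normr1.
Qed.

Lemma norm_pdil_le C u j k x : tame C u ->
  `|pdil u j k x| <= pdil (fun x => `|u x|) j k x.
Proof.
move=> hu; have hd := tame_dilate j k hu; have hnd := tame_dilate j k (tame_norm hu).
rewrite -subr_le0; apply: (@cvgn_le _ (fun N => `|psum (dilate u j k) N x| - psum (dilate (fun x => `|u x|) j k) N x)).
  by apply: cvgB; [apply: cvg_norm; exact: cvg_periodize hd | exact: cvg_periodize hnd].
move=> N; rewrite subr_le0; apply: le_trans (psum_norm _ _ _) _.
by apply: ler_sum => i _; rewrite /dilate normrM ger0_norm// exprn_ge0 ?sqrtr_ge0.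
Qed.

Lemma integral_norm_pdil C u j k : measurable_fun setT u -> tame C u ->
  \int[U]_x `|pdil u j k x| <= (Num.sqrt 2 ^+ j)^-1 * \int[leb]_x `|u x|.
Proof.
move=> mu hu; have mnu : measurable_fun setT (fun x => `|u x|) by exact: measurableT_comp.
rewrite -(integral_pdil1 j k mnu (tame_norm hu)); apply: le_Rintegral => //.
- apply: (integrable_bounded (B := 8 * C * Num.sqrt 2 ^+ j)).
    by apply: measurableT_comp => //; exact: measurable_pdil hu.
  by move=> x; rewrite normr_id; exact: pdil_bound hu.
- apply: (integrable_bounded (B := 8 * C * Num.sqrt 2 ^+ j)).
    exact: measurable_pdil (tame_norm hu).
  by move=> x; exact: pdil_bound (tame_norm hu).
- by move=> x _; exact: norm_pdil_le hu.
Qed.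

Lemma is_derive_dilate u u' j k : (forall x : R, is_derive x 1 u (u' x)) ->
  forall x : R, is_derive x 1 (dilate u j k) (2 ^+ j * dilate u' j k x).
Proof.
move=> du x; have := is_deriveZ (Num.sqrt 2 ^+ j) (is_derive_affine du (2 ^+ j) k%:~R x).
by rewrite /GRing.scale/= /dilate mulrCA.
Qed.

Lemma pdil_lipschitz u u' C C' j k : (forall x : R, is_derive x 1 u (u' x)) ->
  tame C u -> tame C' u' ->
  exists D, forall x y, `|pdil u j k x - pdil u j k y| <= D * `|x - y|.
Proof.
move=> du hu hu'; eexists => x y.
exact: (periodize_lipschitz (is_derive_dilate j k du) (tame_dilate j k hu)
  (tameZ (2 ^+ j) (tame_dilate j k hu'))).
Qed.

Lemma pdil_continuous u u' C C' j k : (forall x : R, is_derive x 1 u (u' x)) ->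
  tame C u -> tame C' u' -> continuous (pdil u j k).
Proof.
by move=> du hu hu'; have [D] := pdil_lipschitz j k du hu hu'; exact: lipschitz_continuous.
Qed.

Lemma is_derive_pdil u u' u'' C C' C'' j k : (forall x : R, is_derive x 1 u (u' x)) ->
  (forall x : R, is_derive x 1 u' (u'' x)) -> tame C u -> tame C' u' -> tame C'' u'' ->
  forall x : R, is_derive x 1 (pdil u j k) (2 ^+ j * pdil u' j k x).
Proof.
move=> du du' hu hu' hu'' x.
rewrite -(periodizeZ _ _ (tame_dilate j k hu')).
apply: (is_derive_periodize (is_derive_dilate j k du) _ (tame_dilate j k hu)
  (tameZ (2 ^+ j) (tame_dilate j k hu'))
  (tameZ (2 ^+ j) (tameZ (2 ^+ j) (tame_dilate j k hu'')))) => y.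
have := is_deriveZ (2 ^+ j) (is_derive_dilate j k du' y).
by rewrite /GRing.scale.
Qed.

(** Orthogonality of the dilates on the line is inherited by their periodic
    versions: only the translation by zero can relate two indices in
    [0, 2 ^ J). *)
Lemma inner_pdil (b : bool) C C' u v J : measurable_fun setT u -> tame C u ->
  measurable_fun setT v -> tame C' v ->
  (forall k m, \int[leb]_x (dilate u J k x * dilate v J m x) = (b && (k == m))%:R) ->
  forall k m : 'I_(2 ^ J), \int[U]_x (pdil u J (k : nat) x * pdil v J (m : nat) x) = (b && (k == m))%:R.
Proof.
move=> mu hu mv hv uv k m.
have mdu := measurable_dilate J (k : nat) mu; have hdu := tame_dilate J (k : nat) hu.
have mdv := measurable_dilate J (m : nat) mv; have hdv := tame_dilate J (m : nat) hv.
rewrite (integral_pdil _ _ mu hu (measurable_pdil _ _ mv hv) (fun x => pdil_bound J _ x hv)); last first.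
  by move=> x; exact: pdilS hv.
have idd (p : int) : leb.-integrable setT (EFin \o (fun x => dilate u J (k : nat) x * dilate v J p x)).
  exact: integrable_mul_tame mdu hdu (measurable_dilate _ _ mv) (tame_dilate _ _ hv).
have := @dominated_cvg_real _ _ _ leb setT (fun N x => dilate u J (k : nat) x * psum (dilate v J (m : nat)) N x)
  (fun x => dilate u J (k : nat) x * pdil v J (m : nat) x)
  (fun x => 8 * (Num.sqrt 2 ^+ J * (C' * (1 + `|(m : nat)%:~R|) ^+ 2)) * `|dilate u J (k : nat) x|).
move=> h; apply: (cvg_unique (@Rhausdorff R) (h _ _ _ _ _ _)) => //.
- by move=> N; exact: (measurable_funM mdu (measurable_psum _ mdv)).
- exact: (measurable_funM mdu (measurable_pdil _ _ mv hv)).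
- by move=> x _; apply: cvgMr; exact: cvg_periodize hdv.
- by apply: (@integrable_mulr _ _ _ leb) => //; exact: integrable_norm (integrable_tame mdu hdu).
- move=> N x _; rewrite normrM mulrC ler_wpM2r//.
  exact: le_trans (psum_norm _ _ _) (psum_tame _ _ hdv).
apply: cvg_near_cst; apply: nearW => N.
have e (i : nat) x : dilate v J (m : nat) (x + i%:R - N%:R) = dilate v J ((m : nat)%:Z + 2 ^+ J * (N%:Z - i%:Z)) x.
  by rewrite dilate_shift; congr dilate; rewrite rmorphB/=; ring.
transitivity (\int[leb]_x (\sum_(i < N.*2.+1) dilate u J (k : nat) x * dilate v J ((m : nat)%:Z + 2 ^+ J * (N%:Z - i%:Z)) x)).
  apply: eq_Rintegral => x _; rewrite /psum mulr_sumr.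
  by apply: eq_bigr => i _; rewrite e.
rewrite Rintegral_sum//.
have NN : (N < N.*2.+1)%N by lia.
rewrite (bigD1 (Ordinal NN))//= uv subrr mulr0 addr0 big1 ?addr0 => [|i iN].
  by rewrite eqz_nat.
rewrite uv (_ : (k : int) == _ = false) ?andbF//; apply/negbTE/eqP.
have iN' : (i : nat) <> N by move=> iN'; move/eqP: iN; apply; exact/val_inj.
have := ltn_ord k; have := ltn_ord m.
rewrite -natrX natz; move: (nat_of_ord m) (nat_of_ord k) => m' k'.
move: (2 ^ J)%N => n mn kn.
have : ((N%:Z - i%:Z <= -1) || (1 <= N%:Z - i%:Z))%R by lia.
by move=> /orP[] h2 h3; nia.
Qed.

End periodic_dilates.

Section kernel_change_of_basis.
Context d (T : measurableType d) {R : realType}.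
Variable mu : {measure set T -> \bar R}.

(** Two orthonormal families with the same number of members, one in the span of
    the other, have the same reproducing kernel: the transition matrix has
    orthonormal rows, hence orthonormal columns. *)
Lemma kernel_change_of_basis n (b c : 'I_n -> T -> R) :
  (forall i j, mu.-integrable setT (EFin \o (fun x => b i x * c j x))) ->
  (forall i j, \int[mu]_x (b i x * b j x) = (i == j)%:R) ->
  (forall i x, b i x = \sum_m (\int[mu]_y (b i y * c m y)) * c m x) ->
  forall x y, \sum_i b i x * b i y = \sum_m c m x * c m y.
Proof.
move=> ibc bb bc x y.
pose A : 'M[R]_n := \matrix_(i, m) \int[mu]_y (b i y * c m y).
have AAT : A *m A^T = 1%:M.
  apply/matrixP => i j; rewrite !mxE -bb.
  under [RHS]eq_Rintegral do rewrite [X in _ * X]bc mulr_sumr.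
  rewrite Rintegral_sum//; last first.
    move=> m; have := @integrable_mulr _ _ _ mu _ _ (\int[mu]_y (b j y * c m y)) measurableT (ibc i m).
    by congr (mu.-integrable _ _); apply/funext => z /=; congr EFin; ring.
  apply: eq_bigr => m _; rewrite !mxE mulrC -RintegralZl//.
  by apply: eq_Rintegral => z _; ring.
have ATA := mulmx1C AAT.
have bE i z : b i z = \sum_m A i m * c m z.
  by rewrite bc; apply: eq_bigr => m _; rewrite mxE.
under eq_bigr do rewrite !bE mulr_suml.
rewrite exchange_big/=; apply: eq_bigr => m _.
under eq_bigr do rewrite mulr_sumr.
rewrite exchange_big/= (bigD1 m)//= [X in _ + X]big1 ?addr0 => [|p pm].
  transitivity ((A^T *m A) m m * (c m x * c m y)).
    by rewrite !mxE mulr_suml; apply: eq_bigr => i _; rewrite !mxE; ring.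
  by rewrite ATA !mxE eqxx mul1r.
transitivity ((A^T *m A) m p * (c m x * c p y)).
  by rewrite !mxE mulr_suml; apply: eq_bigr => i _; rewrite !mxE; ring.
by rewrite ATA !mxE eq_sym (negbTE pm) mul0r.
Qed.

End kernel_change_of_basis.

Section periodic_kernel.
Context {R : realType}.
Local Notation leb := (@lebesgue_measure R).
Local Notation U := (uniform_prob (@ltr01 R)).

Definition pkernel (u : R -> R) J x y := \sum_(k < 2 ^ J) pdil u J (k : nat) x * pdil u J (k : nat) y.

Variables (phi psi phi' psi' : R -> R) (C : R).
Hypothesis basis : orthonormal_basis leb (wavelet_system phi psi).
Hypotheses (dphi : forall x : R, is_derive x 1 phi (phi' x)).
Hypotheses (dpsi : forall x : R, is_derive x 1 psi (psi' x)).
Hypothesis hphi' : tame C phi'.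
Hypotheses (C_ge0 : 0 <= C) (hphi6 : forall x, `|phi x| <= C * decay x ^+ 3).
Hypotheses (hpsi6 : forall x, `|psi x| <= C * decay x ^+ 3).
Hypothesis psi0 : \int[leb]_x psi x = 0.

Let hphi : tame C phi.
Proof. by move=> x; apply: le_trans (hphi6 x) _; rewrite ler_wpM2l// decayX_le. Qed.

Let hpsi : tame C psi.
Proof. by move=> x; apply: le_trans (hpsi6 x) _; rewrite ler_wpM2l// decayX_le. Qed.

Let hphi4 x : `|phi x| <= C * decay x ^+ 2.
Proof.
apply: le_trans (hphi6 x) _; rewrite ler_wpM2l// exprS ler_piMl ?decay_le1//.
by rewrite exprn_ge0 ?decay_ge0.
Qed.

Let cphi := is_derive_continuous dphi.
Let cpsi := is_derive_continuous dpsi.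
Let mphi : measurable_fun setT phi := continuous_measurable_fun cphi.
Let mpsi : measurable_fun setT psi := continuous_measurable_fun cpsi.

Lemma inner_pdil_phi J (k m : 'I_(2 ^ J)) :
  \int[U]_x (pdil phi J (k : nat) x * pdil phi J (m : nat) x) = (k == m)%:R.
Proof.
exact: (inner_pdil (b := true) mphi hphi mphi hphi (inner_phi_phi basis hphi mphi J)).
Qed.

Lemma inner_pdil_psi J (k m : 'I_(2 ^ J)) :
  \int[U]_x (pdil psi J (k : nat) x * pdil psi J (m : nat) x) = (k == m)%:R.
Proof.
exact: (inner_pdil (b := true) mpsi hpsi mpsi hpsi (inner_psi_psi basis J)).
Qed.

Lemma inner_pdil_phi_psi J (k m : 'I_(2 ^ J)) :
  \int[U]_x (pdil phi J (k : nat) x * pdil psi J (m : nat) x) = 0.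
Proof.
apply: (inner_pdil (b := false) mphi hphi mpsi hpsi) => p q.
by have := inner_phi_psi basis hphi hpsi mphi mpsi J 0 p q; rewrite addn0.
Qed.

Let mpd (u : R -> R) j k Cu : measurable_fun setT u -> tame Cu u -> measurable_fun setT (pdil u j k).
Proof. exact: measurable_pdil. Qed.

(** The orthogonal projection onto the span of the periodic dilates. *)
Definition pproj J (f : R -> R) x : R :=
  \sum_(k < 2 ^ J) (\int[U]_y (pdil phi J (k : nat) y * f y)) * pdil phi J (k : nat) x.

Let imul J k (f : R -> R) B : measurable_fun setT f -> (forall x, `|f x| <= B) ->
  U.-integrable setT (EFin \o (fun y => pdil phi J k y * f y)).
Proof.
move=> mf fB; apply: (integrable_bounded (B := 8 * C * Num.sqrt 2 ^+ J * B)).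
  by apply: measurable_funM => //; exact: mpd hphi.
by move=> x; rewrite normrM ler_pM// pdil_bound.
Qed.

Let pproj_lin J (I : Type) (s : seq I) (a : I -> R) (f : I -> R -> R) (g : R -> R) B x :
  (forall i, measurable_fun setT (f i)) -> measurable_fun setT g ->
  (forall i x, `|f i x| <= B) -> (forall x : R, `|g x| <= B) ->
  pproj J (fun x => \sum_(i <- s) a i * f i x + g x) x =
  \sum_(i <- s) a i * pproj J (f i) x + pproj J g x.
Proof.
move=> mf mg fB gB; rewrite /pproj.
under [X in _ = X + _]eq_bigr do rewrite mulr_sumr.
rewrite exchange_big/= -big_split/=; apply: eq_bigr => k _.
under [X in _ = X + _]eq_bigr do rewrite mulrA.
rewrite -mulr_suml -mulrDl; congr (_ * _).
have ii i := imul J (k : nat) (mf i) (fB i).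
have iai i := @integrable_mulr _ _ _ U setT _ (a i) measurableT (ii i).
transitivity (\int[U]_y (\sum_(i <- s) a i * (pdil phi J (k : nat) y * f i y) + pdil phi J (k : nat) y * g y)).
  apply: eq_Rintegral => y _; rewrite mulrDr mulr_sumr; congr (_ + _).
  by apply: eq_bigr => i _; rewrite mulrCA.
rewrite RintegralD//; [|exact: integrable_sumr|exact: imul gB].
congr (_ + _); rewrite Rintegral_sum//.
by apply: eq_bigr => i _; rewrite RintegralZl.
Qed.

Let pproj_phi J (k : int) x : pproj J (pdil phi J k) x = pdil phi J k x.
Proof.
have [m ->] := pdil_ord J k hphi.
rewrite /pproj (bigD1 m)//= inner_pdil_phi eqxx mul1r big1 ?addr0// => p pm.
by rewrite inner_pdil_phi (negbTE pm) mul0r.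
Qed.

Let pproj_bound J (g : R -> R) B x : measurable_fun setT g -> (forall x, `|g x| <= B) ->
  `|pproj J g x| <= 8 * C * Num.sqrt 2 ^+ J * B * (8 * C * Num.sqrt 2 ^+ J).
Proof.
move=> mg gB; apply: le_trans (ler_norm_sum _ _ _) _.
apply: le_trans (_ : \sum_(k < 2 ^ J) (8 * C * Num.sqrt 2 ^+ J * B) * `|pdil phi J (k : nat) x| <= _); last first.
  rewrite -mulr_sumr ler_wpM2l ?sum_pdil//.
  by rewrite !mulr_ge0 ?exprn_ge0 ?sqrtr_ge0// (le_trans _ (gB 0)).
apply: ler_sum => k _; rewrite normrM ler_wpM2r//.
apply: le_trans (_ : \int[U]_y (8 * C * Num.sqrt 2 ^+ J * B) <= _); last first.
  by rewrite Rintegral_cst1.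
apply: (@le_norm_Rintegral _ _ _ U) => //.
- by apply: measurable_funM => //; exact: mpd hphi.
- by move=> y _; rewrite normrM ler_pM// pdil_bound.
- exact: finite_measure_integrable_cst.
Qed.

(** Nestedness of the levels. By [two_scale_tail] the dilate is, up to a
    remainder that is uniformly small after periodisation, a finite combination
    of scaling functions of the next level, which the projection reproduces. *)
Lemma pproj_refine u J (k : int) x : u = phi \/ u = psi ->
  pproj J.+1 (pdil u J k) x = pdil u J k x.
Proof.
move=> uE.
have [hu6 [cu upsi]] : (forall x, `|u x| <= C * decay x ^+ 3) /\ continuous u /\
    forall j k, \int[leb]_x (dilate psi j.+1 k x * u x) = 0.
  case: uE => ->; do ![split] => //.
    move=> j m; have := inner_phi_psi basis hphi hpsi mphi mpsi 0 j.+1 0 m.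
    rewrite add0n => <-; apply: eq_Rintegral => y _.
    by rewrite mulrC /dilate !expr0 !mul1r subr0.
  move=> j m; have [_ /(_ (inr (j.+1, m)) (inr (0%N, 0%:Z))) + _] := basis.
  rewrite /inner/= => h; rewrite -[RHS]h; apply: eq_Rintegral => y _.
  by congr (_ * _); rewrite /dilate !expr0 !mul1r subr0.
have hu : tame C u by move=> y; apply: le_trans (hu6 y) _; rewrite ler_wpM2l// decayX_le.
have mu : measurable_fun setT u by exact: continuous_measurable_fun.
have [e [e0 he]] := two_scale_tail basis hphi hpsi mphi mpsi dphi hphi' C_ge0 hphi4 C_ge0 hu6 cu upsi.
pose F N := expansion_sum phi u N.
pose c (N i : nat) : R := coef phi u (0 + i%:R - N%:R).
pose idx (N i : nat) : int := 2 * k + (i%:Z - N%:Z).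
pose H N y := pdil (fun z => u z - F N z) J k y.
have hF N : tame (e N) (fun z => u z - F N z) by exact: he.
have mF N : measurable_fun setT (F N).
  rewrite /F /expansion_sum /psum; apply: measurable_sum => i.
  apply: measurable_funM => //; apply: measurable_funM => //; apply: (measurableT_comp mphi).
  by apply: measurable_funB => //; exact: measurable_funM.
have mH N : measurable_fun setT (H N).
  by apply: measurable_pdil (hF N); exact: measurable_funB.
(* a translation by k at level J is a translation by 2 k at the next level *)
have dE N : pdil u J k = (fun y => \sum_(i < N.*2.+1) c N i * pdil phi J.+1 (idx N i) y + H N y).
  apply/funext => y.
  have dF z : dilate u J k z = \sum_(i < N.*2.+1) c N i * dilate phi J.+1 (idx N i) z
      + dilate (fun z => u z - F N z) J k z.
    rewrite {1 3}/dilate mulrBr addrCA -[LHS]addr0; congr (_ + _).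
    apply/esym/eqP; rewrite subr_eq0; apply/eqP.
    rewrite /F /expansion_sum /psum mulr_sumr; apply: eq_bigr => i _.
    rewrite /c /dilate exprSr -mulrA mulrCA; congr (_ * (_ * (_ * phi _))).
    rewrite /idx exprS rmorphD rmorphM rmorphB/= add0r; ring.
  have td N' i := tame_dilate J.+1 (idx N' i) hphi.
  have key (s : seq 'I_(N.*2.+1)) : exists C', tame C' (fun z => \sum_(i <- s) c N i * dilate phi J.+1 (idx N i) z) /\
      periodize (fun z => \sum_(i <- s) c N i * dilate phi J.+1 (idx N i) z) y = \sum_(i <- s) c N i * pdil phi J.+1 (idx N i) y.
    elim: s => [|i s [C' [h1 h2]]].
      exists 0; split; first by move=> z; rewrite big_nil normr0 mul0r.
      rewrite big_nil; apply: (@periodize_unique _ 0) => [z|].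
        by rewrite big_nil normr0 mul0r.
      rewrite (_ : (fun N0 => _) = cst 0); first exact: cvg_cst.
      by apply/funext => M; rewrite /psum big1// => j _; rewrite big_nil.
    have e1 : (fun z => \sum_(j <- i :: s) c N j * dilate phi J.+1 (idx N j) z) =
      (fun z => c N i * dilate phi J.+1 (idx N i) z + \sum_(j <- s) c N j * dilate phi J.+1 (idx N j) z).
      by apply/funext => z; rewrite big_cons.
    exists (`|c N i| * (Num.sqrt 2 ^+ J.+1 * (C * (1 + `|(idx N i)%:~R|) ^+ 2)) + C').
    rewrite e1; split; first exact: tameD (tameZ _ (td N i)) h1.
    by rewrite (periodizeD y (tameZ _ (td N i)) h1) h2 big_cons (periodizeZ _ _ (td N i)).
  have [C' [h1 h2]] := key (index_enum _).
  rewrite (_ : pdil u J k y = periodize (fun z => \sum_(i < N.*2.+1) c N i * dilate phi J.+1 (idx N i) z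
      + dilate (fun z => u z - F N z) J k z) y); last first.
    by rewrite /pdil; congr periodize; apply/funext => z; exact: dF.
  by rewrite (periodizeD y h1 (tame_dilate J k (hF N))) h2.
apply/eqP; rewrite -subr_eq0 -normr_eq0; apply/eqP.
pose B := 8 * C * Num.sqrt 2 ^+ J.+1.
have Hb N z : `|H N z| <= 8 * e N * Num.sqrt 2 ^+ J by exact: pdil_bound (hF N).
have E N : `|pproj J.+1 (pdil u J k) x - pdil u J k x| <=
    (B * (8 * Num.sqrt 2 ^+ J) * B + 8 * Num.sqrt 2 ^+ J) * e N.
  have e_ge0 := tame_ge0 (hF N).
  rewrite {1 2}(dE N) (@pproj_lin _ _ _ _ _ _ (B + 8 * e N * Num.sqrt 2 ^+ J)); first last.
  - by move=> z; apply: le_trans (Hb N z) _; rewrite lerDr !mulr_ge0 ?exprn_ge0 ?sqrtr_ge0.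
  - move=> i z; apply: le_trans (pdil_bound _ _ _ hphi) _.
    by rewrite lerDl !mulr_ge0 ?exprn_ge0 ?sqrtr_ge0.
  - exact: mH.
  - by move=> i; exact: mpd hphi.
  under eq_bigr do rewrite pproj_phi.
  rewrite opprD addrACA subrr add0r mulrDl.
  apply: le_trans (ler_normB _ _) _; apply: lerD.
    by apply: le_trans (pproj_bound J.+1 x (mH N) (Hb N)) _; rewrite -/B; apply: eq_ler; ring.
  by apply: le_trans (Hb N x) _; apply: eq_ler; ring.
apply/eqP; rewrite eq_le normr_ge0 andbT.
set K := B * (8 * Num.sqrt 2 ^+ J) * B + 8 * Num.sqrt 2 ^+ J in E *.
have h : K * e N @[N --> \oo] --> (0 : R) by rewrite -(mulr0 K); exact: cvgMr.
rewrite -(subr0 `|_|).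
by apply: (@cvgn_le _ (fun N => `|pproj J.+1 (pdil u J k) x - pdil u J k x| - K * e N));
  [apply: cvgB => //; exact: cvg_cst | move=> N; rewrite subr_le0].
Qed.

(** The periodic scaling functions and wavelets of level J are 2 ^ J.+1
    orthonormal functions in the span of as many scaling functions of the next
    level. *)
Lemma pkernelS J x y : pkernel phi J.+1 x y = pkernel phi J x y + pkernel psi J x y.
Proof.
pose n := (2 ^ J)%N.
pose b (i : 'I_(n + n)) : R -> R :=
  match fintype.split i with inl k => pdil phi J (k : nat) | inr k => pdil psi J (k : nat) end.
pose c (m : 'I_(n + n)) : R -> R := pdil phi J.+1 (m : nat).
have nE : (2 ^ J.+1 = n + n)%N by rewrite expnS mul2n addnn.
have eb : \sum_i b i x * b i y = pkernel phi J x y + pkernel psi J x y.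
  rewrite big_split_ord; congr (_ + _); apply: eq_bigr => k _; rewrite /b.
    by rewrite (unsplitK (inl k)).
  by rewrite (unsplitK (inr k)).
rewrite -eb (kernel_change_of_basis (mu := U) (c := c)).
- by rewrite /pkernel nE.
- move=> i j; have mc : measurable_fun setT (c j) by exact: mpd hphi.
  have mb : measurable_fun setT (b i).
    by rewrite /b; case: (fintype.split i) => k; [exact: mpd hphi | exact: mpd hpsi].
  apply: (integrable_bounded (B := 8 * C * Num.sqrt 2 ^+ J * (8 * C * Num.sqrt 2 ^+ J.+1))).
    exact: measurable_funM.
  move=> z; rewrite normrM ler_pM//; last exact: pdil_bound hphi.
  by rewrite /b; case: (fintype.split i) => k; exact: pdil_bound.
- move=> i j; rewrite /b -[in RHS](splitK i) -[in RHS](splitK j).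
  case: (fintype.split i) => k; case: (fintype.split j) => m /=.
  + by rewrite inner_pdil_phi -val_eqE.
  + rewrite inner_pdil_phi_psi -val_eqE/= (_ : (_ == _) = false)//.
    by apply/negbTE; have := ltn_ord k; rewrite neq_ltn => h; rewrite ltn_addr.
  + under eq_Rintegral do rewrite mulrC.
    rewrite inner_pdil_phi_psi -val_eqE/= (_ : (_ == _) = false)//.
    by apply/negbTE; have := ltn_ord m; rewrite neq_ltn => h; rewrite orbC ltn_addr.
  + rewrite inner_pdil_psi; congr (nat_of_bool _)%:R.
    by apply/eqP/eqP => [->//|/(congr1 val)/= /addnI h]; exact: val_inj.
- move=> i z; rewrite /c.
  have -> : b i z = pproj J.+1 (b i) z.
    by rewrite /b; case: (fintype.split i) => k; rewrite pproj_refine//; [left|right].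
  rewrite /pproj nE; apply: eq_bigr => m _; congr (_ * _).
  by apply: eq_Rintegral => w _; rewrite mulrC.
Qed.

Let u1 x := `|x| * `|phi x|.

Let hu1 : tame C u1.
Proof.
move=> x; rewrite /u1 ger0_norm ?mulr_ge0//.
apply: (@le_trans _ _ (`|x| * (C * decay x ^+ 2))); first by rewrite ler_wpM2l.
rewrite mulrCA ler_wpM2l// expr2 mulrA ler_piMl ?decay_ge0//.
rewrite /decay ler_pdivrMr ?exprn_gt0 ?ltr_pwDl// mul1r.
by have := normr_ge0 x; nra.
Qed.

Let mu1 : measurable_fun setT u1.
Proof.
apply: continuous_measurable_fun => x.
by apply: cvgM; apply: cvg_norm; [exact: cvg_id | exact: cphi].
Qed.

Let pdil_u1_ge0 J k x : 0 <= pdil u1 J k x.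
Proof.
rewrite -oppr_le0; apply: (@cvgn_le _ (fun N => - psum (dilate u1 J k) N x)).
  by apply: cvgN; exact: cvg_periodize (tame_dilate _ _ hu1).
move=> N; rewrite oppr_le0 sumr_ge0// => i _.
by rewrite /dilate /u1 !mulr_ge0 ?exprn_ge0 ?sqrtr_ge0.
Qed.

(** The dilate with index k is concentrated within distance 2^-J of k / 2^J; the
    first moment [u1] takes care of its tails. *)
Let pdil_moment (f : R -> R) Lf J (k : nat) y : 0 <= Lf -> (forall x, f (x + 1) = f x) ->
  (forall x y, `|f x - f y| <= Lf * `|x - y|) ->
  `|pdil phi J k y| * `|f y - f (k%:R / 2 ^+ J)| <= Lf * (2 ^+ J)^-1 * pdil u1 J k y.
Proof.
move=> Lf0 f1 fL.
have fz (i N : nat) x : f (x + i%:R - N%:R) = f x.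
  by rewrite -(periodic1_natr N _ f1) subrK periodic1_natr.
have hd := tame_dilate J k hphi; have hd1 := tame_dilate J k hu1.
rewrite -subr_le0; set fk := f (k%:R / 2 ^+ J).
apply: (@cvgn_le _ (fun N => `|psum (dilate phi J k) N y| * `|f y - fk| -
   Lf * (2 ^+ J)^-1 * psum (dilate u1 J k) N y)).
  apply: cvgB; last by apply: cvgMr; exact: cvg_periodize hd1.
  by apply: cvgMl; apply: cvg_norm; exact: cvg_periodize hd.
move=> N; rewrite subr_le0; apply: (@le_trans _ _ (psum (fun x => `|dilate phi J k x|) N y * `|f y - fk|)).
  by rewrite ler_wpM2r// psum_norm.
rewrite /psum mulr_suml mulr_sumr; apply: ler_sum => i _.
rewrite -(fz i N y); set z := y + i%:R - N%:R.
rewrite /dilate /u1 normrM (ger0_norm (exprn_ge0 _ (sqrtr_ge0 _))).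
apply: le_trans (ler_wpM2l _ (fL z (k%:R / 2 ^+ J))) _.
  by rewrite mulr_ge0 ?exprn_ge0 ?sqrtr_ge0.
have -> : z - k%:R / 2 ^+ J = (2 ^+ J)^-1 * (2 ^+ J * z - k%:R).
  by rewrite mulrBr mulrA mulVf ?mul1r 1?mulrC// expf_neq0.
rewrite normrM (ger0_norm (_ : 0 <= (2 ^+ J)^-1)) ?invr_ge0 ?exprn_ge0//.
by apply: eq_ler; rewrite /=; ring.
Qed.

Let pmass := pproj^~ (cst 1).

Let pmassE J x : pmass J x = \int[U]_y pkernel phi J x y.
Proof.
have iU k : U.-integrable setT (EFin \o pdil phi J k).
  by apply: (integrable_bounded (B := 8 * C * Num.sqrt 2 ^+ J)); [exact: mpd hphi | move=> y; exact: pdil_bound].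
rewrite /pkernel Rintegral_sum//; last by move=> k; exact: (@integrable_mulr _ _ _ U).
apply: eq_bigr => k _; rewrite RintegralZl// mulrC; congr (_ * _).
by apply: eq_Rintegral => y _; rewrite mulr1.
Qed.

(** Since [psi] has mean zero, the mass of the kernel does not depend on the level. *)
Let pmass_level J x : pmass J x = pmass 0 x.
Proof.
elim: J => // J <-; rewrite !pmassE.
have iU u k : measurable_fun setT u -> tame C u -> U.-integrable setT (EFin \o pdil u J k).
  move=> mu hu; apply: (integrable_bounded (B := 8 * C * Num.sqrt 2 ^+ J)); first exact: mpd hu.
  by move=> y; exact: pdil_bound.
have iK u : measurable_fun setT u -> tame C u -> U.-integrable setT (EFin \o pkernel u J x).
  by move=> mu hu; apply: integrable_sumr => // k; apply: (@integrable_mulr _ _ _ U) => //; exact: iU.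
under eq_Rintegral do rewrite pkernelS.
rewrite RintegralD//; [|exact: iK|exact: iK].
rewrite [X in _ + X](_ : _ = 0) ?addr0// /pkernel Rintegral_sum//; last first.
  by move=> k; apply: (@integrable_mulr _ _ _ U) => //; exact: iU.
rewrite big1// => k _; rewrite RintegralZl//; last exact: iU.
by rewrite (integral_pdil1 _ _ mpsi hpsi) psi0 !mulr0.
Qed.

Let A := 8 * C * (\int[leb]_x u1 x + \int[leb]_x `|phi x|).

(** Each dilate sees both f y and f x through the value of f at its centre
    k / 2^J. *)
Let pproj_mass (f : R -> R) Lf J x : 0 <= Lf -> (forall x, f (x + 1) = f x) ->
  (forall x y, `|f x - f y| <= Lf * `|x - y|) ->
  `|pproj J f x - pmass J x * f x| <= A * Lf * (2 ^+ J)^-1.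
Proof.
move=> Lf0 f1 fL.
have mf : measurable_fun setT f by apply: continuous_measurable_fun; exact: lipschitz_continuous fL.
have fB y : `|f y - f x| <= Lf.
  rewrite -(periodic1_intr (Num.floor (x - y)) y f1); apply: le_trans (fL _ _) _.
  rewrite ler_piMr// distrC opprD addrA ger0_norm ?subr_ge0 ?floor_le//.
    have /andP[_] := floor_itv (x - y); rewrite intrD => h.
    by rewrite lerBlDl ltW.
have iphi k : U.-integrable setT (EFin \o (fun y => `|pdil phi J k y|)).
  apply: (integrable_bounded (B := 8 * C * Num.sqrt 2 ^+ J)).
    by apply: measurableT_comp => //; exact: mpd hphi.
  by move=> y; rewrite normr_id; exact: pdil_bound.
have ifx k : U.-integrable setT (EFin \o (fun y => pdil phi J k y * (f y - f x))).
  by apply: (@imul _ _ _ Lf) => //; exact: measurable_funB.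
have iu1 k : U.-integrable setT (EFin \o (fun y => pdil u1 J k y)).
  apply: (integrable_bounded (B := 8 * C * Num.sqrt 2 ^+ J)); first exact: mpd hu1.
  by move=> y; exact: pdil_bound.
have i1 k : U.-integrable setT (EFin \o pdil phi J k).
  by apply: (integrable_bounded (B := 8 * C * Num.sqrt 2 ^+ J)); [exact: mpd hphi | move=> y; exact: pdil_bound].
have -> : pproj J f x - pmass J x * f x =
    \sum_(k < 2 ^ J) (\int[U]_y (pdil phi J (k : nat) y * (f y - f x))) * pdil phi J (k : nat) x.
  rewrite /pmass /pproj mulr_suml -sumrB; apply: eq_bigr => k _.
  rewrite mulrAC -mulrBl; congr (_ * _).
  have e : \int[U]_y (pdil phi J (k : nat) y * cst 1 y) = \int[U]_y (pdil phi J (k : nat) y).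
    by apply: eq_Rintegral => y _; rewrite mulr1.
  rewrite e -RintegralZr// -RintegralB//.
  - by apply: eq_Rintegral => y _; rewrite mulrBr.
  - have := integrable_add measurableT (ifx (k : nat)) (integrable_mulr (f x) measurableT (i1 (k : nat))).
    by congr (U.-integrable _ _); apply/funext => y /=; congr EFin; ring.
  - have := integrable_mulr (f x) measurableT (i1 (k : nat)).
    by congr (U.-integrable _ _); apply/funext => y /=; congr EFin; ring.
pose s := (Num.sqrt 2 ^+ J)^-1 : R.
pose I1 := \int[leb]_x u1 x; pose I0 := \int[leb]_x `|phi x|.
have s0 : 0 <= s by rewrite invr_ge0 exprn_ge0 ?sqrtr_ge0.
have I10 : 0 <= I1 by apply: Rintegral_ge0 => y _; rewrite mulr_ge0.
have I00 : 0 <= I0 by apply: Rintegral_ge0 => y _.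
have t0 : 0 <= (2 ^+ J)^-1 :> R by rewrite invr_ge0 exprn_ge0.
apply: le_trans (ler_norm_sum _ _ _) _.
apply: (@le_trans _ _ (\sum_(k < 2 ^ J) (Lf * (2 ^+ J)^-1 * (s * I1) * `|pdil phi J (k : nat) x| +
    Lf * (2 ^+ J)^-1 * (s * I0) * `|pdil u1 J (k : nat) x|))).
  apply: ler_sum => k _; rewrite normrM; set fk := f ((k : nat)%:R / 2 ^+ J).
  have h1 : `|\int[U]_y (pdil phi J (k : nat) y * (f y - f x))| <=
      Lf * (2 ^+ J)^-1 * (s * I1) + s * I0 * `|f x - fk|.
    apply: le_trans (_ : \int[U]_y (Lf * (2 ^+ J)^-1 * pdil u1 J (k : nat) y + `|f x - fk| * `|pdil phi J (k : nat) y|) <= _).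
      apply: (@le_norm_Rintegral _ _ _ U) => //.
      - exact: integrable_mfun (ifx _).
      - move=> y _; rewrite normrM.
        apply: (@le_trans _ _ (`|pdil phi J (k : nat) y| * (`|f y - fk| + `|f x - fk|))).
          rewrite ler_wpM2l// (distrC (f x)).
          by have := ler_normD (f y - fk) (fk - f x); rewrite addrA subrK.
        by rewrite mulrDr (mulrC _ `|f x - fk|) lerD2r; exact: pdil_moment.
      - by apply: integrable_add => //; exact: (@integrable_mulr _ _ _ U).
    rewrite RintegralD//; [|exact: (@integrable_mulr _ _ _ U)|exact: (@integrable_mulr _ _ _ U)].
    rewrite RintegralZl// RintegralZl// (integral_pdil1 _ _ mu1 hu1) lerD2l.
    by rewrite mulrC ler_wpM2r//; exact: integral_norm_pdil hphi.
  apply: le_trans (ler_wpM2r (normr_ge0 _) h1) _.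
  rewrite mulrDl lerD2l -(mulrA (s * I0)) (mulrC `|f x - fk|).
  have := pdil_moment J k x Lf0 f1 fL; rewrite -/fk (ger0_norm (pdil_u1_ge0 _ _ _)) => h2.
  apply: le_trans (ler_wpM2l (mulr_ge0 s0 I00) h2) _.
  by apply: eq_ler; ring.
rewrite big_split/= -!mulr_sumr.
apply: le_trans (lerD (ler_wpM2l _ (sum_pdil J x hphi)) (ler_wpM2l _ (sum_pdil J x hu1))) _.
- by rewrite !mulr_ge0.
- by rewrite !mulr_ge0.
rewrite /A -/I1 -/I0 /s; apply: eq_ler; field.
by rewrite !expf_neq0// gt_eqF// sqrtr_gt0.
Qed.

Let Theta := pdil phi 0 0.

Let pproj_Theta J x : pproj J Theta x = Theta x.
Proof.
elim: J x => [|J IHJ] x; first exact: pproj_phi.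
have -> : Theta = (fun x => \sum_(k <- index_enum 'I_(2 ^ J)) (\int[U]_y (pdil phi J (k : nat) y * Theta y)) *
    pdil phi J (k : nat) x + cst 0 x).
  by apply/funext => y; rewrite -[LHS]IHJ addr0.
rewrite (@pproj_lin _ _ _ _ (fun k : 'I_(2 ^ J) => pdil phi J (k : nat)) (cst 0) (8 * C * Num.sqrt 2 ^+ J)).
- congr (_ + _).
    by apply: eq_bigr => k _; rewrite pproj_refine//; left.
  rewrite /pproj big1// => k _; under eq_Rintegral do rewrite mulr0.
  by rewrite Rintegral_cst1 mul0r.
- by move=> k; exact: mpd hphi.
- exact: measurable_cst.
- by move=> k y; exact: pdil_bound.
- by move=> y; rewrite normr0 !mulr_ge0 ?exprn_ge0 ?sqrtr_ge0.
Qed.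

Lemma cvg_inv2X : (2 ^+ n)^-1 @[n --> \oo] --> (0 : R).
Proof.
under eq_fun do rewrite -exprVn.
by apply: cvg_expr; rewrite ger0_norm// invf_lt1// ltr1n.
Qed.

(** The mass is c Theta at every level. Applied to Theta itself, [pproj_mass]
    gives Theta (1 - c Theta) = 0 in the limit, so that Theta takes no values
    but 0 and 1 / c; being continuous and not identically zero, it is
    constant. *)
Let pmass1 x : pmass 0 x = 1.
Proof.
pose c := \int[U]_y (pdil phi 0 0 y * cst 1 y).
have ME y : pmass 0 y = c * Theta y by rewrite /pmass /pproj big_ord_recl big_ord0 addr0.
have [Lf ThL] := pdil_lipschitz 0 0 dphi hphi hphi'.
have Lf0 : 0 <= Lf by have := le_trans (normr_ge0 _) (ThL 1 0); rewrite subr0 normr1 mulr1.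
have cT : continuous Theta by exact: lipschitz_continuous ThL.
have idem y : Theta y * (1 - c * Theta y) = 0.
  apply/eqP; rewrite -normr_eq0 eq_le normr_ge0 andbT -[X in _ <= X](mulr0 (A * Lf)).
  rewrite -subr_le0; apply: (@cvgn_le _ (fun J => `|Theta y * (1 - c * Theta y)| - A * Lf * (2 ^+ J)^-1)).
    by apply: cvgB; [exact: cvg_cst | apply: cvgMr; exact: cvg_inv2X].
  move=> J; rewrite subr_le0.
  have := pproj_mass J y Lf0 (fun x => pdilS 0 0 x hphi) ThL.
  by rewrite -/Theta pproj_Theta pmass_level ME; congr (`|_| <= _); ring.
have [x0 Th0] : exists x0, Theta x0 != 0.
  apply: contrapT => h; have := inner_pdil_phi (J := 0) ord0 ord0.
  rewrite eqxx => /eqP; rewrite -[X in _ == X]opprK eq_sym -subr_eq0.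
  under eq_Rintegral => y _.
    rewrite (_ : pdil phi 0 _ y = 0); first over.
    by apply/eqP; apply: contrapT => /negP hy; apply: h; exists y.
  by under eq_Rintegral do rewrite mul0r; rewrite Rintegral_cst1 opprK subr0 oner_eq0.
have cT0 y : Theta y != 0 -> c * Theta y = 1.
  move=> Ty; have /eqP := idem y; rewrite mulf_eq0 (negbTE Ty)/= subr_eq0 => /eqP //.
rewrite ME; apply: (cT0 x); apply/negP => /eqP Tx.
have [z Tz] : exists z, Theta z = Theta x0 / 2.
  have mid (a b : R) : a = 0 \/ b = 0 -> Num.min a b <= (a + b) / 2 <= Num.max a b.
    by move=> [->|->]; rewrite ?add0r ?addr0 /Order.min /Order.max; case: ltP => ?; lra.
  have [xx|xx] := leP x x0.
    have [||z _ Tz] := @IVT _ Theta x x0 (Theta x0 / 2) xx.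
    - exact: continuous_subspaceT.
    - by have := mid (Theta x) (Theta x0) (or_introl Tx); rewrite Tx add0r.
    by exists z; rewrite Tz.
  have [||z _ Tz] := @IVT _ Theta x0 x (Theta x0 / 2) (ltW xx).
  - exact: continuous_subspaceT.
  - by have := mid (Theta x0) (Theta x) (or_intror Tx); rewrite Tx addr0.
  by exists z; rewrite Tz.
have Tz0 : Theta z != 0 by rewrite Tz mulf_neq0// invr_eq0 pnatr_eq0.
have := cT0 _ Tz0; rewrite Tz mulrA cT0// mul1r => /eqP.
by rewrite invr_eq1 (eqr_nat R 2 1).
Qed.

(** The projection kernels have mass one and are concentrated within distance
    2^-J of the diagonal. *)
Lemma pproj_approx : exists A', 0 <= A' /\ forall (f : R -> R) Lf J x, 0 <= Lf ->
  (forall x, f (x + 1) = f x) -> (forall x y, `|f x - f y| <= Lf * `|x - y|) ->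
  `|pproj J f x - f x| <= A' * Lf * (2 ^+ J)^-1.
Proof.
exists A; split.
  rewrite /A !mulr_ge0// addr_ge0//; apply: Rintegral_ge0 => y _ //.
  by rewrite mulr_ge0.
move=> f Lf J x Lf0 f1 fL.
by have := pproj_mass J x Lf0 f1 fL; rewrite pmass_level pmass1 mul1r.
Qed.

End periodic_kernel.

(** * Tensor products on the torus *)

Section torus_integral.
Context {R : realType}.
Local Notation U := (uniform_prob (@ltr01 R)).

Lemma measurable_coord d (f : R -> R) (i : 'I_d) : measurable_fun setT f ->
  measurable_fun setT (fun x : 'rV[R]_d => f (x ord0 i)).
Proof. by move=> mf; exact: (measurableT_comp mf (measurable_row_coord i)). Qed.

Lemma measurable_tensor d (f : 'I_d -> R -> R) : (forall i, measurable_fun setT (f i)) ->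
  measurable_fun setT (fun x : 'rV[R]_d => \prod_(i < d) f i (x ord0 i)).
Proof. by move=> mf; apply: measurable_prod => i _; exact: measurable_coord. Qed.

Lemma prod_bound (I : finType) (f : I -> R) B : (forall i, `|f i| <= B) ->
  `|\prod_i f i| <= B ^+ #|I|.
Proof.
move=> fB; rewrite normr_prod -prodr_const; apply: ler_prod => i _.
by rewrite normr_ge0 fB.
Qed.

(** Fubini, one coordinate at a time. *)
Lemma Rintegral_tensor d (f : 'I_d -> R -> R) B : (forall i, measurable_fun setT (f i)) ->
  (forall i x, `|f i x| <= B) ->
  \int[torus_measure d]_x (\prod_(i < d) f i (x ord0 i)) = \prod_(i < d) \int[U]_t f i t.
Proof.
elim: d f => [|d IHd] f mf fB.
  rewrite big_ord0 (_ : (fun x => _) = cst 1) ?Rintegral_cst1//.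
  by apply/funext => x; rewrite big_ord0.
rewrite big_ord_recl -(IHd (fun i => f (lift ord0 i))) //.
pose g (x : 'rV[R]_d) : R := \prod_(i < d) f (lift ord0 i) (x ord0 i).
have mg : measurable_fun setT g := measurable_tensor (fun i => mf (lift ord0 i)).
have mF := measurable_tensor mf.
have gB x : `|g x| <= B ^+ #|'I_d| by apply: prod_bound => i.
have E p : (\prod_(i < d.+1) f i (cons_row p ord0 i))%:E = (f ord0 p.1 * g p.2)%:E.
  rewrite big_ord_recl; congr (_ * _)%:E; first by rewrite mxE unlift_none.
  by apply: eq_bigr => i _; rewrite mxE liftK.
rewrite /Rintegral /=.
rewrite integral_distribution//; last 2 first.
- exact/measurable_EFinP.
- apply: (@integrable_bounded _ _ _ _ _ (B ^+ #|'I_d.+1|)).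
    exact: (measurableT_comp mF (@measurable_cons_row R d)).
  by move=> p; apply: prod_bound => i.
transitivity (fine (\int[(U \x torus_measure d)%E]_p (f ord0 p.1 * g p.2)%:E)%E).
  by congr fine; apply: eq_integral => p _; exact: E.
rewrite -integral12_prod_meas1/=; last first.
  apply: (@le_integrable_real _ _ _ (U \x torus_measure d)%E setT (fun p => f ord0 p.1 * g p.2)
    (cst (B * B ^+ #|'I_d|))) => //; last first.
    apply: measurable_bounded_integrable => //; last by exists `|B * B ^+ #|'I_d| |; split=> // z zB x _; exact: ltW.
    have := @product_measure1E _ _ _ _ R U (torus_measure d) setT setT measurableT measurableT.
    rewrite setXTT => e; apply: (@le_lt_trans _ _ 1%E); last exact: ltry.
    apply: eq_ler; apply: (etrans e).
    by apply: etrans (mule1 1%E); congr (_ * _)%E; exact: probability_setT.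
    by move=> p _; rewrite normrM ler_pM.
  apply: measurable_funM; first exact: (measurableT_comp (mf ord0)).
  exact: (measurableT_comp mg).
rewrite -/(Rintegral U setT (f ord0)) -/(Rintegral (torus_measure d) setT g) mulrC.
have ig : (torus_measure d).-integrable setT (EFin \o g) by exact: integrable_bounded mg gB.
have i0 : U.-integrable setT (EFin \o f ord0) by exact: (@integrable_bounded R _ _ U _ _ (mf ord0) (fB ord0)).
rewrite -RintegralZl//; congr fine; apply: eq_integral => t _.
rewrite /fubini_F/= (_ : (fun y => _) = (fun y => ((f ord0 t)%:E * (g y)%:E)%E))//.
rewrite integralZl// [in RHS]EFinM muleC; congr (_ * _)%E.
by rewrite /Rintegral fineK//; exact: integrable_fin_num.
Qed.

Lemma Rintegral_coord d (f : R -> R) B (i : 'I_d) : measurable_fun setT f ->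
  (forall x, `|f x| <= B) -> \int[torus_measure d]_x f (x ord0 i) = \int[U]_t f t.
Proof.
move=> mf fB; pose F (j : 'I_d) := if j == i then f else cst 1.
have FE : (fun x : 'rV[R]_d => f (x ord0 i)) = (fun x => \prod_(j < d) F j (x ord0 j)).
  apply/funext => x; rewrite (bigD1 i)//= {1}/F eqxx big1 ?mulr1// => j ji.
  by rewrite /F (negbTE ji).
rewrite FE (@Rintegral_tensor _ _ (Num.max B 1)).
- rewrite (bigD1 i)//= {1}/F eqxx big1 ?mulr1// => j ji.
  by rewrite /F (negbTE ji) Rintegral_cst1.
- by move=> j; rewrite /F; case: ifP.
- move=> j x; rewrite /F; case: ifP => _; rewrite le_max ?fB//.
  by rewrite normr1 lexx orbT.
Qed.

End torus_integral.

Section tensor_wavelets.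
Context {R : realType} (d : nat).
Local Notation leb := (@lebesgue_measure R).
Local Notation U := (uniform_prob (@ltr01 R)).
Local Notation mu := (torus_measure d : probability _ R).

Definition tensor (u : 'I_d -> R -> R) j (k : {ffun 'I_d -> 'I_(2 ^ j)}) (x : 'rV[R]_d) : R :=
  \prod_(i < d) pdil (u i) j (k i : nat) (x ord0 i).

Arguments tensor : clear implicits.

Lemma sum_tensor_kernel (u : 'I_d -> R -> R) j x y :
  \sum_k tensor u j k x * tensor u j k y = \prod_(i < d) pkernel (u i) j (x ord0 i) (y ord0 i).
Proof.
rewrite /pkernel bigA_distr_bigA; apply: eq_bigr => k _.
by rewrite /tensor big_split.
Qed.

Variables (u : 'I_d -> R -> R) (C I : R).
Hypotheses (mu_ : forall i, measurable_fun setT (u i)) (hu : forall i, tame C (u i)).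
Hypothesis (uI : forall i, \int[leb]_x `|u i x| <= I).

(** By distributivity the sum over multi-indices is a product of one-dimensional
    sums, each of them bounded as the dilates of one level overlap boundedly. *)
Lemma sum_tensor j x : \sum_k `|tensor u j k x| <= (8 * C * Num.sqrt 2 ^+ j) ^+ d.
Proof.
under eq_bigr do rewrite /tensor normr_prod.
rewrite -(bigA_distr_bigA (fun i (k : 'I_(2 ^ j)) => `|pdil (u i) j (k : nat) (x ord0 i)|)).
rewrite -{1}[X in _ <= _ ^+ X](card_ord d) -prodr_const; apply: ler_prod => i _.
by rewrite sum_pdil// andbT sumr_ge0.
Qed.

Lemma tensor_bound j k x : `|tensor u j k x| <= (8 * C * Num.sqrt 2 ^+ j) ^+ d.
Proof.
by apply: le_trans (sum_tensor j x); rewrite (bigD1 k)//= lerDl sumr_ge0.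
Qed.

Lemma sum_coef_tensor j (c : {ffun 'I_d -> 'I_(2 ^ j)} -> R) delta x :
  (forall k, `|c k| <= delta) ->
  `|\sum_k c k * tensor u j k x| <= delta * (8 * C * Num.sqrt 2 ^+ j) ^+ d.
Proof.
move=> hG; apply: le_trans (ler_norm_sum _ _ _) _.
apply: (@le_trans _ _ (\sum_k delta * `|tensor u j k x|)).
  by apply: ler_sum => k _; rewrite normrM ler_wpM2r.
case: (pickP (fun k : {ffun 'I_d -> 'I_(2 ^ j)} => true)) => [k _|no]; last first.
  have : (0 < #|{ffun 'I_d -> 'I_(2 ^ j)}|)%N by rewrite card_ffun !card_ord expn_gt0 expn_gt0.
  by rewrite (eq_card0 no).
rewrite -mulr_sumr ler_wpM2l ?sum_tensor//; exact: le_trans (hG k).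
Qed.

Lemma measurable_tensor_pdil j k : measurable_fun setT (tensor u j k).
Proof. apply: (@measurable_tensor _ _ (fun i => pdil (u i) j (k i : nat))) => i.
exact: measurable_pdil (hu i). Qed.

Lemma integral_norm_tensor j k :
  \int[mu]_x `|tensor u j k x| <= ((Num.sqrt 2 ^+ j)^-1 * I) ^+ d.
Proof.
have -> : \int[mu]_x `|tensor u j k x| = \prod_(i < d) \int[U]_t `|pdil (u i) j (k i : nat) t|.
  rewrite -(@Rintegral_tensor _ _ (fun i t => `|pdil (u i) j (k i : nat) t|) (8 * C * Num.sqrt 2 ^+ j)).
  - by apply: eq_Rintegral => x _; rewrite /tensor normr_prod.
  - by move=> i; apply: measurableT_comp => //; exact: measurable_pdil (hu i).
  - by move=> i t; rewrite normr_id; exact: pdil_bound.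
rewrite -{1}[X in _ <= _ ^+ X](card_ord d) -prodr_const; apply: ler_prod => i _.
rewrite Rintegral_ge0//=; apply: le_trans (integral_norm_pdil _ _ (mu_ i) (hu i)) _.
by rewrite ler_wpM2l ?invr_ge0 ?exprn_ge0 ?sqrtr_ge0.
Qed.

Lemma integrable_tensor_mul j k (G : 'rV[R]_d -> R) : mu.-integrable setT (EFin \o G) ->
  mu.-integrable setT (EFin \o (fun x => tensor u j k x * G x)).
Proof.
move=> iG; apply: (@integrable_mulbd _ _ _ mu _ _ _ ((8 * C * Num.sqrt 2 ^+ j) ^+ d)) => //.
- exact: measurable_tensor_pdil.
- by move=> x _; exact: tensor_bound.
Qed.

(** The part of the expansion of G that belongs to one level and one type of
    tensor; [levelE] writes it as an integral operator. *)
Definition level j (G : 'rV[R]_d -> R) x :=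
  \sum_k inner mu (tensor u j k) G * tensor u j k x.

Lemma levelE j G x : mu.-integrable setT (EFin \o G) ->
  level j G x = \int[mu]_y ((\prod_(i < d) pkernel (u i) j (x ord0 i) (y ord0 i)) * G y).
Proof.
move=> iG.
transitivity (\int[mu]_y (\sum_k tensor u j k x * (tensor u j k y * G y))).
  rewrite Rintegral_sum//.
    apply: eq_bigr => k _.
    by rewrite (@RintegralZl _ _ _ mu setT _ _ measurableT (integrable_tensor_mul k iG)) mulrC.
  by move=> k; apply: (@integrable_mulr _ _ _ mu) => //; exact: integrable_tensor_mul.
apply: eq_Rintegral => y _; rewrite -sum_tensor_kernel mulr_suml.
by apply: eq_bigr => k _; rewrite mulrA.
Qed.

Lemma measurable_level j G : measurable_fun setT (level j G).
Proof.
apply: measurable_sum => k; apply: measurable_funM => //.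
exact: measurable_tensor_pdil.
Qed.

Lemma integrable_level j G : mu.-integrable setT (EFin \o level j G).
Proof.
apply: integrable_sumr => // k; apply: (@integrable_mulr _ _ _ mu) => //.
apply: (@integrable_bounded _ _ _ _ _ ((8 * C * Num.sqrt 2 ^+ j) ^+ d)).
  exact: measurable_tensor_pdil.
by move=> x; exact: tensor_bound.
Qed.

(** The powers of 2 in the L^1 norm of a tensor and in the pointwise sum over
    all tensors of the level cancel, so the bound is uniform in the level. *)
Lemma level_L1 j G : mu.-integrable setT (EFin \o G) ->
  \int[mu]_x `|level j G x| <= (8 * C * I) ^+ d * \int[mu]_x `|G x|.
Proof.
move=> iG; have inG := integrable_norm iG.
pose s : R := (Num.sqrt 2 ^+ j)^-1.
have I0 (i : 'I_d) : 0 <= I by apply: le_trans (uI i); exact: Rintegral_ge0.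
have Id : 0 <= (s * I) ^+ d.
  have [d0|d0] := posnP d; first by rewrite [X in _ ^+ X]d0 expr0.
  by rewrite exprn_ge0// mulr_ge0 ?(I0 (Ordinal d0))// invr_ge0 exprn_ge0 ?sqrtr_ge0.
have it k : mu.-integrable setT (EFin \o (fun x => `|tensor u j k x|)).
  apply: (@integrable_bounded _ _ _ _ _ ((8 * C * Num.sqrt 2 ^+ j) ^+ d)).
    by apply: measurableT_comp => //; exact: measurable_tensor_pdil.
  by move=> x; rewrite normr_id; exact: tensor_bound.
have itG k : mu.-integrable setT (EFin \o (fun x => `|tensor u j k x| * `|G x|)).
  have := integrable_norm (integrable_tensor_mul k iG).
  by congr (mu.-integrable _ _); apply/funext => x /=; rewrite normrM.
apply: (@le_trans _ _ (\int[mu]_x (\sum_k `|inner mu (tensor u j k) G| * `|tensor u j k x|))).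
  apply: le_Rintegral => //.
  - exact: (integrable_norm (integrable_level j G)).
  - by apply: integrable_sumr => // k; exact: (@integrable_mulr _ _ _ mu).
  - move=> x _; apply: le_trans (ler_norm_sum _ _ _) _.
    by apply: ler_sum => k _; rewrite normrM.
rewrite Rintegral_sum//; last by move=> k; exact: (@integrable_mulr _ _ _ mu).
apply: (@le_trans _ _ (\sum_k (\int[mu]_x (`|tensor u j k x| * `|G x|)) * (s * I) ^+ d)).
  apply: ler_sum => k _; rewrite RintegralZl//; apply: ler_pM => //.
  - exact: Rintegral_ge0.
  - apply: (@le_norm_Rintegral _ _ _ mu) => //.
      exact: integrable_mfun (integrable_tensor_mul k iG).
    by move=> x _; rewrite normrM.
  - exact: integral_norm_tensor.
rewrite -mulr_suml -Rintegral_sum//.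
apply: (@le_trans _ _ (\int[mu]_x ((8 * C * Num.sqrt 2 ^+ j) ^+ d * `|G x|) * (s * I) ^+ d)).
  rewrite ler_wpM2r//; apply: le_Rintegral => //.
  - by apply: integrable_sumr.
  - exact: (@integrable_mulr _ _ _ mu).
  - by move=> x _; rewrite -mulr_suml ler_wpM2r// sum_tensor.
rewrite RintegralZl// mulrAC -exprMn; apply: eq_ler.
congr (_ ^+ d * _); rewrite /s; field.
by rewrite expf_neq0// gt_eqF// sqrtr_gt0.
Qed.

End tensor_wavelets.
Arguments tensor {R d} u j k x.

(** * Total variation and wavelet levels *)

Section antiderivative.
Context {R : realType}.
Local Notation leb := (@lebesgue_measure R).

(** A well localised function of mean zero has a well localised primitive:
    to the left of 0 integrate from -oo, to the right use that the two tails
    of the integral cancel. *)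
Lemma tame_antiderivative C (psi : R -> R) : 0 <= C -> continuous psi ->
  (forall x, `|psi x| <= C * decay x ^+ 3) -> \int[leb]_x psi x = 0 ->
  exists chi : R -> R, (forall x : R, is_derive x 1 chi (psi x)) /\ exists C', tame C' chi.
Proof.
move=> C0 cpsi hpsi psi0.
have mpsi : measurable_fun setT psi by exact: continuous_measurable_fun.
have hpsi1 : tame C psi.
  by move=> x; apply: le_trans (hpsi x) _; rewrite ler_wpM2l// decayX_le.
have ipsi := integrable_tame mpsi hpsi1.
have ipsiD (D : set R) : measurable D -> leb.-integrable D (EFin \o psi).
  by move=> mD; apply: (integrableS measurableT).
have idec (D : set R) : measurable D -> leb.-integrable D (EFin \o @decay R).
  by move=> mD; apply: (integrableS measurableT) => //; exact: integrable_decay.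
pose chi (x : R) := \int[leb]_(t in `]-oo, x]) psi t.
pose I := \int[leb]_x @decay R x.
have I0 : 0 <= I by apply: Rintegral_ge0 => x _; exact: decay_ge0.
exists chi; split.
  move=> x; have [||||dx ex] := @continuous_FTC1 R psi -oo%O x (x + 1).
  - by rewrite ltrDl.
  - exact: ipsiD.
  - by rewrite /= ltNyr.
  - exact: cpsi.
  by rewrite derive1E in ex; exact: (DeriveDef dx ex).
have bnd (D : set R) x : measurable D -> (forall t, D t -> `|x| <= `|t|) ->
    `|\int[leb]_(t in D) psi t| <= C * I * decay x.
  move=> mD Dx.
  apply: (@le_trans _ _ (\int[leb]_(t in D) (C * decay x * decay t))).
    apply: (@le_norm_Rintegral _ _ _ leb) => //.
    - exact: measurable_funS mpsi.
    - move=> t /Dx xt; apply: le_trans (hpsi t) _; rewrite -mulrA ler_wpM2l//.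
      have : decay t <= decay x.
        rewrite /decay lef_pV2 ?posrE ?exprn_gt0 ?ltr_pwDl//.
        by rewrite lerXn2r ?nnegrE ?addr_ge0// lerD2l.
      have := decay_ge0 t; have := decay_ge0 x; have := decay_le1 x; have := decay_le1 t.
      move: (decay t) (decay x) => a b a1 b1 b0 a0 ab.
      rewrite exprS [X in X <= _]mulrC ler_wpM2r// expr2; nra.
    - by apply: (@integrable_mulr _ _ _ leb) => //; exact: idec.
  rewrite RintegralZl//; last exact: idec.
  rewrite mulrAC ler_wpM2r ?decay_ge0// ler_wpM2l//.
  have -> : I = \int[leb]_(t in D `|` ~` D) decay t by rewrite setUv.
  rewrite Rintegral_setU//.
  - by rewrite lerDl Rintegral_ge0// => t _; exact: decay_ge0.
  - exact: measurableC.
  - by rewrite setUv; exact: idec.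
  - by rewrite disj_set2E setICr.
exists (C * I) => x; have [x0|x0] := leP x 0.
  by apply: bnd => // t; rewrite /= in_itv/= => tx; rewrite !ler0_norm ?lerN2//; exact: le_trans x0.
have -> : chi x = - \int[leb]_(t in ~` `]-oo, x]) psi t.
  apply/eqP; rewrite -addr_eq0 /chi; apply/eqP.
  rewrite -Rintegral_setU ?setUv//; first exact: measurableC.
  - by rewrite disj_set2E setICr.
rewrite normrN; apply: bnd; first exact: measurableC.
move=> t; rewrite /= in_itv/= => /negP; rewrite -ltNge => xt.
by rewrite !gtr0_norm ?(ltW xt)//; exact: lt_trans xt.
Qed.

End antiderivative.

Section partial_derivatives.
Context {R : realType} (d : nat).
Implicit Types (F : 'rV[R]_d -> R) (x v : 'rV[R]_d).

Lemma is_derive_line F (g : R -> R) x v (a l : R) :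
  (forall h : R, F (h *: v + x) = g (h + a)) -> is_derive a 1 g l -> is_derive x v F l.
Proof.
move=> Fg [dg lg].
have E : (fun h : R => h^-1 *: ((F \o shift x) (h *: v) - F x)) =
         (fun h : R => h^-1 *: ((g \o shift a) (h *: (1 : R)) - g a)).
  apply/funext => h /=; rewrite Fg.
  have := Fg 0; rewrite scale0r !add0r => ->.
  by rewrite /shift/= /GRing.scale/= mulr1.
by apply: DeriveDef; [rewrite /derivable E | rewrite -lg /derive E].
Qed.

Lemma is_derive_sumr (I : Type) (s : seq I) (f : I -> 'rV[R]_d -> R) (df : I -> R) x v :
  (forall i, is_derive x v (f i) (df i)) ->
  is_derive x v (fun y => \sum_(i <- s) f i y) (\sum_(i <- s) df i).
Proof.
move=> hf; elim: s => [|i s IHs].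
  rewrite big_nil (_ : (fun y => _) = cst 0); last by apply/funext => y; rewrite big_nil.
  exact: is_derive_cst.
rewrite big_cons (_ : (fun y => _) = f i + (fun y => \sum_(j <- s) f j y)).
  exact: is_deriveD.
by apply/funext => y; rewrite big_cons.
Qed.

(** [torus_C1] with the partial derivatives as data. *)
Definition C1_with F (dF : 'I_d -> 'rV[R]_d -> R) : Prop :=
  [/\ Defs.periodic F, continuous F, forall i x, is_derive x 'e_i F (dF i x) &
      forall i, continuous (dF i)].

Lemma C1_with_torus F dF : C1_with F dF -> torus_C1 F.
Proof.
move=> [F1 cF hF cdF]; split => //.
by move=> i; rewrite (_ : 'D_('e_i) F = dF i)//; apply/funext => x; by have [] := hF i x.
Qed.

Lemma continuous_mull a F : continuous F -> continuous (fun x => a * F x).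
Proof. by move=> cF x; apply: continuousM; [exact: cst_continuous | exact: cF]. Qed.

Lemma C1_withZ a F dF : C1_with F dF -> C1_with (fun x => a * F x) (fun i x => a * dF i x).
Proof.
move=> [F1 cF hF cdF]; split.
- by move=> x i; rewrite F1.
- exact: continuous_mull.
- by move=> i x; exact: is_deriveZ.
- by move=> i; exact: continuous_mull.
Qed.

Lemma C1_with_sum (I : Type) (s : seq I) (P : pred I)
    (F : I -> 'rV[R]_d -> R) (dF : I -> 'I_d -> 'rV[R]_d -> R) : (forall i : I, C1_with (F i) (dF i)) ->
  C1_with (fun x => \sum_(i <- s | P i) F i x) (fun l x => \sum_(i <- s | P i) dF i l x).
Proof.
move=> hF; split.
- by move=> x l; apply: eq_bigr => i _; have [->] := hF i.
- apply: continuous_big; last by move=> i _; have [] := hF i.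
  exact: add_continuous.
- move=> l x; under eq_fun do rewrite -big_filter.
  by rewrite -big_filter; apply: is_derive_sumr => i; have [] := hF i.
- move=> l; apply: continuous_big; last by move=> i _; have [] := hF i.
  exact: add_continuous.
Qed.

Lemma continuous_prod_coord (f : 'I_d -> R -> R) : (forall i, continuous (f i)) ->
  continuous (fun x : 'rV[R]_d => \prod_(i < d) f i (x ord0 i)).
Proof.
move=> cf; apply: continuous_big; first exact: mul_continuous.
move=> i _ x; apply: (@continuous_comp _ _ _ (fun x : 'rV[R]_d => x ord0 i)); last exact: cf.
exact: coord_continuous.
Qed.

Lemma is_derive_prod_coord (f : 'I_d -> R -> R) (i : 'I_d) (df : R -> R) x :
  (forall t : R, is_derive t 1 (f i) (df t)) ->
  is_derive x 'e_i (fun x : 'rV[R]_d => \prod_(l < d) f l (x ord0 l))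
    (\prod_(l < d) (if l == i then df else f l) (x ord0 l)).
Proof.
move=> hf; pose c := \prod_(l < d | l != i) f l (x ord0 l).
apply: (@is_derive_line _ (fun t => c * f i t) _ _ (x ord0 i)).
  move=> h; rewrite (bigD1 i)//= mulrC !mxE !eqxx/= mulr1; congr (_ * _).
  by apply: eq_bigr => l li; rewrite !mxE (negbTE li) andbF mulr0 add0r.
rewrite (bigD1 i)//= eqxx mulrC (_ : \prod_(_ < _ | _) _ = c); last first.
  by apply: eq_bigr => l li; rewrite (negbTE li).
exact: is_deriveZ.
Qed.

End partial_derivatives.

Section tensor_calculus.
Context {R : realType} (d : nat).
Local Notation mu := (torus_measure d : probability _ R).
Variables (v dv ddv : 'I_d -> R -> R) (C : R).
Hypotheses (hv : forall i, tame C (v i)) (hdv : forall i, tame C (dv i)).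
Hypotheses (hddv : forall i, tame C (ddv i)).
Hypotheses (d1 : forall i (x : R), is_derive x 1 (v i) (dv i x)).
Hypotheses (d2 : forall i (x : R), is_derive x 1 (dv i) (ddv i x)).

Lemma C1_with_tensor J (k : {ffun 'I_d -> 'I_(2 ^ J)}) :
  C1_with (tensor v J k) (fun i => fun x =>
    2 ^+ J * tensor (fun l => if l == i then dv l else v l) J k x).
Proof.
have cv i : continuous (pdil (v i) J (k i : nat)) by exact: pdil_continuous (d1 i) (hv i) (hdv i).
have cdv i : continuous (pdil (dv i) J (k i : nat)) by exact: pdil_continuous (d2 i) (hdv i) (hddv i).
split.
- move=> x i; apply: eq_bigr => l _; rewrite !mxE eqxx/=.
  by case: (l =P i) => [_|_]; rewrite ?addr0// (pdilS _ _ _ (hv l)).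
- exact: (@continuous_prod_coord R d (fun l => pdil (v l) J (k l : nat))).
- move=> i x.
  have := @is_derive_prod_coord R d (fun l => pdil (v l) J (k l : nat)) i _ x
    (is_derive_pdil J (k i : nat) (d1 i) (d2 i) (hv i) (hdv i) (hddv i)).
  congr is_derive; rewrite /tensor (bigD1 i)//= [in RHS](bigD1 i)//= !eqxx -mulrA.
  by congr (_ * (_ * _)); apply: eq_bigr => l /negbTE ->.
- move=> i; apply: continuous_mull.
  apply: (@continuous_prod_coord R d (fun l => pdil (if l == i then dv l else v l) J (k l : nat))) => l.
  by case: ifP.
Qed.

End tensor_calculus.

Section BV_duality.
Context {R : realType} (d : nat).
Local Notation mu := (torus_measure d : probability _ R).

(** The l^1 norm of a vector dominates its Euclidean norm, so the field divided
    by c is admissible in the definition of [BV_seminorm]. *)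
Lemma BV_seminorm_test (G : 'rV[R]_d -> R) (B c : R) (h : 'I_d -> 'rV[R]_d -> R)
    (dh : 'I_d -> 'I_d -> 'rV[R]_d -> R) : mu.-integrable setT (EFin \o G) ->
  (BV_seminorm G <= B%:E)%E -> 0 < c -> (forall i, C1_with (h i) (dh i)) ->
  (forall x, \sum_(i < d) `|h i x| <= c) ->
  mu.-integrable setT (EFin \o (fun x => G x * \sum_(i < d) dh i i x)) ->
  \int[mu]_x (G x * \sum_(i < d) dh i i x) <= c * B.
Proof.
move=> iG GB c0 Ch hc iGh.
have sq (a : 'I_d -> R) : Num.sqrt (\sum_(i < d) a i ^+ 2) <= \sum_(i < d) `|a i|.
  have s0 : 0 <= \sum_(i < d) `|a i| by rewrite sumr_ge0.
  rewrite -[X in _ <= X](ger0_norm s0) -sqrtr_sqr ler_wsqrtr// expr2 mulr_suml; apply: ler_sum => i _.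
  rewrite -real_normK ?num_real// expr2 ler_wpM2l//.
  by rewrite (bigD1 i)//= lerDl sumr_ge0.
pose h' i x := c^-1 * h i x.
have Ch' i : C1_with (h' i) (fun l x => c^-1 * dh i l x) by exact: C1_withZ.
have div x : divergence h' x = c^-1 * \sum_(i < d) dh i i x.
  rewrite /divergence mulr_sumr; apply: eq_bigr => i _.
  by have [_ _ /(_ i x) [_ ->] _] := Ch' i.
have : ((\int[mu]_x (G x * divergence h' x))%:E <= BV_seminorm G)%E.
  apply: ereal_sup_ubound; exists h' => //; split; first by move=> i; exact: C1_with_torus (Ch' i).
  move=> x; apply: le_trans (sq _) _.
  under eq_bigr do rewrite /h' normrM.
  by rewrite -mulr_sumr (gtr0_norm (_ : 0 < c^-1)) ?invr_gt0// ler_pdivrMl// mulr1.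
move=> /le_trans /(_ GB); rewrite lee_fin.
under eq_Rintegral do rewrite div mulrCA.
by rewrite RintegralZl// ler_pdivrMl.
Qed.

(** The total variation is at most B as far as fields with a bounded measurable
    divergence can tell.  Unlike [BV_seminorm] this is visibly subadditive, all
    the integrals being finite. *)
Definition tested_variation (G : 'rV[R]_d -> R) (B : R) : Prop :=
  forall (c M : R) (h : 'I_d -> 'rV[R]_d -> R) (dh : 'I_d -> 'I_d -> 'rV[R]_d -> R),
    0 < c -> (forall i, C1_with (h i) (dh i)) -> (forall x, \sum_(i < d) `|h i x| <= c) ->
    measurable_fun setT (fun x => \sum_(i < d) dh i i x) ->
    (forall x, `|\sum_(i < d) dh i i x| <= M) ->
    \int[mu]_x (G x * \sum_(i < d) dh i i x) <= c * B.

Let integrable_mul_div (G : 'rV[R]_d -> R) M (u : 'rV[R]_d -> R) :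
  mu.-integrable setT (EFin \o G) -> measurable_fun setT u -> (forall x, `|u x| <= M) ->
  mu.-integrable setT (EFin \o (fun x => G x * u x)).
Proof.
move=> iG mu_ uM.
have := @integrable_mulbd _ _ _ mu setT u G M measurableT mu_ (fun x _ => uM x) iG.
by congr (mu.-integrable _ _); apply/funext => x /=; rewrite mulrC.
Qed.

Lemma BV_tested_variation (G : 'rV[R]_d -> R) (B : R) : mu.-integrable setT (EFin \o G) ->
  (BV_seminorm G <= B%:E)%E -> tested_variation G B.
Proof.
move=> iG GB c M h dh c0 Ch hc mdiv divM.
by apply: BV_seminorm_test GB c0 Ch hc _ => //; exact: integrable_mul_div divM.
Qed.

Lemma tested_variationB (G H : 'rV[R]_d -> R) (B B' : R) :
  mu.-integrable setT (EFin \o G) -> mu.-integrable setT (EFin \o H) ->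
  tested_variation G B -> tested_variation H B' -> tested_variation (fun x => G x - H x) (B + B').
Proof.
move=> iG iH hG hH c M h dh c0 Ch hc mdiv divM.
have hN : \int[mu]_x (H x * \sum_(i < d) (-1 * dh i i x)) <= c * B'.
  apply: (@hH c M (fun i x => -1 * h i x) (fun i l x => -1 * dh i l x)) => //.
  - by move=> i; exact: C1_withZ.
  - by move=> x; under eq_bigr do rewrite mulN1r normrN.
  - by under eq_fun do rewrite -mulr_sumr; exact: measurable_funM.
  - by move=> x; rewrite -mulr_sumr mulN1r normrN.
have iGd := integrable_mul_div iG mdiv divM; have iHd := integrable_mul_div iH mdiv divM.
under eq_Rintegral do rewrite mulrBl.
rewrite RintegralB// mulrDr lerD//; first exact: hG divM.
rewrite -mulN1r -RintegralZl//; apply: le_trans hN; apply: eq_ler.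
by apply: eq_Rintegral => x _; rewrite -mulr_sumr mulrCA.
Qed.

End BV_duality.

Section wavelet_levels.
Context {R : realType} (d : nat).
Local Notation leb := (@lebesgue_measure R).
Local Notation mu := (torus_measure d : probability _ R).
Variables (phi psi : R -> R) (C : R).
Hypotheses (mphi : measurable_fun setT phi) (mpsi : measurable_fun setT psi).
Hypotheses (hphi : tame C phi) (hpsi : tame C psi).
Hypothesis kernelS : forall J x y, pkernel phi J.+1 x y = pkernel phi J x y + pkernel psi J x y.

(** [e] marks the coordinates in which the wavelet oscillates. *)
Definition mix (e : {ffun 'I_d -> bool}) (i : 'I_d) : R -> R := if e i then psi else phi.

(** The orthogonal projection onto the multiresolution space of level J. *)
Definition mra J (G : 'rV[R]_d -> R) := level (fun=> phi) J G.

Let mmix e i : measurable_fun setT (mix e i).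
Proof. by rewrite /mix; case: ifP. Qed.

Let hmix e i : tame C (mix e i).
Proof. by rewrite /mix; case: ifP. Qed.

Let mix0 : mix [ffun=> false] = fun=> phi.
Proof. by apply/funext => i; rewrite /mix ffunE. Qed.

Lemma wavelet_tensor J k e : wavelet phi psi k e = tensor (mix e) J k.
Proof. by []. Qed.

(** The kernel of level J + 1 is the product over the coordinates of the sums in
    [kernelS]; expanding it, the pure scaling term is the kernel of level J. *)
Lemma mraS J G x : mu.-integrable setT (EFin \o G) ->
  mra J.+1 G x = mra J G x + \sum_(e : {ffun 'I_d -> bool} | [exists i, e i]) level (mix e) J G x.
Proof.
move=> iG.
have -> : mra J G x = level (mix [ffun=> false]) J G x.
  by rewrite mix0.
transitivity (\sum_e level (mix e) J G x); last first.
  rewrite (bigID (fun e : {ffun 'I_d -> bool} => [exists i, e i]))/= addrC; congr (_ + _).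
  rewrite (big_pred1 [ffun=> false])// => e; apply/idP/eqP => [ne|->].
    apply/ffunP => i; rewrite ffunE; apply/negbTE/negP => ei.
    by move/negP: ne; apply; apply/existsP; exists i.
  by apply/existsPn => i; rewrite ffunE.
rewrite /mra (levelE (fun=> mphi) (fun=> hphi))//.
have bk u J' y z : tame C u -> `|pkernel u J' y z| <= (8 * C * Num.sqrt 2 ^+ J') * (8 * C * Num.sqrt 2 ^+ J').
  move=> hu; apply: le_trans (ler_norm_sum _ _ _) _.
  apply: (@le_trans _ _ (\sum_(k < 2 ^ J') (8 * C * Num.sqrt 2 ^+ J') * `|pdil u J' (k : nat) z|)).
    by apply: ler_sum => k _; rewrite normrM ler_wpM2r// pdil_bound.
  rewrite -mulr_sumr ler_wpM2l ?sum_pdil//.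
  by rewrite !mulr_ge0 ?exprn_ge0 ?sqrtr_ge0// (tame_ge0 hu).
have mk u J' y : measurable_fun setT u -> tame C u -> measurable_fun setT (pkernel u J' y).
  move=> mu hu; apply: measurable_sum => k; apply: measurable_funM => //.
  exact: measurable_pdil hu.
transitivity (\int[mu]_y (\sum_e (\prod_(i < d) pkernel (mix e i) J (x ord0 i) (y ord0 i)) * G y)).
  apply: eq_Rintegral => y _; rewrite -mulr_suml; congr (_ * _).
  under eq_bigr do rewrite kernelS.
  rewrite -(bigA_distr_bigA (fun i (b : bool) => pkernel (if b then psi else phi) J (x ord0 i) (y ord0 i))).
  by apply: eq_bigr => i _; rewrite big_bool addrC.
rewrite Rintegral_sum//; first by apply: eq_bigr => e _; rewrite (levelE (mmix e) (hmix e)).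
move=> e; apply: (@integrable_mulbd _ _ _ mu _ _ _ (((8 * C * Num.sqrt 2 ^+ J) * (8 * C * Num.sqrt 2 ^+ J)) ^+ #|'I_d|)) => //.
  by apply: (@measurable_tensor R d (fun i => pkernel (mix e i) J (x ord0 i))) => i; exact: mk.
by move=> y _; apply: prod_bound => i; exact: bk.
Qed.

(** The blocks of level j are bounded by a multiple of delta 2 ^ (d j / 2), and
    these bounds add up geometrically. *)
Lemma mra_sup_bound G delta J x : (0 < d)%N -> mu.-integrable setT (EFin \o G) ->
  (forall j k (e : {ffun 'I_d -> bool}), (j == 0)%N || [exists i, e i] ->
    `|inner mu (@wavelet R d phi psi j k e) G| <= delta) ->
  `|mra J G x| <= 4 * 2 ^+ d * delta * (8 * C * Num.sqrt 2 ^+ J) ^+ d.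
Proof.
move=> d0 iG hG.
have C0 : 0 <= C by exact: tame_ge0 hphi.
have s0 j : 0 <= (8 * C * Num.sqrt 2 ^+ j) ^+ d :> R.
  by rewrite exprn_ge0// !mulr_ge0 ?exprn_ge0 ?sqrtr_ge0.
have dl0 : 0 <= delta.
  have := @hG 0%N [ffun=> Ordinal (isT : (0 < 2 ^ 0)%N)] [ffun=> false] isT.
  exact: le_trans (normr_ge0 _).
have twod : 1 <= 2 ^+ d :> R by rewrite exprn_ege1// ler1n.
elim: J => [|J IHJ].
  apply: le_trans (_ : delta * (8 * C * Num.sqrt 2 ^+ 0) ^+ d <= _).
    apply: (@sum_coef_tensor _ _ (fun=> phi) _ (fun=> hphi)) => k.
    have := @hG 0%N k [ffun=> false] isT; rewrite wavelet_tensor.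
    by rewrite mix0.
  by rewrite ler_wpM2r// ler_peMl//; nra.
rewrite mraS//; apply: le_trans (ler_normD _ _) _.
have hs : `|\sum_(e : {ffun 'I_d -> bool} | [exists i, e i]) level (mix e) J G x| <=
    2 ^+ d * (delta * (8 * C * Num.sqrt 2 ^+ J) ^+ d).
  apply: le_trans (ler_norm_sum _ _ _) _.
  apply: (@le_trans _ _ (\sum_(e : {ffun 'I_d -> bool}) delta * (8 * C * Num.sqrt 2 ^+ J) ^+ d)).
    rewrite big_mkcond/=; apply: ler_sum => e _; case: ifP => [he|_]; last by rewrite mulr_ge0.
    apply: (sum_coef_tensor (hmix e)) => k; have := @hG J k e; rewrite he orbT; exact.
  by rewrite sumr_const card_ffun card_bool card_ord -[X in X <= _]mulr_natl natrX.
apply: le_trans (lerD IHJ hs) _.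
have -> : (8 * C * Num.sqrt 2 ^+ J.+1) ^+ d = Num.sqrt 2 ^+ d * (8 * C * Num.sqrt 2 ^+ J) ^+ d.
  by rewrite -exprMn exprS mulrCA.
(* the constant a = 4 satisfies a + 1 <= a sqrt 2 ^ d *)
have : 5 / 4 <= Num.sqrt 2 ^+ d :> R.
  apply: (@le_trans _ _ (Num.sqrt 2)); last first.
    by rewrite ler_eXnr// -[X in X <= _]sqrtr1 ler_wsqrtr// ler1n.
  rewrite -[X in X <= _]ger0_norm ?divr_ge0// -sqrtr_sqr ler_wsqrtr//.
  by rewrite expr2; lra.
have := mulr_ge0 dl0 (s0 J); move: twod.
move: (2 ^+ d) (Num.sqrt 2 ^+ d) ((8 * C * Num.sqrt 2 ^+ J) ^+ d) => a b c a1 dc b54.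
have ab : 0 <= (b - 5 / 4) * (a * (delta * c)) by rewrite mulr_ge0 ?subr_ge0// mulr_ge0//; lra.
by move: ab; lra.
Qed.

End wavelet_levels.

(** * Consecutive levels in L^1 *)

Section level_duality.
Context {R : realType} (d : nat).
Local Notation leb := (@lebesgue_measure R).
Local Notation mu := (torus_measure d : probability _ R).
Variables (u : 'I_d -> R -> R) (C I : R).
Hypotheses (mu_ : forall i, measurable_fun setT (u i)) (hu : forall i, tame C (u i)).
Hypothesis (uI : forall i, \int[leb]_x `|u i x| <= I).

Lemma integrable_tensor J k : mu.-integrable setT (EFin \o tensor u J k).
Proof.
apply: (@integrable_bounded _ _ _ _ _ ((8 * C * Num.sqrt 2 ^+ J) ^+ d)).
  exact: measurable_tensor_pdil.
by move=> x; exact: tensor_bound.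
Qed.

Lemma inner_tensor_bound J k (s : 'rV[R]_d -> R) : measurable_fun setT s ->
  (forall x, `|s x| <= 1) -> `|inner mu (tensor u J k) s| <= ((Num.sqrt 2 ^+ J)^-1 * I) ^+ d.
Proof.
move=> ms s1; apply: le_trans (integral_norm_tensor mu_ hu uI k).
apply: (@le_norm_Rintegral _ _ _ mu) => //.
- by apply: measurable_funM => //; exact: measurable_tensor_pdil.
- by move=> x _; rewrite normrM ler_piMr.
- exact: (integrable_norm (integrable_tensor k)).
Qed.

(** Both sides are the sum over k of the products of the coefficients of G and
    s. *)
Lemma level_adjoint J (G s : 'rV[R]_d -> R) : mu.-integrable setT (EFin \o G) ->
  measurable_fun setT s -> (forall x, `|s x| <= 1) ->
  \int[mu]_x (level u J G x * s x) = \int[mu]_x (G x * level u J s x).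
Proof.
move=> iG ms s1.
have is_ : mu.-integrable setT (EFin \o s) by exact: integrable_bounded ms s1.
have iGt := integrable_tensor_mul mu_ hu _ iG; have ist := integrable_tensor_mul mu_ hu _ is_.
transitivity (\sum_k inner mu (tensor u J k) G * inner mu (tensor u J k) s).
  under eq_Rintegral do rewrite mulr_suml.
  rewrite Rintegral_sum//.
    apply: eq_bigr => k _; rewrite -(@RintegralZl _ _ _ mu setT _ _ measurableT (ist J k)).
    by apply: eq_Rintegral => x _; rewrite mulrA.
  move=> k; have := @integrable_mulr _ _ _ mu setT _ (inner mu (tensor u J k) G) measurableT (ist J k).
  by congr (mu.-integrable _ _); apply/funext => x /=; rewrite mulrA.
under [RHS]eq_Rintegral do rewrite mulr_sumr.
rewrite Rintegral_sum//.
  apply: eq_bigr => k _; rewrite mulrC -(@RintegralZl _ _ _ mu setT _ _ measurableT (iGt J k)).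
  by apply: eq_Rintegral => x _; rewrite mulrA [LHS]mulrC.
move=> k; have := @integrable_mulr _ _ _ mu setT _ (inner mu (tensor u J k) s) measurableT (iGt J k).
by congr (mu.-integrable _ _); apply/funext => x /=; rewrite mulrA; congr (_%:E); rewrite mulrC.
Qed.

End level_duality.

Section level_BV.
Context {R : realType} (d : nat).
Local Notation leb := (@lebesgue_measure R).
Local Notation mu := (torus_measure d : probability _ R).
Variables (phi psi chi phi' psi' phi'' psi'' : R -> R) (C I : R).
Hypotheses (hphi : tame C phi) (hpsi : tame C psi) (hchi : tame C chi).
Hypotheses (hphi' : tame C phi') (hpsi' : tame C psi').
Hypotheses (hphi'' : tame C phi'') (hpsi'' : tame C psi'').
Hypotheses (dphi : forall x : R, is_derive x 1 phi (phi' x)).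
Hypotheses (dpsi : forall x : R, is_derive x 1 psi (psi' x)).
Hypotheses (dchi : forall x : R, is_derive x 1 chi (psi x)).
Hypotheses (dphi' : forall x : R, is_derive x 1 phi' (phi'' x)).
Hypotheses (dpsi' : forall x : R, is_derive x 1 psi' (psi'' x)).
Hypotheses (phiI : \int[leb]_x `|phi x| <= I) (psiI : \int[leb]_x `|psi x| <= I).
Hypothesis kernelS : forall J x y, pkernel phi J.+1 x y = pkernel phi J x y + pkernel psi J x y.

Let mphi : measurable_fun setT phi := continuous_measurable_fun (is_derive_continuous dphi).
Let mpsi : measurable_fun setT psi := continuous_measurable_fun (is_derive_continuous dpsi).
Local Notation mix := (mix phi psi).

Let mmix e (i : 'I_d) : measurable_fun setT (mix e i).
Proof. by rewrite /mix; case: ifP. Qed.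

Let hmix e (i : 'I_d) : tame C (mix e i).
Proof. by rewrite /mix; case: ifP. Qed.

Let mixI e (i : 'I_d) : \int[leb]_x `|mix e i x| <= I.
Proof. by rewrite /mix; case: ifP. Qed.

(** A wavelet of type [e] is charged to one coordinate [i] in which it
    oscillates. There its factor is the derivative of a dilate of [chi], so
    integrating the wavelet in that coordinate gains the factor 2 ^ - J in
    [field]. *)
Let prim e i (l : 'I_d) := if l == i then chi else mix e l.

Let field J s i x := (2 ^+ J)^-1 * \sum_(e : {ffun 'I_d -> bool} | [pick l | e l] == Some i)
  \sum_k inner mu (tensor (mix e) J k) s * tensor (prim e i) J k x.

(** The derivative of the i-th component of [field] in the direction l. *)
Let dfield J s i l x := (2 ^+ J)^-1 * \sum_(e : {ffun 'I_d -> bool} | [pick l | e l] == Some i)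
  \sum_k inner mu (tensor (mix e) J k) s * (2 ^+ J *
    tensor (fun m => if m == l then
      (if m == i then psi else if e m then psi' else phi') else prim e i m) J k x).

Let field_C1 J s i : C1_with (field J s i) (dfield J s i).
Proof.
apply: C1_withZ; apply: C1_with_sum => e; apply: C1_with_sum => k; apply: C1_withZ.
apply: (@C1_with_tensor _ _ (prim e i) (fun m => if m == i then psi else if e m then psi' else phi')
  (fun m => if m == i then psi' else if e m then psi'' else phi'') C); rewrite /prim /mix => m;
  by do !case: ifP.
Qed.

Let sum_pick (F : {ffun 'I_d -> bool} -> R) :
  \sum_(i < d) \sum_(e : {ffun 'I_d -> bool} | [pick l | e l] == Some i) F e =
  \sum_(e : {ffun 'I_d -> bool} | [exists i, e i]) F e.
Proof.
under eq_bigr do rewrite big_mkcond; rewrite exchange_big [RHS]big_mkcond/=.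
apply: eq_bigr => e _; case: pickP => [i ei|ne].
  have -> : [exists i, e i] by apply/existsP; exists i.
  by rewrite (bigD1 i)//= eqxx big1 ?addr0// => l li; case: eqP => // -[il]; rewrite il eqxx in li.
have -> : [exists i, e i] = false by apply/existsPn => i; rewrite ne.
by rewrite big1.
Qed.

Let div_field J s x : \sum_(i < d) dfield J s i i x =
  \sum_(e : {ffun 'I_d -> bool} | [exists i, e i]) level (mix e) J s x.
Proof.
rewrite -sum_pick; apply: eq_bigr => i _; rewrite /dfield mulr_sumr.
apply: eq_bigr => e /eqP pe; rewrite mulr_sumr; apply: eq_bigr => k _.
rewrite mulrCA mulKf ?expf_neq0//; congr (_ * _); apply: eq_bigr => l _.
rewrite /prim /mix; case: eqP => // ->.
by case: pickP pe => // m em [<-]; rewrite em.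
Qed.

Definition BV_const : R := 2 ^+ d * (8 * C * I) ^+ d + 1.

Let I_ge0 : 0 <= I.
Proof. by apply: le_trans phiI; exact: Rintegral_ge0. Qed.

Let C_ge0 : 0 <= C.
Proof. exact: tame_ge0 hphi. Qed.

Lemma BV_const_ge0 : 0 <= BV_const.
Proof. by rewrite addr_ge0// mulr_ge0// exprn_ge0// !mulr_ge0. Qed.

(** As in [level_L1], the L^1 norms of the wavelets, which bound the
    coefficients of s, balance the pointwise sums over the level. *)
Let field_bound J (s : 'rV[R]_d -> R) x : measurable_fun setT s -> (forall x, `|s x| <= 1) ->
  \sum_(i < d) `|field J s i x| <= (2 ^+ J)^-1 * BV_const.
Proof.
move=> ms s1; pose M : R := (8 * C * I) ^+ d.
have M0 : 0 <= M by rewrite exprn_ge0// !mulr_ge0.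
have fb i : `|field J s i x| <= (2 ^+ J)^-1 *
    \sum_(e : {ffun 'I_d -> bool} | [pick l | e l] == Some i) M.
  rewrite normrM ger0_norm ?invr_ge0 ?exprn_ge0// ler_wpM2l ?invr_ge0 ?exprn_ge0//.
  apply: le_trans (ler_norm_sum _ _ _) _; apply: ler_sum => e _.
  have hp l : tame C (prim e i l) by rewrite /prim; case: ifP.
  apply: le_trans (sum_coef_tensor hp x (fun k => inner_tensor_bound (mmix e) (hmix e) (mixI e) k ms s1)) _.
  rewrite -exprMn /M; apply: eq_ler; congr (_ ^+ d); field.
  by rewrite expf_neq0// gt_eqF// sqrtr_gt0.
apply: le_trans (ler_sum _ (fun i _ => fb i)) _.
rewrite -mulr_sumr ler_wpM2l ?invr_ge0 ?exprn_ge0// sum_pick.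
apply: (@le_trans _ _ (\sum_(e : {ffun 'I_d -> bool}) M)).
  by rewrite big_mkcond; apply: ler_sum => e _; case: ifP.
by rewrite sumr_const card_ffun card_bool card_ord -[X in X <= _]mulr_natl natrX lerDl.
Qed.

(** Consecutive levels differ by a divergence of a field of size 2^-J: pair the
    difference with its own sign and move the operator to the sign. *)
Lemma mra_diff_L1 J G B : mu.-integrable setT (EFin \o G) -> tested_variation G B ->
  \int[mu]_x `|mra phi J.+1 G x - mra phi J G x| <= (2 ^+ J)^-1 * BV_const * B.
Proof.
move=> iG GB.
pose D x := \sum_(e : {ffun 'I_d -> bool} | [exists i, e i]) level (mix e) J G x.
have ED x : mra phi J.+1 G x - mra phi J G x = D x.
  by rewrite (mraS mphi mpsi hphi hpsi kernelS)// addrAC subrr add0r.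
have mlev e (s : 'rV[R]_d -> R) : measurable_fun setT (level (mix e) J s) by exact: (measurable_level (mmix e) (hmix e)).
have mD : measurable_fun setT D.
  rewrite /D; under eq_fun do rewrite -big_filter.
  exact: measurable_sum.
pose s x : R := if 0 < D x then 1 else -1.
have ms : measurable_fun setT s.
  apply: measurable_fun_ifT => //.
  exact: measurable_fun_ltr.
have s1 x : `|s x| <= 1 by rewrite /s; case: ifP => _; rewrite ?normrN normr1.
have Ds x : `|D x| = D x * s x.
  rewrite /s; case: ltP => D0; first by rewrite gtr0_norm// mulr1.
  by rewrite ler0_norm// mulrN1.
have is_ : mu.-integrable setT (EFin \o s) by exact: integrable_bounded ms s1.
have ilev e : mu.-integrable setT (EFin \o (fun x => level (mix e) J G x * s x)).
  have := @integrable_mulbd _ _ _ mu setT s (level (mix e) J G) 1 measurableT ms (fun x _ => s1 x)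
    (integrable_level (mmix e) (hmix e) J G).
  by congr (mu.-integrable _ _); apply/funext => x /=; rewrite mulrC.
have slev e x : `|level (mix e) J s x| <= (8 * C * I) ^+ d.
  apply: le_trans (sum_coef_tensor (hmix e) x (fun k => inner_tensor_bound (mmix e) (hmix e) (mixI e) k ms s1)) _.
  rewrite -exprMn; apply: eq_ler; congr (_ ^+ d); field.
  by rewrite expf_neq0// gt_eqF// sqrtr_gt0.
have iGlev e : mu.-integrable setT (EFin \o (fun x => G x * level (mix e) J s x)).
  have := @integrable_mulbd _ _ _ mu setT (level (mix e) J s) G ((8 * C * I) ^+ d) measurableT
    (mlev e s) (fun x _ => slev e x) iG.
  by congr (mu.-integrable _ _); apply/funext => x /=; rewrite mulrC.
have -> : \int[mu]_x `|mra phi J.+1 G x - mra phi J G x| =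
    \int[mu]_x (G x * \sum_(i < d) dfield J s i i x).
  under eq_Rintegral do rewrite ED Ds mulr_suml -big_filter.
  under [RHS]eq_Rintegral do rewrite div_field mulr_sumr -big_filter.
  rewrite Rintegral_sum// Rintegral_sum//.
  by apply: eq_bigr => e _; exact: (level_adjoint (mmix e) (hmix e)).
apply: (GB _ (\sum_(e : {ffun 'I_d -> bool} | [exists i, e i]) (8 * C * I) ^+ d) (field J s) (dfield J s)) => //.
- by rewrite mulr_gt0 ?invr_gt0 ?exprn_gt0// ltr_wpDl// mulr_ge0// exprn_ge0// !mulr_ge0.
- by move=> x; exact: field_bound.
- under eq_fun do rewrite div_field -big_filter.
  exact: measurable_sum.
- move=> x; rewrite div_field; apply: le_trans (ler_norm_sum _ _ _) _.
  by apply: ler_sum => e _.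
Qed.

End level_BV.

(** * Convergence of the projections in L^1 *)

Section ray_approximation.
Context {R : realType}.

Let sin_lip (x y : R) : `|sin x - sin y| <= `|x - y|.
Proof.
rewrite -[X in _ <= X]mul1r; apply: (@derive_lipschitz _ sin cos) => // z.
by rewrite ler_norml cos_geN1 cos_le1.
Qed.

(** Indicators of rays are, on ]0, 1[, pointwise limits of Lipschitz functions of
    period 1: saturate multiples of sin (pi t) sin (pi (r - t)), which on ]0, 1[
    is positive exactly for t < r. *)
Lemma ray_approx (a : \bar R) : exists chi : R -> R, exists f : nat -> R -> R,
  [/\ measurable_fun setT chi /\ (forall t, `|chi t| <= 1),
      forall t, 0 < t < 1 -> chi t = (t%:E < a)%E%:R,
      forall n, exists2 Lf, 0 <= Lf & forall x y, `|f n x - f n y| <= Lf * `|x - y|,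
      forall n t, f n (t + 1) = f n t /\ `|f n t| <= 1 &
      forall t, f n t @[n --> \oo] --> chi t].
Proof.
have const (b : bool) : (forall t, 0 < t < 1 -> (t%:E < a)%E = b) ->
  exists chi : R -> R, exists f : nat -> R -> R,
  [/\ measurable_fun setT chi /\ (forall t, `|chi t| <= 1),
      forall t, 0 < t < 1 -> chi t = (t%:E < a)%E%:R,
      forall n, exists2 Lf, 0 <= Lf & forall x y, `|f n x - f n y| <= Lf * `|x - y|,
      forall n t, f n (t + 1) = f n t /\ `|f n t| <= 1 &
      forall t, f n t @[n --> \oo] --> chi t].
  move=> hb; exists (cst b%:R), (fun=> cst b%:R); split => //.
  - by split => // t; rewrite /= normr_nat lern1 leq_b1.
  - by move=> t /hb ->.
  - by move=> n; exists 0 => // x y; rewrite subrr normr0 mul0r.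
  - by move=> n t; split => //; rewrite /= normr_nat lern1 leq_b1.
  - by move=> t; exact: cvg_cst.
have [a0|a0] := leP a 0%E.
  by apply: (const false) => t /andP[t0 _]; apply/negbTE; rewrite -leNgt (le_trans a0)// lee_fin ltW.
have [a1|a1] := leP 1%E a.
  by apply: (const true) => t /andP[_ t1]; apply: lt_le_trans a1; rewrite lte_fin.
have {const} [r [ra r0 r1]] : exists r, [/\ a = r%:E, 0 < r & r < 1].
  by case: a a0 a1 {const} => [r| |]//; rewrite !lte_fin; exists r.
rewrite {}ra {a a0 a1}.
have pi0 : 0 < (pi : R) by exact: pi_gt0.
pose w t : R := sin (pi * t) * sin (pi * (r - t)).
have sinBpi (x : R) : sin (x - pi) = - sin x by rewrite -[in RHS](subrK pi x) sinDpi opprK.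
have w1 t : w (t + 1) = w t.
  rewrite /w mulrDr mulr1 sinDpi opprD addrA mulrBr mulr1 sinBpi.
  by rewrite mulrNN.
have sin1 (x : R) : `|sin x| <= 1 by rewrite ler_norml sin_geN1 sin_le1.
have wL x y : `|w x - w y| <= 2 * pi * `|x - y|.
  have -> : w x - w y = (sin (pi * x) - sin (pi * y)) * sin (pi * (r - x)) +
      sin (pi * y) * (sin (pi * (r - x)) - sin (pi * (r - y))) by rewrite /w; ring.
  have -> : 2 * pi * `|x - y| = pi * `|x - y| + pi * `|x - y| by ring.
  apply: le_trans (ler_normD _ _) _; rewrite !normrM; apply: lerD.
    apply: (@le_trans _ _ (`|sin (pi * x) - sin (pi * y)|)); first by rewrite ler_piMr.
    by apply: le_trans (sin_lip _ _) _; rewrite -mulrBr normrM gtr0_norm.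
  apply: (@le_trans _ _ (`|sin (pi * (r - x)) - sin (pi * (r - y))|)); first by rewrite ler_piMl.
  apply: le_trans (sin_lip _ _) _; rewrite -mulrBr normrM gtr0_norm//.
  by rewrite ler_wpM2l ?(ltW pi0)// (_ : r - x - (r - y) = y - x) 1?distrC//; ring.
pose chi t : R := (0 < w t)%R%:R.
pose f n t : R := Num.min 1 (n%:R * Num.max 0 (w t)).
exists chi, f; split.
- split; last by move=> t; rewrite /chi normr_nat lern1 leq_b1.
  have mw : measurable_fun setT w by apply: continuous_measurable_fun; exact: lipschitz_continuous wL.
  rewrite (_ : chi = fun t => if 0 < w t then 1 else 0); last first.
    by apply/funext => t; rewrite /chi; case: ifP.
  by apply: measurable_fun_ifT => //; exact: measurable_fun_ltr.
- move=> t /andP[t0 t1]; rewrite /chi lte_fin; congr (nat_of_bool _)%:R.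
  have st : 0 < sin (pi * t).
    by apply: sin_gt0_pi; rewrite mulr_gt0//= -[X in _ < X]mulr1 ltr_pM2l.
  rewrite /w pmulr_rgt0//; have [tr|rt] := ltP t r.
    apply: sin_gt0_pi; rewrite mulr_gt0 ?subr_gt0//= -[X in _ < X]mulr1 ltr_pM2l//.
    by lra.
  apply/negbTE; rewrite -leNgt -oppr_ge0 -sinN -mulrN opprB.
  apply: sin_ge0_pi; rewrite mulr_ge0 ?subr_ge0 ?(ltW pi0)//= -[X in _ <= X]mulr1 ler_pM2l//.
  by lra.
- move=> n; exists (n%:R * (2 * pi)); first by rewrite !mulr_ge0// ltW.
  move=> x y; apply: (@le_trans _ _ (n%:R * `|w x - w y|)); last by rewrite -mulrA ler_wpM2l.
  have min_lip (p q : R) : `|Num.min 1 p - Num.min 1 q| <= `|p - q|.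
    by rewrite /Num.min; do !case: ifPn => ?; rewrite ?ler_norml; case: (ger0P (p - q)) => ?; lra.
  have max_lip (p q : R) : `|Num.max 0 p - Num.max 0 q| <= `|p - q|.
    by rewrite /Num.max; do !case: ifPn => ?; rewrite ?ler_norml; case: (ger0P (p - q)) => ?; lra.
  apply: le_trans (min_lip _ _) _; rewrite -mulrBr normrM ger0_norm// ler_wpM2l//.
- move=> n t; rewrite /f w1; split => //.
  rewrite ger0_norm ?ge_min ?lexx// le_min ler01 mulr_ge0//.
  by rewrite le_max lexx.
- move=> t; rewrite /chi /f; case: ltP => wt; last first.
    rewrite (_ : (fun n => _) = cst 0); first exact: cvg_cst.
    by apply/funext => n; rewrite mulr0 min_r.
  apply: cvg_near_cst; exists (Num.bound (w t)^-1) => //= n Nn.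
  rewrite min_l// -ler_pdivrMr// mul1r.
  apply: (@le_trans _ _ (Num.bound (w t)^-1)%:R); last by rewrite ler_nat.
  by apply/ltW/archi_boundP; rewrite invr_ge0 ltW.
Qed.

End ray_approximation.

Section boxes.
Context {R : realType} (d : nat).

(** With infinite sides allowed, the boxes contain the half spaces that generate
    the measurable sets. *)
Definition box (a : 'I_d -> \bar R) : set 'rV[R]_d := [set x | forall i, ((x ord0 i)%:E < a i)%E].

Lemma measurable_box a : measurable (box a).
Proof.
have -> : box a = \bigcap_(i : 'I_d) (row_coord i @^-1` [set t : measurableTypeR R | (t%:E < a i)%E]).
  by apply/seteqP; split => x /= h; [move=> i _; exact: h | move=> i; exact: h].
apply: fin_bigcap_measurable => // i _; rewrite -[X in measurable X]setTI.
apply: measurable_row_coord => //; case: (a i) => [r| |].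
- rewrite (_ : [set _ | _] = `]-oo, r[%classic); first exact: measurable_itv.
  by apply/seteqP; split => t /=; rewrite in_itv/= lte_fin.
- by rewrite (_ : [set _ | _] = setT)//; apply/seteqP; split => t //= _; rewrite ltry.
- by rewrite (_ : [set _ | _] = set0)//; apply/seteqP; split => t //=; rewrite ltNge leNye.
Qed.

Lemma measurable_boxes : measurable = <<s range box >> :> set (set 'rV[R]_d).
Proof.
apply/seteqP; split => [A|]; last first.
  apply: smallest_sub; first exact: sigma_algebra_measurable.
  by move=> _ [a _ <-]; exact: measurable_box.
suff : g_sigma_preimage (@row_coord R d) `<=` <<s range box >> by apply.
apply: smallest_sub; first exact: smallest_sigma_algebra.
rewrite -bigcup_seq; apply: bigcup_sub => i _ _ [B mB <-].
pose V : measurableType _ := g_sigma_algebraType (range box).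
suff mi : measurable_fun [set: V] (row_coord i : V -> measurableTypeR R) by exact: (mi measurableT B mB).
apply: (@measurability _ _ V (measurableTypeR R) setT (row_coord i) (@RGenInftyO.G R) (RGenInftyO.measurableE R)).
move=> _ [_ [r ->] <-]; apply: sub_sigma_algebra.
exists (fun j => if j == i then r%:E else +oo%E) => //.
rewrite setTI; apply/seteqP; split => x /=.
  by move=> /(_ i); rewrite eqxx lte_fin /= in_itv.
by rewrite in_itv/= => xr j; case: eqP => [->|_]; rewrite ?lte_fin// ltry.
Qed.

Lemma setI_closed_boxes : setI_closed (range box).
Proof.
move=> _ _ [a _ <-] [b _ <-]; exists (fun i => mine (a i) (b i)) => //.
apply/seteqP; split => x /=; first by move=> h; split => i; have := h i; rewrite lt_min => /andP[].
by move=> [ha hb] i; rewrite lt_min ha hb.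
Qed.

End boxes.

Lemma cvgn_prod {R : realType} (I : Type) (s : seq I) (f : I -> nat -> R) (l : I -> R) :
  (forall i, f i n @[n --> \oo] --> l i) ->
  \prod_(i <- s) f i n @[n --> \oo] --> \prod_(i <- s) l i.
Proof.
move=> fl; elim: s => [|i s IHs].
  by rewrite big_nil; under eq_fun do rewrite big_nil; exact: cvg_cst.
by rewrite big_cons; under eq_fun do rewrite big_cons; exact: cvgM.
Qed.

Lemma prod_norm_le1 {R : realType} (I : finType) (f : I -> R) : (forall i, `|f i| <= 1) ->
  `|\prod_i f i| <= 1.
Proof. by move=> /prod_bound; rewrite expr1n. Qed.

Section density.
Context {R : realType} (d : nat).
Local Notation leb := (@lebesgue_measure R).
Local Notation U := (uniform_prob (@ltr01 R)).
Local Notation mu := (torus_measure d : probability _ R).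
Variables (phi : R -> R) (C I A : R).
Hypotheses (mphi : measurable_fun setT phi) (hphi : tame C phi).
Hypothesis phiI : \int[leb]_x `|phi x| <= I.
Hypothesis A_ge0 : 0 <= A.
Hypothesis approx : forall (f : R -> R) Lf J x, 0 <= Lf ->
  (forall x, f (x + 1) = f x) -> (forall x y, `|f x - f y| <= Lf * `|x - y|) ->
  `|pproj phi J f x - f x| <= A * Lf * (2 ^+ J)^-1.
Implicit Types (G H : 'rV[R]_d -> R).

Local Notation proj := (mra phi).
Local Notation integ G := (mu.-integrable setT (EFin \o G)).

Lemma L1_triangle G H : integ G -> integ H ->
  \int[mu]_x `|G x + H x| <= \int[mu]_x `|G x| + \int[mu]_x `|H x|.
Proof.
move=> iG iH; rewrite -RintegralD//; last 2 first.
- exact: (integrable_norm iG).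
- exact: (integrable_norm iH).
apply: le_Rintegral => //.
- exact: (integrable_norm (@integrable_add _ _ _ mu _ _ _ measurableT iG iH)).
- exact: (@integrable_add _ _ _ mu _ _ _ measurableT (integrable_norm iG) (integrable_norm iH)).
- by move=> x _; exact: ler_normD.
Qed.

Lemma integ_mra J G : integ (proj J G).
Proof. exact: (integrable_level (fun=> mphi) (fun=> hphi)). Qed.

Lemma mra_lin J a b G H x : integ G -> integ H ->
  proj J (fun x => a * G x + b * H x) x = a * proj J G x + b * proj J H x.
Proof.
move=> iG iH; rewrite /mra /level !mulr_sumr -big_split/=; apply: eq_bigr => k _.
have iGt := integrable_tensor_mul (fun=> mphi) (fun=> hphi) k iG.
have iHt := integrable_tensor_mul (fun=> mphi) (fun=> hphi) k iH.
rewrite !mulrA -mulrDl; congr (_ * _); rewrite /inner -!RintegralZl//.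
rewrite -RintegralD//; last 2 first.
- exact: (@integrable_mulr _ _ _ mu).
- exact: (@integrable_mulr _ _ _ mu).
by apply: eq_Rintegral => y _; rewrite mulrDr !(mulrCA (tensor _ _ _ _)).
Qed.

(** The functions that are recovered from their projections. The class is closed
    under linear combinations and limits in L^1, which reduces the claim for all
    integrable functions to boxes. *)
Definition resolved G := integ G /\ forall e, 0 < e ->
  exists N, forall J, (N <= J)%N -> \int[mu]_x `|proj J G x - G x| <= e.

Let iB J G : integ G -> integ (fun x => proj J G x - G x).
Proof. by move=> iG; apply: (@integrable_subr _ _ _ mu) => //; exact: integ_mra. Qed.

Lemma resolved_lin a b G H : resolved G -> resolved H -> resolved (fun x => a * G x + b * H x).
Proof.
move=> [iG hG] [iH hH]; split.
  by apply: (@integrable_add _ _ _ mu) => //; exact: (@integrable_mulr _ _ _ mu).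
move=> e e0; pose e' := e / (`|a| + `|b| + 1).
have s0 : 0 < `|a| + `|b| + 1 by rewrite ltr_wpDl// addr_ge0.
have e'0 : 0 < e' by rewrite divr_gt0.
have [N1 h1] := hG e' e'0; have [N2 h2] := hH e' e'0.
exists (maxn N1 N2) => J; rewrite geq_max => /andP[/h1 {}h1 /h2 {}h2].
have -> : \int[mu]_x `|proj J (fun x => a * G x + b * H x) x - (a * G x + b * H x)| =
    \int[mu]_x `|a * (proj J G x - G x) + b * (proj J H x - H x)|.
  by apply: eq_Rintegral => x _; rewrite mra_lin//; congr (`|_|); ring.
apply: le_trans (L1_triangle _ _) _; [exact: (@integrable_mulr _ _ _ mu _ _ _ measurableT (iB J iG)) |
  exact: (@integrable_mulr _ _ _ mu _ _ _ measurableT (iB J iH)) |].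
have -> : \int[mu]_x `|a * (proj J G x - G x)| = `|a| * \int[mu]_x `|proj J G x - G x|.
  rewrite -RintegralZl//; last exact: (integrable_norm (iB J iG)).
  by apply: eq_Rintegral => x _; rewrite normrM.
have -> : \int[mu]_x `|b * (proj J H x - H x)| = `|b| * \int[mu]_x `|proj J H x - H x|.
  rewrite -RintegralZl//; last exact: (integrable_norm (iB J iH)).
  by apply: eq_Rintegral => x _; rewrite normrM.
have -> : e = `|a| * e' + `|b| * e' + e' by rewrite /e'; field; rewrite gt_eqF.
by rewrite ler_wpDr ?(ltW e'0)// lerD// ler_wpM2l.
Qed.

(** The projections are bounded on L^1 uniformly in the level, by [level_L1]. *)
Lemma resolved_lim G : integ G ->
  (forall e, 0 < e -> exists2 H, resolved H & \int[mu]_x `|G x - H x| <= e) -> resolved G.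
Proof.
move=> iG hG; split=> // e e0.
pose M := (8 * C * I) ^+ d.
have M0 : 0 <= M.
  rewrite exprn_ge0// !mulr_ge0 ?(tame_ge0 hphi)//.
  by apply: le_trans phiI; exact: Rintegral_ge0.
pose e' := e / (M + 2); have s0 : 0 < M + 2 by rewrite ltr_wpDl.
have e'0 : 0 < e' by rewrite divr_gt0.
have [H [iH hH] GH] := hG e' e'0.
have [N hN] := hH e' e'0; exists N => J /hN {}hN.
have iGH : integ (fun x => G x - H x) by exact: (@integrable_subr _ _ _ mu).
have -> : \int[mu]_x `|proj J G x - G x| =
    \int[mu]_x `|proj J (fun x => G x - H x) x + ((proj J H x - H x) + (-1) * (G x - H x))|.
  apply: eq_Rintegral => x _; congr (`|_|).
  have -> : (fun x => G x - H x) = (fun x => 1 * G x + (-1) * H x).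
    by apply/funext => y; rewrite mul1r mulN1r.
  by rewrite mra_lin//; ring.
have iN : integ (fun x => -1 * (G x - H x)) by exact: (@integrable_mulr _ _ _ mu).
apply: le_trans (L1_triangle (integ_mra _ _) (@integrable_add _ _ _ mu _ _ _ measurableT (iB J iH) iN)) _.
have h1 := le_trans (level_L1 (fun=> mphi) (fun=> hphi) (fun=> phiI) J iGH) (ler_wpM2l M0 GH).
have h2 := L1_triangle (iB J iH) iN.
have h3 : \int[mu]_x `|-1 * (G x - H x)| <= e'.
  by under eq_Rintegral do rewrite mulN1r normrN.
have -> : e = M * e' + (e' + e') by rewrite /e'; field; rewrite gt_eqF.
by apply: lerD => //; apply: le_trans h2 (lerD hN h3).
Qed.

(** On a product the projection acts on each coordinate separately. *)
Lemma resolved_tensor (f : 'I_d -> R -> R) Lf : 0 <= Lf ->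
  (forall i x, f i (x + 1) = f i x) -> (forall i x, `|f i x| <= 1) ->
  (forall i x y, `|f i x - f i y| <= Lf * `|x - y|) ->
  resolved (fun x => \prod_(i < d) f i (x ord0 i)).
Proof.
move=> Lf0 f1 fb fL.
have mf i : measurable_fun setT (f i).
  by apply: continuous_measurable_fun; exact: lipschitz_continuous (fL i).
pose F (x : 'rV[R]_d) := \prod_(i < d) f i (x ord0 i).
have mF : measurable_fun setT F by exact: measurable_tensor.
have iF : integ F.
  by apply: (integrable_bounded (B := 1 ^+ #|'I_d|) mF) => x; exact: prod_bound.
split => //.
have E J x : proj J F x = \prod_(i < d) pproj phi J (f i) (x ord0 i).
  rewrite /pproj bigA_distr_bigA; apply: eq_bigr => k _; rewrite big_split/=; congr (_ * _).
  rewrite /inner -(@Rintegral_tensor _ _ (fun i y => pdil phi J (k i : nat) y * f i y) (8 * C * Num.sqrt 2 ^+ J)).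
  - by apply: eq_Rintegral => y _; rewrite -big_split.
  - by move=> i; apply: measurable_funM => //; exact: measurable_pdil hphi.
  - move=> i y; rewrite normrM -[X in _ <= X]mulr1 ler_pM//; exact: pdil_bound.
pose B := (1 + A * Lf) ^+ #|'I_d| + 1 ^+ #|'I_d|.
have bF J x : `|proj J F x - F x| <= B.
  apply: le_trans (ler_normB _ _) _; rewrite E lerD ?prod_bound// => i.
  rewrite -[X in `|X|](subrK (f i (x ord0 i))) addrC.
  apply: le_trans (ler_normD _ _) _; rewrite lerD//.
  apply: le_trans (approx _ _ _ _ _) _; [exact: Lf0 | exact: f1 | exact: fL|].
  by rewrite ler_piMr ?mulr_ge0// invf_le1 ?exprn_gt0// exprn_ege1// ler1n.
have cE x : `|proj J F x - F x| @[J --> \oo] --> (0 : R).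
  rewrite -[X in _ --> X](normr0 R) -(subrr (F x)); apply: cvg_norm; apply: cvgB; last exact: cvg_cst.
  under eq_fun do rewrite E.
  apply: cvgn_prod => i; apply/cvgrPdist_le => /= e e0.
  have /cvgrPdist_le/(_ e e0) : A * Lf * (2 ^+ J)^-1 @[J --> \oo] --> (0 : R).
    by rewrite -(mulr0 (A * Lf)); apply: cvgMr; exact: cvg_inv2X.
  apply: filterS => J; rewrite sub0r normrN ger0_norm ?mulr_ge0// => hJ.
  by rewrite distrC; apply: le_trans hJ; exact: approx.
have := @dominated_cvg_real _ _ _ mu setT (fun J x => `|proj J F x - F x|) (cst 0) (cst B) measurableT.
rewrite /cst Rintegral_cst1 => /(_ _ _ _ _ _)/cvgrPdist_le h e e0.
have [|||||N _ hN] := h _ _ _ _ _ e e0.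
- move=> J; apply: measurableT_comp => //; exact: integrable_mfun (iB J iF).
- by [].
- by move=> x _; exact: cE.
- exact: finite_measure_integrable_cst.
- by move=> J x _; rewrite normr_id.
exists N => J /hN; rewrite sub0r normrN ger0_norm//; exact: Rintegral_ge0.
Qed.

Lemma resolved_cst0 : resolved (cst 0).
Proof.
have h : resolved (fun x => \prod_(i < d) (cst 1 : R -> R) (x ord0 i)).
  apply: (@resolved_tensor (fun=> cst 1) 0) => // i x; first by rewrite normr1.
  by move=> y; rewrite subrr normr0 mul0r.
have := resolved_lin 0 0 h h; congr resolved; apply/funext => x.
by rewrite !mul0r addr0.
Qed.

Lemma resolved_sum (J : Type) (s : seq J) (G : J -> 'rV[R]_d -> R) :
  (forall j, resolved (G j)) -> resolved (fun x => \sum_(j <- s) G j x).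
Proof.
move=> hG; elim: s => [|j s IHs].
  by have := resolved_cst0; congr resolved; apply/funext => x; rewrite big_nil.
have := resolved_lin 1 1 (hG j) IHs; congr resolved; apply/funext => x.
by rewrite big_cons !mul1r.
Qed.

Lemma resolved_cvg (Gn : nat -> 'rV[R]_d -> R) G B : (forall n, resolved (Gn n)) ->
  measurable_fun setT G -> (forall x, `|G x| <= B) -> (forall n x, `|Gn n x| <= B) ->
  (forall x, Gn n x @[n --> \oo] --> G x) -> resolved G.
Proof.
move=> hGn mG GB GnB cG; have iG : integ G by exact: integrable_bounded mG GB.
apply: resolved_lim => // e e0.
have mGn n : measurable_fun setT (Gn n) by have [+ _] := hGn n => /integrable_mfun.
have := @dominated_cvg_real _ _ _ mu setT (fun n x => `|G x - Gn n x|) (cst 0) (cst (B + B)) measurableT.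
rewrite /cst Rintegral_cst1 => /(_ _ _ _ _ _)/cvgrPdist_le h.
have [|||||N _ hN] := h _ _ _ _ _ e e0.
- by move=> n; apply: measurableT_comp => //; exact: measurable_funB.
- by [].
- move=> x _; rewrite -[X in _ --> X](normr0 R) -(subrr (G x)); apply: cvg_norm.
  by apply: cvgB; [exact: cvg_cst | exact: cG].
- exact: finite_measure_integrable_cst.
- by move=> n x _; rewrite normr_id; apply: le_trans (ler_normB _ _) (lerD _ _).
exists (Gn N) => //; have := hN N (leqnn N); rewrite sub0r normrN ger0_norm//; exact: Rintegral_ge0.
Qed.

Lemma resolved_ae G H : resolved H -> integ G -> \int[mu]_x `|G x - H x| = 0 -> resolved G.
Proof.
by move=> hH iG GH; apply: resolved_lim => // e e0; exists H; rewrite ?GH ?ltW.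
Qed.

(** Away from the null set of points with a coordinate equal to 0, the indicator
    of a box is a product of limits as in [ray_approx]. *)
Lemma resolved_box (a : 'I_d -> \bar R) : resolved (\1_(box a)).
Proof.
have [chi hchi] := choice (fun i => ray_approx (a i)).
have [f hf] := choice hchi.
have mchi i : measurable_fun setT (chi i) by have [[]] := hf i.
have chi1 i t : `|chi i t| <= 1 by have [[]] := hf i.
pose F (x : 'rV[R]_d) := \prod_(i < d) chi i (x ord0 i).
have mF : measurable_fun setT F by exact: measurable_tensor.
have rF : resolved F.
  apply: (@resolved_cvg (fun n x => \prod_(i < d) f i n (x ord0 i)) _ 1) => //.
  - move=> n.
    have ex_lip i : exists Lf, 0 <= Lf /\ forall x y, `|f i n x - f i n y| <= Lf * `|x - y|.
      by have [_ _ /(_ n)[Lf L0 hL] _ _] := hf i; exists Lf.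
    have [Lf hL] := choice ex_lip.
    apply: (@resolved_tensor (fun i => f i n) (\sum_i Lf i)).
    + by apply: sumr_ge0 => i _; have [] := hL i.
    + by move=> i x; have [_ _ _ /(_ n x)[]] := hf i.
    + by move=> i x; have [_ _ _ /(_ n x)[]] := hf i.
    + move=> i x y; have [_ /(_ x y) h] := hL i; apply: le_trans h _; rewrite ler_wpM2r//.
      by rewrite (bigD1 i)//= lerDl sumr_ge0// => j _; have [] := hL j.
  - by move=> x; exact: prod_norm_le1.
  - move=> n x; apply: prod_norm_le1 => i.
    by have [_ _ _ /(_ n (x ord0 i))[]] := hf i.
  - by move=> x; apply: cvgn_prod => i; have [_ _ _ _] := hf i; apply.
have mB : measurable_fun setT (\1_(box a) : 'rV[R]_d -> R).
  by apply: measurable_indic; exact: measurable_box.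
have iB1 : integ (\1_(box a)).
  by apply: (integrable_bounded (B := 1) mB) => x; rewrite normr_nat lern1 leq_b1.
apply: (resolved_ae rF) => //.
pose E : set R := ~` `]0, 1[%classic.
have mE : measurable E by apply: measurableC; exact: measurable_itv.
have m1 : measurable_fun setT (\1_E : R -> R) by exact: measurable_indic.
have E1 t : `|\1_E t : R| <= 1 by rewrite normr_nat lern1 leq_b1.
have E0 : \int[U]_t \1_E t = 0 :> R.
  rewrite Rintegral_uniform// /Rintegral integral_indic//.
  have E01 : E `&` `[0, 1[%classic = [set 0].
    apply/seteqP; split => t /=; rewrite /E /= !in_itv/=.
      move=> [/negP t01 /andP[t0 t1]]; apply/eqP; rewrite eq_le t0 andbT leNgt.
      by move: t01; rewrite t1 andbT.
    by move=> ->; rewrite ltxx lexx ltr01.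
  rewrite E01; transitivity (fine (0%E : \bar R)) => //; congr fine.
  exact: lebesgue_measure_set1.
have iE i : integ (fun x : 'rV[R]_d => \1_E (x ord0 i)).
  have mi : measurable_fun setT (fun x : 'rV[R]_d => \1_E (x ord0 i) : R) by exact: measurable_coord.
  exact: (integrable_bounded mi (fun x => E1 (x ord0 i))).
apply/eqP; rewrite eq_le Rintegral_ge0//= andbT.
apply: (@le_trans _ _ (\int[mu]_x (2 * \sum_(i < d) \1_E (x ord0 i)))); last first.
  rewrite RintegralZl//; last exact: integrable_sumr.
  rewrite Rintegral_sum// big1 ?mulr0// => i _.
  by rewrite (Rintegral_coord i m1 E1).
apply: le_Rintegral => //.
- by apply: (integrable_norm); apply: (@integrable_subr _ _ _ mu) => //; have [] := rF.
- by apply: (@integrable_mulr _ _ _ mu) => //; exact: integrable_sumr.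
move=> x _; have [/existsP[i]|] := boolP [exists i, ~~ (0 < x ord0 i < 1)].
  move=> xi; apply: le_trans (ler_normB _ _) _.
  have -> : 2 = 1 + 1 :> R by [].
  rewrite mulrDl mul1r lerD//; apply: (@le_trans _ _ 1).
  - by rewrite normr_nat lern1 leq_b1.
  - rewrite (bigD1 i)//= indicE mem_set/=; last by rewrite /E/= in_itv/=; exact/negP.
    by rewrite lerDl sumr_ge0// => j _; rewrite ler0n.
  - exact: prod_norm_le1.
  - rewrite (bigD1 i)//= indicE mem_set/=; last by rewrite /E/= in_itv/=; exact/negP.
    by rewrite lerDl sumr_ge0// => j _; rewrite ler0n.
move=> /existsPn hx.
have -> : F x = \1_(box a) x.
  rewrite /F indicE.
  have cE i : chi i (x ord0 i) = ((x ord0 i)%:E < a i)%E%:R.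
    by have [_ h _ _ _] := hf i; apply: h; have := hx i; rewrite negbK.
  under eq_bigr do rewrite cE.
  have [xb|xb] := pselect (box a x).
    by rewrite mem_set// big1// => i _; rewrite xb.
  rewrite memNset//.
  have [i xi] : exists i, ~~ ((x ord0 i)%:E < a i)%E.
    apply/existsP; rewrite -negb_forall; apply/negP => /forallP h; apply: xb => i; exact: h.
  by rewrite (bigD1 i)//= (negbTE xi) mul0r.
by rewrite subrr normr0 mulr_ge0// sumr_ge0// => i _; rewrite ler0n.
Qed.

(** The boxes are stable under intersection, and the sets with a resolved
    indicator form a Dynkin system. *)
Lemma resolved_measurable (S : set 'rV[R]_d) : measurable S -> resolved (\1_S).
Proof.
move=> mS.
have h1 : resolved (\1_setT).
  have := resolved_box (fun=> +oo%E); congr resolved; congr (\1_ _).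
  by apply/seteqP; split => x //= _ i; rewrite ltry.
move: (mS); rewrite measurable_boxes; apply: (@dynkin_induction _ _ (range (@box R d)) (fun S => resolved (\1_S))).
- exact: measurable_boxes.
- exact: setI_closed_boxes.
- exact: h1.
- by move=> _ [a _ <-]; exact: resolved_box.
- move=> A' _ hA; have := resolved_lin 1 (-1) h1 hA; congr resolved.
  apply/funext => x; rewrite !indicE in_setT in_setC mul1r mulN1r.
  by case: (_ \in _); rewrite /= ?subrr ?subr0.
move=> F mF tF hF.
have sumF n x k : F k x -> \sum_(j < n) \1_(F j) x = (k < n)%N%:R :> R.
  move=> Fk; have nF j : j <> k -> \1_(F j) x = 0 :> R.
    move=> jk; rewrite indicE memNset// => Fj; apply: jk.
    by apply: tF => //; exists x.
  have [kn|kn] := ltnP k n; last first.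
    by rewrite big1// => j _; apply: nF => jk; have := ltn_ord j; rewrite jk ltnNge kn.
  rewrite (bigD1 (Ordinal kn))//= indicE mem_set// big1 ?addr0// => j jk.
  by apply: nF => /= jE; move/eqP: jk; apply; exact: val_inj.
have sumN n x : ~ (\bigcup_k F k) x -> \sum_(j < n) \1_(F j) x = 0 :> R.
  by move=> nF; rewrite big1// => j _; rewrite indicE memNset// => Fj; apply: nF; exists j.
apply: (@resolved_cvg (fun n x => \sum_(k < n) \1_(F k) x) _ 1).
- by move=> n; apply: resolved_sum => k; exact: hF.
- by apply: measurable_indic; exact: bigcup_measurable.
- by move=> x; rewrite normr_nat lern1 leq_b1.
- move=> n x; have [[k _ Fk]|nF] := pselect ((\bigcup_k F k) x).
    by rewrite (sumF n x k)// normr_nat lern1 leq_b1.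
  by rewrite sumN// normr0.
- move=> x; have [[k _ Fk]|nF] := pselect ((\bigcup_k F k) x).
    rewrite indicE mem_set; last by exists k.
    apply: cvg_near_cst; exists k.+1 => //= n kn.
    by rewrite (sumF n x k)// kn.
  under eq_fun do rewrite sumN//.
  by rewrite indicE memNset//; exact: cvg_cst.
Qed.

Import HBSimple.

(** The simple functions are dense in L^1. *)
Lemma resolved_integrable G : integ G -> resolved G.
Proof.
move=> iG; apply: resolved_lim => // e e0.
have [g [ig _ cg]] := approximation_sfun_integrable measurableT iG.
have /fine_cvgP[_ /cvgrPdist_le/(_ e e0)[n _ hn]] := cg.
pose s := HBSimple.SimpleFun.sort (g n).
exists s.
  pose r := fset_set (range s).
  have hs (i : 'I_(#|` r|)) : resolved (fun x => r`_i * \1_(s @^-1` [set r`_i]) x).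
    have hA : resolved (\1_(s @^-1` [set r`_i])).
      apply: resolved_measurable; rewrite -[X in measurable X]setTI.
      by apply: (integrable_mfun (ig n)) => //; exact: measurable_set1.
    have := resolved_lin (r`_i) 0 hA hA; congr resolved; apply/funext => x.
    by rewrite mul0r addr0.
  have := resolved_sum (index_enum 'I_(#|` r|)) hs.
  by congr resolved; apply/funext => x; exact/esym/(fimfunEord (g n)).
by have := hn n (leqnn n); rewrite sub0r normrN; apply: le_trans; exact: ler_norm.
Qed.

End density.

(** * Approximation by wavelet projections *)

Section approximation.
Context {R : realType} (d : nat).
Local Notation leb := (@lebesgue_measure R).
Local Notation mu := (torus_measure d : probability _ R).

(** Summing the geometric series of the differences of consecutive levels. *)
Lemma mra_tail (phi : R -> R) C K B (G : 'rV[R]_d -> R) J :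
  measurable_fun setT phi -> tame C phi -> 0 <= K * B -> resolved phi G ->
  (forall j, \int[mu]_x `|mra phi j.+1 G x - mra phi j G x| <= (2 ^+ j)^-1 * K * B) ->
  \int[mu]_x `|G x - mra phi J G x| <= 2 * K * (2 ^+ J)^-1 * B.
Proof.
move=> mphi hphi KB [iG hG] hd.
have iM j := integ_mra (d := d) mphi hphi j G.
have iB i j : mu.-integrable setT (EFin \o (fun x => mra phi i G x - mra phi j G x)).
  exact: (@integrable_subr _ _ _ mu).
have step n : \int[mu]_x `|mra phi (J + n) G x - mra phi J G x| <=
    2 * K * B * ((2 ^+ J)^-1 - (2 ^+ (J + n))^-1).
  elim: n => [|n IHn].
    rewrite addn0 subrr mulr0; under eq_Rintegral do rewrite subrr normr0.
    by rewrite Rintegral_cst1.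
  have -> : \int[mu]_x `|mra phi (J + n.+1) G x - mra phi J G x| =
      \int[mu]_x `|(mra phi (J + n).+1 G x - mra phi (J + n) G x) + (mra phi (J + n) G x - mra phi J G x)|.
    by rewrite addnS; apply: eq_Rintegral => x _; rewrite addrA subrK.
  apply: le_trans (L1_triangle (iB _ _) (iB _ _)) _.
  apply: le_trans (lerD (hd _) IHn) _; rewrite addnS exprS invfM; apply: eq_ler.
  by field; rewrite !expf_neq0.
apply/ler_addgt0Pr => e e0; have [N hN] := hG e e0.
have {}hN := hN (J + N)%N (leq_addl _ _).
have -> : \int[mu]_x `|G x - mra phi J G x| =
    \int[mu]_x `|(mra phi (J + N) G x - mra phi J G x) + (G x - mra phi (J + N) G x)|.
  by apply: eq_Rintegral => x _; congr (`|_|); ring.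
have iGM : mu.-integrable setT (EFin \o (fun x => G x - mra phi (J + N) G x)).
  exact: (@integrable_subr _ _ _ mu).
apply: le_trans (L1_triangle (iB _ _) iGM) _; apply: lerD; last first.
  by under eq_Rintegral do rewrite distrC.
apply: le_trans (step N) _.
have -> : 2 * K * (2 ^+ J)^-1 * B = 2 * K * B * (2 ^+ J)^-1 by ring.
have KB2 : 0 <= 2 * K * B by rewrite -mulrA mulr_ge0.
rewrite ler_wpM2l//.
by rewrite lerBlDr lerDl invr_ge0 exprn_ge0.
Qed.

Let derive1n_is_derive S (f : R -> R) m : smooth_decay S f -> (m < S)%N ->
  forall x : R, is_derive x 1 (derive1n m f) (derive1n m.+1 f x).
Proof.
move=> [df _ _] mS x; apply: DeriveDef; first exact: df.
by rewrite derive1nS derive1E.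
Qed.

(** All that is needed of the wavelet basis below. T is the projection of G to
    level J: its size is governed by the coefficients of G, its distance from G
    by the total variation. *)
Lemma wavelet_approximation (S : nat) (phi psi : R -> R) : (0 < d)%N -> (1 < S)%N ->
  regular_wavelet S phi psi -> exists A K : R, [/\ 0 < A, 0 < K &
  forall (G : 'rV[R]_d -> R) (B delta : R) J, mu.-integrable setT (EFin \o G) ->
    0 <= B -> tested_variation G B -> (besov_norm phi psi G <= delta%:E)%E ->
  exists T : 'rV[R]_d -> R, [/\ mu.-integrable setT (EFin \o T),
    forall x, `|T x| <= A * delta * (Num.sqrt 2 ^+ d) ^+ J &
    \int[mu]_x `|G x - T x| <= K * (2 ^+ J)^-1 * B]].
Proof.
move=> d0 S1 [sphi spsi moments basis].
have S0 : (0 < S)%N by exact: ltnW.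
have [_ cphi rphi] := sphi; have [_ cpsi rpsi] := spsi.
have dphi : forall x : R, is_derive x 1 phi (derive1n 1 phi x) := derive1n_is_derive sphi S0.
have dphi' : forall x : R, is_derive x 1 (derive1n 1 phi) (derive1n 2 phi x) := derive1n_is_derive sphi S1.
have dpsi : forall x : R, is_derive x 1 psi (derive1n 1 psi x) := derive1n_is_derive spsi S0.
have dpsi' : forall x : R, is_derive x 1 (derive1n 1 psi) (derive1n 2 psi x) := derive1n_is_derive spsi S1.
have mphi := continuous_measurable_fun (is_derive_continuous dphi).
have mpsi := continuous_measurable_fun (is_derive_continuous dpsi).
have [C1 [C10 h1]] := rapidly_decayX 3 (rphi 0%N isT).
have [C2 [C20 h2]] := rapidly_decayX 3 (rpsi 0%N isT).
have [C3 h3] := rapidly_tame (rphi 1%N S0); have [C4 h4] := rapidly_tame (rpsi 1%N S0).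
have [C5 h5] := rapidly_tame (rphi 2%N S1); have [C6 h6] := rapidly_tame (rpsi 2%N S1).
have psi0 : \int[leb]_x psi x = 0.
  by rewrite -(moments 0%N S0); apply: eq_Rintegral => x _; rewrite mul1r.
have [chi [dchi [C7 h7]]] := tame_antiderivative C20 (is_derive_continuous dpsi) h2 psi0.
have C30 := tame_ge0 h3; have C40 := tame_ge0 h4; have C50 := tame_ge0 h5.
have C60 := tame_ge0 h6; have C70 := tame_ge0 h7.
pose C := C1 + C2 + C3 + C4 + C5 + C6 + C7.
have C0 : 0 <= C by rewrite !addr_ge0.
have le1 : C1 <= C by rewrite /C; lra. have le2 : C2 <= C by rewrite /C; lra.
have le3 : C3 <= C by rewrite /C; lra. have le4 : C4 <= C by rewrite /C; lra.
have le5 : C5 <= C by rewrite /C; lra. have le6 : C6 <= C by rewrite /C; lra.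
have le7 : C7 <= C by rewrite /C; lra.
have d30 (x : R) : 0 <= decay x ^+ 3 by rewrite exprn_ge0 ?decay_ge0.
have {}h1 x : `|phi x| <= C * decay x ^+ 3 by apply: le_trans (h1 x) _; rewrite ler_wpM2r.
have {}h2 x : `|psi x| <= C * decay x ^+ 3 by apply: le_trans (h2 x) _; rewrite ler_wpM2r.
have {}h3 := tame_le le3 h3; have {}h4 := tame_le le4 h4; have {}h5 := tame_le le5 h5.
have {}h6 := tame_le le6 h6; have {}h7 := tame_le le7 h7.
have tphi : tame C phi by move=> x; apply: le_trans (h1 x) _; rewrite ler_wpM2l// decayX_le.
have tpsi : tame C psi by move=> x; apply: le_trans (h2 x) _; rewrite ler_wpM2l// decayX_le.
pose I := \int[leb]_x `|phi x| + \int[leb]_x `|psi x|.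
have phiI : \int[leb]_x `|phi x| <= I by rewrite lerDl; exact: Rintegral_ge0.
have psiI : \int[leb]_x `|psi x| <= I by rewrite lerDr; exact: Rintegral_ge0.
have kS := pkernelS basis dphi dpsi h3 C0 h1 h2.
have [A [A0 approx]] := pproj_approx basis dphi dpsi h3 C0 h1 h2 psi0.
have K0 : 0 <= BV_const d C I by apply: BV_const_ge0 phiI.
exists (4 * 2 ^+ d * (8 * C) ^+ d + 1), (2 * BV_const d C I + 1); split.
- by rewrite ltr_wpDl// mulr_ge0 ?mulr_ge0 ?exprn_ge0// mulr_ge0.
- by rewrite ltr_wpDl// mulr_ge0.
move=> G B delta J iG B0 GB Gdelta; exists (mra phi J G); split.
- exact: integ_mra mphi tphi J G.
- move=> x.
  have coef j k (e : {ffun 'I_d -> bool}) : (j == 0)%N || [exists i, e i] ->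
      `|inner mu (@wavelet R d phi psi j k e) G| <= delta.
    move=> je; rewrite -lee_fin; apply: le_trans Gdelta; apply: ereal_sup_ubound.
    by exists j, k, e.
  have delta0 : 0 <= delta.
    have := @coef 0%N [ffun=> Ordinal (isT : (0 < 2 ^ 0)%N)] [ffun=> false] isT.
    exact: le_trans (normr_ge0 _).
  apply: le_trans (mra_sup_bound mphi mpsi tphi tpsi kS J x d0 iG coef) _.
  rewrite (exprMn _ (8 * C)) mulrA -exprM mulnC exprM ler_wpM2r ?exprn_ge0 ?sqrtr_ge0//.
  by rewrite -mulrA [delta * _]mulrC mulrA ler_wpM2r// lerDl.
- have rG := resolved_integrable mphi tphi phiI A0 approx iG.
  apply: le_trans (@mra_tail phi C (BV_const d C I) B G J mphi tphi _ rG _) _.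
  + exact: mulr_ge0.
  + by move=> j; exact: (mra_diff_L1 tphi tpsi h7 h3 h4 h5 h6 dphi dpsi dchi dphi' dpsi' phiI psiI kS j iG GB).
  by rewrite !ler_wpM2r ?invr_ge0 ?exprn_ge0// lerDl.
Qed.

End approximation.

(** * From exceedance bounds to L^q rates *)

Section interpolation.
Context {R : realType} d (T : measurableType d) (P : probability T R).
Implicit Types (G : T -> R).

(** Splitting the range ]0, v rho^N] into geometric layers. *)
Lemma powR_layers (p v rho t : R) N : 0 <= p -> 0 < v -> 1 <= rho -> 0 <= t -> t <= v * rho ^+ N ->
  t `^ p <= v `^ p + \sum_(j < N) (v * rho ^+ j.+1) `^ p * (v * rho ^+ j < t)%R%:R.
Proof.
move=> p0 v0 rho1 t0; have mono a b : 0 <= a -> a <= b -> a `^ p <= b `^ p.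
  by move=> a0 ab; rewrite ge0_ler_powR ?nnegrE//; exact: le_trans ab.
have s0 n : 0 <= \sum_(j < n) (v * rho ^+ j.+1) `^ p * (v * rho ^+ j < t)%R%:R.
  by apply: sumr_ge0 => j _; rewrite mulr_ge0 ?powR_ge0.
elim: N => [|N IHN] tN; first by rewrite big_ord0 addr0 mono//; rewrite expr0 mulr1 in tN.
rewrite big_ord_recr/=; have [tle|tgt] := leP t (v * rho ^+ N).
  by rewrite mulr0 addr0 IHN.
rewrite mulr1; apply: le_trans (mono _ _ t0 tN) _.
by rewrite addrA lerDr; exact: addr_ge0 (powR_ge0 _ _) (s0 N).
Qed.

Let mnormR G (p : R) : measurable_fun setT G -> measurable_fun setT (fun x => `|G x| `^ p).
Proof.
move=> mG; apply: (@measurableT_comp _ _ _ _ _ _ (fun t : R => t `^ p)); first exact: measurable_powR.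
exact: measurableT_comp.
Qed.

Let inormR G U p : measurable_fun setT G -> (forall x, `|G x| <= U) -> 0 <= p ->
  P.-integrable setT (EFin \o (fun x => `|G x| `^ p)).
Proof.
move=> mG GU p0; apply: (@integrable_bounded _ _ _ P _ (U `^ p)); first exact: mnormR.
move=> x; rewrite ger0_norm ?powR_ge0// ge0_ler_powR ?nnegrE//.
exact: le_trans (GU x).
Qed.

(** |G|^s <= U^(s - p) |G|^p, and each of the N layers of [powR_layers]
    contributes at most D to the moment of order p. *)
Lemma interpolation G (U v rho p s D : R) N : measurable_fun setT G ->
  (forall x, `|G x| <= U) -> 0 < p -> p <= s -> 0 < v -> 1 <= rho -> U <= v * rho ^+ N ->
  (forall j, (v * rho ^+ j.+1) `^ p * \int[P]_x (v * rho ^+ j < `|G x|)%R%:R <= D) ->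
  \int[P]_x `|G x| `^ s <= U `^ (s - p) * (v `^ p + N%:R * D).
Proof.
move=> mG GU p0 ps v0 rho1 UN hD.
have s0 : 0 < s by exact: lt_le_trans ps.
have it j : P.-integrable setT (EFin \o (fun x => (v * rho ^+ j < `|G x|)%R%:R : R)).
  apply: (@integrable_bounded _ _ _ P _ 1).
    rewrite (_ : (fun x => _) = (fun x => if v * rho ^+ j < `|G x| then 1 else 0)).
      by apply: measurable_fun_ifT => //; apply: measurable_fun_ltr => //; exact: measurableT_comp.
    by apply/funext => x; case: ifP.
  by move=> x; rewrite normr_nat lern1 leq_b1.
have ipt j : P.-integrable setT (EFin \o (fun x => (v * rho ^+ j.+1) `^ p * (v * rho ^+ j < `|G x|)%R%:R)).
  exact: (@integrable_mulr _ _ _ P).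
have isum : P.-integrable setT (EFin \o (fun x => \sum_(j < N) (v * rho ^+ j.+1) `^ p * (v * rho ^+ j < `|G x|)%R%:R)).
  by apply: (@integrable_sumr _ _ _ P).
have icst : P.-integrable setT (EFin \o (fun=> v `^ p : R)) by exact: finite_measure_integrable_cst.
apply: (@le_trans _ _ (\int[P]_x (U `^ (s - p) * (v `^ p + \sum_(j < N) (v * rho ^+ j.+1) `^ p *
    (v * rho ^+ j < `|G x|)%R%:R)))).
  apply: le_Rintegral => //.
  - exact: inormR mG GU (ltW s0).
  - by apply: (@integrable_mulr _ _ _ P) => //; exact: (@integrable_add _ _ _ P).
  - move=> x _; have -> : `|G x| `^ s = `|G x| `^ (s - p) * `|G x| `^ p.
      by rewrite -powRD ?subrK// gt_eqF.
    apply: ler_pM; rewrite ?powR_ge0//.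
      by rewrite ge0_ler_powR ?nnegrE ?subr_ge0//; exact: le_trans (GU x).
    by apply: powR_layers => //; [exact: ltW | exact: le_trans UN].
rewrite RintegralZl//; last exact: (@integrable_add _ _ _ P).
rewrite ler_wpM2l ?powR_ge0// RintegralD// Rintegral_cst1 lerD2l.
rewrite (@Rintegral_sum _ _ _ P)//.
apply: (@le_trans _ _ (\sum_(j < N) D)); last by rewrite sumr_const card_ord mulr_natl.
by apply: ler_sum => j _; rewrite RintegralZl.
Qed.

(** Pointwise |G|^q <= X^q + X^(q - s) |G|^s, comparing |G| with X. *)
Lemma Lnorm_le_power G (U q s X : R) : measurable_fun setT G -> (forall x, `|G x| <= U) ->
  1 <= q -> q <= s -> 0 < X -> \int[P]_x `|G x| `^ s <= X `^ s ->
  ('N[P]_(q%:E)%E [EFin \o G] <= (2 * X)%:E)%E.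
Proof.
move=> mG GU q1 qs X0 hX.
have q0 : 0 < q by exact: lt_le_trans q1.
have iq : P.-integrable setT (EFin \o (fun x => `|G x| `^ q)) by exact: inormR mG GU (ltW q0).
have is_ : P.-integrable setT (EFin \o (fun x => `|G x| `^ s)).
  by apply: inormR mG GU _; exact: le_trans (ltW q0) qs.
have hq : \int[P]_x `|G x| `^ q <= (2 * X) `^ q.
  apply: (@le_trans _ _ (\int[P]_x (X `^ q + X `^ (q - s) * `|G x| `^ s))).
    apply: le_Rintegral => //.
      apply: (@integrable_add _ _ _ P) => //; first exact: finite_measure_integrable_cst.
      exact: (@integrable_mulr _ _ _ P).
    move=> x _; have [le|lt] := leP `|G x| X.
      apply: (@le_trans _ _ (X `^ q)); last by rewrite lerDl mulr_ge0 ?powR_ge0.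
      by rewrite ge0_ler_powR ?nnegrE// ltW.
    have G0 : 0 < `|G x| by exact: lt_trans lt.
    have -> : `|G x| `^ q = `|G x| `^ (q - s) * `|G x| `^ s.
      by rewrite -powRD ?subrK// (gt_eqF G0) implybT.
    apply: (@le_trans _ _ (X `^ (q - s) * `|G x| `^ s)); last by rewrite lerDr powR_ge0.
    rewrite ler_wpM2r ?powR_ge0// -opprB !powRN lef_pV2 ?posrE ?powR_gt0//.
    by rewrite ge0_ler_powR ?nnegrE ?subr_ge0// ltW.
  rewrite RintegralD//; last 2 first.
  - exact: finite_measure_integrable_cst.
  - exact: (@integrable_mulr _ _ _ P).
  rewrite Rintegral_cst1 RintegralZl//.
  apply: (@le_trans _ _ (X `^ q + X `^ (q - s) * X `^ s)).
    by rewrite lerD2l ler_wpM2l ?powR_ge0.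
  rewrite -powRD ?subrK; last by rewrite (gt_eqF X0) implybT.
  rewrite powRM ?(ltW X0)//; apply: (@le_trans _ _ (2 * X `^ q)); first by rewrite mulr2n mulrDl mul1r.
  by rewrite ler_wpM2r ?powR_ge0//; apply: le1r_powR => //; rewrite ler1n.
rewrite unlock.
have -> : (\int[P]_x (`|(EFin \o G) x| `^ q)%E = (\int[P]_x `|G x| `^ q)%:E)%E.
  rewrite /Rintegral fineK; last exact: integrable_fin_num.
  exact: eq_integral.
rewrite poweR_EFin lee_fin.
apply: (@le_trans _ _ (((2 * X) `^ q) `^ q^-1)).
  by rewrite ge0_ler_powR ?nnegrE ?invr_ge0 ?(ltW q0)// ?powR_ge0// Rintegral_ge0// => x _; exact: powR_ge0.
by rewrite -powRrM mulfV ?gt_eqF// powRr1// mulr_ge0// ltW.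
Qed.

End interpolation.

Section rate.
Context {R : realType}.
Implicit Types (d n : nat) (q a c : R).

Lemma ln_nat_gt0 n : (2 <= n)%N -> 0 < ln n%:R :> R.
Proof. by move=> n2; rewrite ln_gt0// ltr1n. Qed.

Lemma ln2_le_ln n : (2 <= n)%N -> ln 2 <= ln n%:R :> R.
Proof. by move=> n2; rewrite ler_ln ?posrE ?ltr0n ?ler_nat//; exact: leq_trans n2. Qed.

(** The number of dyadic levels needed to reach n is of order ln n. *)
Lemma trunc_log_le_ln n : (2 <= n)%N -> (trunc_log 2 n).+1%:R <= 2 / ln 2 * ln n%:R :> R.
Proof.
move=> n2; have l2 : 0 < ln 2 :> R by exact: (ln_nat_gt0 (leqnn 2)).
have n0 : (0 < n)%N by exact: leq_trans n2.
have h1 : (trunc_log 2 n)%:R * ln 2 <= ln n%:R :> R.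
  rewrite mulr_natl -lnXn// -natrX ler_ln ?posrE ?ltr0n ?expn_gt0// ler_nat.
  exact: trunc_logP.
have h2 := ln2_le_ln n2.
by rewrite mulrAC ler_pdivlMr// -natr1 mulrDl mul1r; lra.
Qed.

(** The two regimes of the rate correspond to q below and above the critical
    order 1 + 2 / d. *)
Lemma rate_exponent d q : (0 < d)%N -> 1 <= q ->
  Num.min (d.+2%:R^-1) ((d%:R * q)^-1) = (d%:R * Num.max q (1 + 2 / d%:R))^-1.
Proof.
move=> d0 q1; have dr : 0 < d%:R :> R by rewrite ltr0n.
have q0 : 0 < q by exact: lt_le_trans q1.
have dE : d.+2%:R = d%:R * (1 + 2 / d%:R) :> R.
  by rewrite mulrDr mulr1 mulrCA mulfV ?gt_eqF// mulr1 -natr1 -natr1; ring.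
have p0 : 0 < 1 + 2 / d%:R :> R by rewrite ltr_pwDl// divr_ge0// ltW.
rewrite dE; have [qp|pq] := leP q (1 + 2 / d%:R).
  by rewrite min_l// lef_pV2 ?posrE ?mulr_gt0// ler_pM2l.
by rewrite min_r// lef_pV2 ?posrE ?mulr_gt0// ler_pM2l// ltW.
Qed.

Lemma ln_le_power d n : (0 < d)%N -> (2 <= n)%N ->
  ln n%:R <= (1 + (ln 2)^-1) * ln n%:R ^+ (3 - minn d 2) :> R.
Proof.
move=> d0 n2; have l2 : 0 < ln 2 :> R by exact: (ln_nat_gt0 (leqnn 2)).
have l0 : 0 < ln n%:R :> R by exact: ln_nat_gt0.
have [d1|d2] := leqP d 1.
  have -> : d = 1%N by apply/eqP; rewrite eqn_leq d1 d0.
  rewrite mulrDl mul1r (_ : (3 - minn 1 2)%N = 2%N)//.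
  apply: (@le_trans _ _ ((ln 2)^-1 * ln n%:R ^+ 2)); last by rewrite lerDr exprn_ge0// ltW.
  by rewrite expr2 mulrA ler_pMl// ler_pdivlMl// mulr1 ln2_le_ln.
rewrite (minn_idPr d2) (_ : (3 - 2)%N = 1%N)// expr1 mulrDl mul1r lerDl.
by rewrite mulr_ge0 ?invr_ge0 ?ltW.
Qed.

(** For thresholds of size ln n / sqrt n every layer contributes the same
    amount to the critical moment of order 1 + 2 / d, and there are only of
    order ln n layers. *)
Lemma Lq_rate d q a c : (0 < d)%N -> 1 <= q -> 2 <= a -> 0 <= c -> exists K : R, 0 < K /\
  forall n (e : measure_display) (T : measurableType e) (P : probability T R) (G : T -> R),
  (2 <= n)%N -> measurable_fun setT G -> (forall x, `|G x| <= 2 * ln n%:R) ->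
  (forall j, let u := a * (ln n%:R / Num.sqrt n%:R) * (Num.sqrt 2 ^+ d) ^+ j in
     \int[P]_x (u < `|G x|)%R%:R <= c * (2 ^+ j)^-1 / u) ->
  ('N[P]_(q%:E)%E [EFin \o G] <= (K * convergence_rate d q n)%:E)%E.
Proof.
move=> d0 q1 a2 c0; pose p : R := 1 + 2 / d%:R; pose s := Num.max q p.
have dr : 0 < d%:R :> R by rewrite ltr0n.
have p0 : 0 < p by rewrite ltr_pwDl// divr_ge0// ltW.
have ps : p <= s by rewrite /s le_max lexx orbT.
have qs : q <= s by rewrite /s le_max lexx.
have s1 : 1 <= s by exact: le_trans qs.
have s0 : 0 < s by exact: lt_le_trans s1.
have a0 : 0 < a by exact: lt_le_trans a2.
pose rho : R := Num.sqrt 2 ^+ d.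
have rt2 : 1 <= Num.sqrt 2 :> R by rewrite -[X in X <= _]sqrtr1 ler_wsqrtr// ler1n.
have rho1 : 1 <= rho by rewrite exprn_ege1.
have l2 : 0 < ln 2 :> R by exact: (ln_nat_gt0 (leqnn 2)).
pose K1 : R := 2 `^ (s - p) * (a `^ p + 2 / ln 2 * (c * rho `^ p * a `^ (2 / d%:R))).
have K10 : 0 <= K1.
  rewrite mulr_ge0 ?powR_ge0// addr_ge0 ?powR_ge0// !mulr_ge0 ?powR_ge0 ?invr_ge0//; exact: ltW.
exists (2 * (K1 + 1) * (1 + (ln 2)^-1)); split.
  by rewrite !mulr_gt0 ?ltr_wpDl// invr_gt0.
move=> n e T P G n2 mG GU hG.
pose l : R := ln n%:R; have l0 : 0 < l by exact: ln_nat_gt0.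
have n0 : 0 < n%:R :> R by rewrite ltr0n; exact: leq_trans n2.
have n1 : 1 <= n%:R :> R by rewrite ler1n; exact: leq_trans n2.
have sn0 : 0 < Num.sqrt n%:R :> R by rewrite sqrtr_gt0.
pose v : R := a * (l / Num.sqrt n%:R).
have v0 : 0 < v by rewrite !mulr_gt0// invr_gt0.
pose N := (trunc_log 2 n).+1.
(* as sqrt 2 <= rho and n < 2 ^ N, the last threshold exceeds the sup bound *)
have NU : 2 * ln n%:R <= v * rho ^+ N.
  apply: (@le_trans _ _ (v * Num.sqrt n%:R)).
    by rewrite /v -!mulrA mulVf ?gt_eqF// mulr1 ler_wpM2r// ltW.
  rewrite ler_wpM2l ?(ltW v0)//; apply: (@le_trans _ _ (Num.sqrt 2 ^+ N)); last first.
    by rewrite lerXn2r ?nnegrE ?sqrtr_ge0 ?exprn_ge0 ?sqrtr_ge0// ler_eXnr.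
  rewrite -(ger0_norm (exprn_ge0 N (sqrtr_ge0 2))) -sqrtr_sqr ler_wsqrtr// -exprM mulnC exprM.
  by rewrite sqr_sqrtr// -natrX ler_nat ltnW// trunc_log_ltn.
pose D : R := c * rho `^ p * v `^ (2 / d%:R).
have D0 : 0 <= D by rewrite !mulr_ge0 ?powR_ge0.
have rj0 j : 0 < rho ^+ j by rewrite exprn_gt0//; exact: lt_le_trans rho1.
(* (v rho^j)^(p - 1) is proportional to 2^j for p = 1 + 2 / d, which cancels the
   decay of the exceedance bound *)
have layer j : (v * rho ^+ j.+1) `^ p * \int[P]_x (v * rho ^+ j < `|G x|)%R%:R <= D.
  apply: le_trans (ler_wpM2l (powR_ge0 _ _) (hG j)) _.
  rewrite -/l -/v -/rho exprSr mulrA powRM; last 2 first.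
  - by rewrite mulr_ge0 ?(ltW v0)// ltW.
  - exact: le_trans rho1.
  have u0 : 0 < v * rho ^+ j by rewrite mulr_gt0.
  rewrite -(mulr_powRB1 (ltW u0) p0) {2}/p addrAC subrr add0r.
  have -> : (v * rho ^+ j) `^ (2 / d%:R) = v `^ (2 / d%:R) * 2 ^+ j.
    rewrite powRM ?(ltW v0) ?(ltW (rj0 j))//; congr (_ * _).
    rewrite /rho -!powR_mulrn ?exprn_ge0 ?sqrtr_ge0// -powR12_sqrt// -!powRrM; congr (_ `^ _).
    by field; rewrite gt_eqF.
  apply: eq_ler; rewrite /D; field.
  by rewrite (gt_eqF (rj0 j)) (gt_eqF v0) expf_neq0.
have hI := interpolation mG GU p0 ps v0 rho1 NU layer.
have vl : v <= a * l.
  rewrite /v mulrA ler_pdivrMr// ler_peMr ?mulr_ge0 ?(ltW a0) ?(ltW l0)//.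
  by rewrite -[X in X <= _]sqrtr1 ler_wsqrtr.
pose m := n%:R `^ (- d%:R^-1) : R; have m0 : 0 <= m by exact: powR_ge0.
have vd : v `^ (2 / d%:R) = a `^ (2 / d%:R) * l `^ (2 / d%:R) * m.
  rewrite /v mulrA powRM ?mulr_ge0 ?invr_ge0 ?(ltW a0) ?(ltW l0) ?(ltW sn0)//.
  rewrite powRM ?(ltW a0) ?(ltW l0)//; congr (_ * _).
  rewrite -powR12_sqrt ?(ltW n0)// -powRN -powRrM; congr (_ `^ _).
  by field; rewrite gt_eqF.
have p1E : 2 / d%:R = p - 1 :> R by rewrite /p addrAC subrr add0r.
have vp : v `^ p <= a `^ p * (l `^ p * m).
  rewrite -(mulr_powRB1 (ltW v0) p0) -p1E vd.
  rewrite -(mulr_powRB1 (ltW a0) p0) -(mulr_powRB1 (ltW l0) p0) -p1E.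
  apply: (@le_trans _ _ (a * l * (a `^ (2 / d%:R) * l `^ (2 / d%:R) * m))).
    by rewrite ler_wpM2r// !mulr_ge0 ?powR_ge0.
  by apply: eq_ler; ring.
have ND : N%:R * D <= 2 / ln 2 * (c * rho `^ p * a `^ (2 / d%:R)) * (l `^ p * m).
  apply: le_trans (ler_wpM2r D0 (trunc_log_le_ln n2)) _.
  rewrite /D vd -(mulr_powRB1 (ltW l0) p0) -p1E -/l.
  by apply: eq_ler; ring.
have hK1 : \int[P]_x `|G x| `^ s <= K1 * (l `^ s * m).
  apply: le_trans hI _; apply: le_trans (ler_wpM2l (powR_ge0 _ _) (lerD vp ND)) _.
  rewrite powRM ?(ltW l0)// -/l (_ : l `^ s = l `^ (s - p) * l `^ p); last first.
    by rewrite -powRD ?subrK// (gt_eqF l0) implybT.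
  by apply: eq_ler; rewrite /K1; ring.
pose X := (K1 + 1) * l * n%:R `^ (- (d%:R * s)^-1).
have nX : 0 < n%:R `^ (- (d%:R * s)^-1) :> R by exact: powR_gt0.
have K1p : 0 < K1 + 1 by rewrite ltr_wpDl.
have X0 : 0 < X by rewrite !mulr_gt0.
have hX : \int[P]_x `|G x| `^ s <= X `^ s.
  apply: le_trans hK1 _.
  rewrite /X powRM ?mulr_ge0 ?(ltW K1p) ?(ltW l0) ?(ltW nX)//.
  rewrite powRM ?(ltW K1p) ?(ltW l0)// -powRrM mulNr invfM mulfVK ?gt_eqF//.
  rewrite -/m -mulrA ler_wpM2r ?mulr_ge0 ?powR_ge0//.
  by apply: le_trans (le1r_powR _ s1); rewrite ?lerDl// lerDr.
apply: le_trans (Lnorm_le_power mG GU q1 qs X0 hX) _.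
rewrite lee_fin /convergence_rate rate_exponent// -/p -/s /X.
have le_l : l <= (1 + (ln 2)^-1) * l ^+ (3 - minn d 2) by exact: ln_le_power.
apply: (@le_trans _ _ (2 * (K1 + 1) * n%:R `^ (- (d%:R * s)^-1) * l)).
  by apply: eq_ler; ring.
apply: (@le_trans _ _ (2 * (K1 + 1) * n%:R `^ (- (d%:R * s)^-1) * ((1 + (ln 2)^-1) * l ^+ (3 - minn d 2)))).
  by rewrite ler_wpM2l// !mulr_ge0 ?(ltW K1p) ?(ltW nX).
by apply: eq_ler; ring.
Qed.

End rate.

(** * Gaussian tails *)

Section normal_density.
Context {R : realType}.
Local Notation leb := (@lebesgue_measure R).
Variables (m s : R).
Hypothesis s_gt0 : 0 < s.

Let nu : probability _ R := normal_prob m s.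
Let p : R -> R := normal_pdf m s.

Let mp : measurable_fun setT p.
Proof. exact: measurable_normal_pdf. Qed.

Lemma integral_normal_prob (f : R -> \bar R) : measurable_fun setT f ->
  (\int[nu]_x `|f x| < +oo -> \int[nu]_x f x = \int[leb]_x (f x * (p x)%:E))%E.
Proof.
move=> mf finf; have dom : nu `<< leb by exact: normal_prob_dominates.
rewrite -(Radon_Nikodym_change_of_variables dom)//=; last by apply/integrableP; split.
apply: ae_eq_integral => //.
- exact: emeasurable_funM.
- by apply: emeasurable_funM => //; exact/measurable_EFinP.
apply: ae_eqe_mul2l; apply: integral_ae_eq => //=.
- exact: Radon_Nikodym_integrable.
- exact/measurable_EFinP.
- by move=> E _ mE; rewrite -Radon_Nikodym_integral.
Qed.

Let pE x : p x = normal_peak s * expR (- (x - m) ^+ 2 / (s ^+ 2 * 2)).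
Proof. by rewrite /p normal_pdfE ?gt_eqF//= /normal_fun mulr_natr. Qed.

Let p0 x : 0 <= p x.
Proof. exact: normal_pdf_ge0. Qed.

Let ip : leb.-integrable setT (EFin \o p).
Proof. exact: integrable_normal_pdf. Qed.

Let p1 : \int[leb]_x p x = 1.
Proof. by rewrite /Rintegral integral_normal_pdf. Qed.

Let s2 : 0 < s ^+ 2.
Proof. by rewrite exprn_gt0. Qed.

Let p_ratio x y : p y = p x * expR (((x - m) ^+ 2 - (y - m) ^+ 2) / (s ^+ 2 * 2)).
Proof.
rewrite !pE -[RHS]mulrA -expRD; congr (_ * expR _); field.
by rewrite gt_eqF.
Qed.

(** exp r >= 1 + r compares the density with each of its affine images. *)
Let p_compare x y : p x * (1 + ((x - m) ^+ 2 - (y - m) ^+ 2) / (s ^+ 2 * 2)) <= p y.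
Proof. by rewrite (p_ratio x y) ler_wpM2l// expR_ge1Dx. Qed.

(** Comparing the density with its translate by its own centred mean M, whose
    integral is 1 as well, yields 1 + M^2 / (2 s^2) <= 1. *)
Lemma normal_mean : leb.-integrable setT (EFin \o (fun x => (x - m) * p x)) ->
  \int[leb]_x ((x - m) * p x) = 0.
Proof.
move=> i1; set M := \int[leb]_x _.
have i0 : leb.-integrable setT (EFin \o (fun x => p (1 * x + - M))).
  exact: (@integrable_affine _ 1 (- M) ltr01 p ip).
have e x : p x * (1 + ((x - m) ^+ 2 - (1 * x + - M - m) ^+ 2) / (s ^+ 2 * 2)) =
    (1 - M ^+ 2 / (s ^+ 2 * 2)) * p x + (M / s ^+ 2) * ((x - m) * p x).
  by field; rewrite gt_eqF.
have ic1 : leb.-integrable setT (EFin \o (fun x => (1 - M ^+ 2 / (s ^+ 2 * 2)) * p x)).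
  exact: (@integrable_mulr _ _ _ leb).
have ic2 : leb.-integrable setT (EFin \o (fun x => (M / s ^+ 2) * ((x - m) * p x))).
  exact: (@integrable_mulr _ _ _ leb).
have : \int[leb]_x ((1 - M ^+ 2 / (s ^+ 2 * 2)) * p x + (M / s ^+ 2) * ((x - m) * p x)) <=
    \int[leb]_x p (1 * x + - M).
  apply: le_Rintegral => //; first exact: (@integrable_add _ _ _ leb).
  by move=> x _; rewrite -e p_compare.
rewrite RintegralD// !RintegralZl// (@Rintegral_affine _ 1 (- M) ltr01 p ip) p1 -/M !mulr1 invr1.
have -> : 1 - M ^+ 2 / (s ^+ 2 * 2) + M / s ^+ 2 * M = 1 + M ^+ 2 / (s ^+ 2 * 2).
  by field; rewrite gt_eqF.
rewrite gerDl pmulr_lle0 ?invr_gt0 ?mulr_gt0// => M0.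
by apply/eqP; rewrite -sqrf_eq0 eq_le M0 sqr_ge0.
Qed.

(** Compare the density with its dilates about m by factors a > 1, and let a
    tend to 1. *)
Lemma normal_variance : leb.-integrable setT (EFin \o (fun x => (x - m) ^+ 2 * p x)) ->
  s ^+ 2 <= \int[leb]_x ((x - m) ^+ 2 * p x).
Proof.
move=> i2; set M := \int[leb]_x _.
have M0 : 0 <= M by apply: Rintegral_ge0 => x _; rewrite mulr_ge0// sqr_ge0.
have key a : 1 < a -> 2 * s ^+ 2 <= M * (a * (1 + a)).
  move=> a1; have a0 : 0 < a by exact: lt_trans a1.
  have i0 : leb.-integrable setT (EFin \o (fun x => p (a * x + (m - a * m)))).
    exact: (@integrable_affine _ a (m - a * m) a0 p ip).
  have e x : p x * (1 + ((x - m) ^+ 2 - (a * x + (m - a * m) - m) ^+ 2) / (s ^+ 2 * 2)) =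
      p x + ((1 - a ^+ 2) / (s ^+ 2 * 2)) * ((x - m) ^+ 2 * p x).
    by field; rewrite gt_eqF.
  have ic : leb.-integrable setT (EFin \o (fun x => ((1 - a ^+ 2) / (s ^+ 2 * 2)) * ((x - m) ^+ 2 * p x))).
    exact: (@integrable_mulr _ _ _ leb).
  have : \int[leb]_x (p x + ((1 - a ^+ 2) / (s ^+ 2 * 2)) * ((x - m) ^+ 2 * p x)) <=
      \int[leb]_x p (a * x + (m - a * m)).
    apply: le_Rintegral => //; first exact: (@integrable_add _ _ _ leb).
    by move=> x _; rewrite -e p_compare.
  rewrite RintegralD// RintegralZl// (@Rintegral_affine _ a (m - a * m) a0 p ip) p1 -/M mulr1.
  rewrite -subr_ge0 (_ : _ - _ = (a - 1) / (2 * s ^+ 2 * a) * (M * (a * (1 + a)) - 2 * s ^+ 2)); last first.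
    by field; rewrite !gt_eqF.
  rewrite pmulr_rge0 ?subr_ge0// divr_gt0 ?subr_gt0// !mulr_gt0//.
rewrite leNgt; apply/negP => Ms.
pose e := (s ^+ 2 - M) / (4 * s ^+ 2).
have e0 : 0 < e by rewrite divr_gt0 ?subr_gt0// mulr_gt0.
have ME : M = s ^+ 2 * (1 - 4 * e) by rewrite /e; field; rewrite gt_eqF.
have := key (1 + e); rewrite ltrDl => /(_ e0); rewrite ME.
have -> : s ^+ 2 * (1 - 4 * e) * ((1 + e) * (1 + (1 + e))) =
  s ^+ 2 * ((1 - 4 * e) * ((1 + e) * (2 + e))) by ring.
by rewrite [2 * _]mulrC ler_pM2l//; nra.
Qed.

(** The Gaussian tail bound without a constant: translating a half line to the
    origin gains the factor exp (- t^2 / 2). *)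
Lemma normal_tail t : m = 0 -> s <= 1 -> 0 <= t ->
  (nu [set x | (t < `|x|)%R] <= (expR (- t ^+ 2 / 2))%:E)%E.
Proof.
move=> m0 s1 t0; set A := [set x | _].
have mA : measurable A.
  rewrite [A](_ : _ = (fun x : R => `|x|) @^-1` `]t, +oo[%classic).
    by rewrite -[X in measurable X]setTI; apply: measurableT_comp => //; exact: measurable_itv.
  by apply/seteqP; split => x /=; rewrite in_itv/= andbT.
pose E : R := expR (- t ^+ 2 / 2).
pose f (b : bool) u x : R := (u < (-1) ^+ b * x)%R%:R * p x.
have if_ b u : leb.-integrable setT (EFin \o f b u).
  apply: (@integrable_mulbd _ _ _ leb _ _ _ 1) => //; last by move=> x _; rewrite normr_nat lern1 leq_b1.
  rewrite (_ : (fun x => _) = (fun x => if u < (-1) ^+ b * x then 1 else 0)).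
    by apply: measurable_fun_ifT => //; exact: measurable_fun_ltr.
  by apply/funext => x; case: ifP.
have half b : \int[leb]_x f b t x <= E * \int[leb]_x f b 0 x.
  pose c : R := (-1) ^+ b; have c2 : c * c = 1 by rewrite -expr2 sqrr_sign.
  have -> : \int[leb]_x f b t x = \int[leb]_x f b t (1 * x + c * t).
    by rewrite (@Rintegral_affine _ 1 (c * t) ltr01 _ (if_ b t)) invr1 mul1r.
  rewrite -RintegralZl//; apply: le_Rintegral => //.
  - exact: (@integrable_affine _ 1 (c * t) ltr01 _ (if_ b t)).
  - exact: (@integrable_mulr _ _ _ leb).
  move=> x _; have cE : c * (x + c * t) = c * x + t by rewrite mulrDr mulrA c2 mul1r.
  rewrite /f -/c mul1r cE ltrDr.
  case: ltP => cx; last by rewrite !mul0r mulr0.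
  rewrite !mul1r (p_ratio x) mulrC ler_wpM2r// ler_expR m0 !subr0.
  rewrite ler_pdivrMr ?mulr_gt0// [X in _ <= X]mulrC.
  have -> : s ^+ 2 * 2 * (- t ^+ 2 / 2) = - (s ^+ 2 * t ^+ 2) by field.
  have -> : x ^+ 2 - (x + c * t) ^+ 2 = - (2 * t * (c * x)) - (c * c) * t ^+ 2 by ring.
  rewrite c2 mul1r -opprD lerN2.
  have : s ^+ 2 * t ^+ 2 <= t ^+ 2 by rewrite ler_piMl ?sqr_ge0// exprn_ile1// ltW.
  have : 0 <= 2 * t * (c * x) by apply: mulr_ge0; [rewrite mulr_ge0 | exact: ltW].
  lra.
have A1 x : \1_A x * p x = f false t x + f true t x.
  rewrite /f expr0 expr1 mul1r mulN1r -mulrDl indicE; congr (_ * _).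
  have -> : (x \in A) = (t < `|x|) by apply/idP/idP; rewrite inE.
  case: (ger0P x) => x0.
    have -> : (t < - x) = false by apply/negbTE; rewrite -leNgt; lra.
    by rewrite addr0.
  have -> : (t < x) = false by apply/negbTE; rewrite -leNgt; lra.
  by rewrite add0r.
have iA : leb.-integrable setT (EFin \o (fun x => \1_A x * p x)).
  by under eq_fun do rewrite A1; exact: (@integrable_add _ _ _ leb).
have -> : nu A = (\int[leb]_x (\1_A x * p x))%:E.
  have -> : nu A = (\int[nu]_x (\1_A x)%:E)%E by rewrite integral_indic// setIT.
  rewrite integral_normal_prob; first by rewrite /Rintegral fineK//; exact: integrable_fin_num.
    by apply/measurable_EFinP; exact: measurable_indic.
  apply: (@le_lt_trans _ _ (nu A)); last exact: le_lt_trans (probability_le1 nu mA) (ltry _).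
  under eq_integral do rewrite gee0_abs ?lee_fin//.
  by rewrite integral_indic// setIT.
rewrite lee_fin; under eq_Rintegral do rewrite A1.
rewrite RintegralD//; apply: le_trans (lerD (half false) (half true)) _.
rewrite -mulrDr -RintegralD// ler_piMr ?expR_ge0// -[X in _ <= X]p1; apply: le_Rintegral => //.
  exact: (@integrable_add _ _ _ leb).
move=> x _; rewrite /f expr0 expr1 mul1r mulN1r -mulrDl -[X in _ <= X]mul1r ler_wpM2r//.
by rewrite oppr_gt0; case: (ltgtP 0 x) => _; rewrite ?addr0 ?add0r.
Qed.

End normal_density.

Section gaussian_tail.
Local Notation leb := lebesgue_measure.
Context {R : realType} d (T : measurableType d) (P : probability T R).

(** The parameters m and s of the law are recovered from the moments: mean zero
    gives m = 0, variance one excludes the Dirac mass and gives s <= 1. *)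
Lemma standard_gaussian_tail (X : {RV P >-> R}) t : gaussian P X ->
  ('E_P[X] = 0)%E -> covariance P X X = 1%E -> 0 <= t ->
  (P [set w | (t < `|X w|)%R] <= (expR (- t ^+ 2 / 2))%:E)%E.
Proof.
move=> [m gX] EX VX t0.
have X2 : (\int[P]_w ((X w) ^+ 2)%:E = 1)%E.
  rewrite -VX unlock EX/= unlock; apply: eq_integral => w _.
  by rewrite -[RHS]/(((X w - 0) * (X w - 0))%:E) subr0 expr2.
have mX : measurable_fun setT (X : T -> R) by exact: measurable_funP.
have msq : measurable_fun setT (fun x : R => (x ^+ 2)%:E).
  by apply/measurable_EFinP; exact: measurable_funX.
have mid : measurable_fun setT (fun x : R => x%:E) by exact/measurable_EFinP.
have iX2 : P.-integrable setT (EFin \o (fun w => (X w) ^+ 2)).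
  apply/integrableP; split; first by apply/measurable_EFinP; exact: measurable_funX.
  rewrite (_ : (\int[P]_w _)%E = 1%E) ?ltry// -X2; apply: eq_integral => w _.
  by rewrite gee0_abs ?lee_fin ?sqr_ge0.
have le_sq (x : R) : `|x| <= 1 + x ^+ 2.
  by rewrite -real_normK ?num_real//; have := normr_ge0 x; nra.
have iX : P.-integrable setT (EFin \o X).
  apply: (@le_integrable_real _ _ _ P setT X (fun w => 1 + (X w) ^+ 2)) => //.
  by apply: (@integrable_add _ _ _ P) => //; exact: finite_measure_integrable_cst.
have transfer (nu : probability _ R) :
    (forall A : set (measurableTypeR R), measurable A -> P (X @^-1` A) = nu A) ->
    (\int[nu]_x (x ^+ 2)%:E = 1 /\ \int[nu]_x x%:E = 0)%E.
  move=> h; have mX' : measurable_fun setT (X : T -> measurableTypeR R) by [].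
  split.
    transitivity (\int[P]_w ((fun x : measurableTypeR R => (x ^+ 2)%:E) \o X) w)%E => //.
    rewrite -(@ge0_integral_pushforward _ _ T (measurableTypeR R) R X mX' P setT)//; last first.
      by move=> x _; rewrite lee_fin sqr_ge0.
    by apply: eq_measure_integral => A mA _; exact/esym/h.
  transitivity (\int[P]_w ((fun x : measurableTypeR R => x%:E) \o X) w)%E; last by rewrite -EX unlock.
  rewrite -(@integral_pushforward _ _ T (measurableTypeR R) R X mX' P setT)//.
  by apply: eq_measure_integral => A mA _; exact/esym/h.
case: gX => [gX|[s s0 gX]].
  have [] := transfer (\d_(m : measurableTypeR R) : probability _ R) gX; rewrite !integral_dirac// !diracT !mul1e => m2 m1.
  by move: m2; case: m1 => ->; rewrite expr0n/= => -[/eqP]; rewrite eq_sym oner_eq0.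
have [] := transfer (normal_prob m s : probability _ R) gX; pose p : R -> R := normal_pdf m s.
have p0 x : 0 <= p x by exact: normal_pdf_ge0.
have mp : measurable_fun setT p by exact: measurable_normal_pdf.
have ip : leb.-integrable setT (EFin \o p) by exact: integrable_normal_pdf.
have p1 : \int[leb]_x p x = 1 by rewrite /Rintegral integral_normal_pdf.
move=> n2 n1.
have n2p : (\int[leb]_x ((x ^+ 2) * p x)%:E = 1)%E.
  rewrite -n2 integral_normal_prob//.
  rewrite (_ : (\int[_]_x _)%E = 1%E) ?ltry// -n2; apply: eq_integral => w _.
  by rewrite gee0_abs ?lee_fin ?sqr_ge0.
have i2p : leb.-integrable setT (EFin \o (fun x => x ^+ 2 * p x)).
  apply/integrableP; split; first by apply/measurable_EFinP; apply: measurable_funM => //; exact: measurable_funX.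
  rewrite (_ : (\int[_]_w _)%E = 1%E) ?ltry// -n2p; apply: eq_integral => w _.
  by rewrite gee0_abs ?lee_fin// mulr_ge0 ?sqr_ge0.
have i1p : leb.-integrable setT (EFin \o (fun x => x * p x)).
  apply: (@le_integrable_real _ _ _ leb setT _ (fun x => p x + x ^+ 2 * p x)) => //.
  - exact: measurable_funM.
  - move=> x _; by rewrite normrM (ger0_norm (p0 x)) -[X in X + _]mul1r -mulrDl ler_wpM2r.
  - exact: (@integrable_add _ _ _ leb).
have n1p : \int[leb]_x (x * p x) = 0.
  rewrite -[RHS]/(fine 0%E) -n1 integral_normal_prob//.
  apply: (@le_lt_trans _ _ (\int[normal_prob m s]_x (1 + x ^+ 2)%:E)%E).
    apply: ge0_le_integral => //.
    - by apply: measurableT_comp.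
    - by apply/measurable_EFinP; apply: measurable_funD => //; exact: measurable_funX.
    - by move=> x _; rewrite /= lee_fin.
  under eq_integral do rewrite EFinD.
  rewrite ge0_integralD//; last by move=> x _; rewrite lee_fin sqr_ge0.
  by rewrite n2 integral_cst// mul1e lte_add_pinfty ?ltry// (le_lt_trans (probability_le1 _ _)) ?ltry.
have im : leb.-integrable setT (EFin \o (fun x => (x - m) * p x)).
  have := @integrable_subr _ _ _ leb setT _ _ measurableT i1p (@integrable_mulr _ _ _ leb setT _ m measurableT ip).
  by congr (leb.-integrable _ _); apply/funext => x /=; rewrite mulrBl.
have m0 : m = 0.
  have := normal_mean s0 im.
  rewrite (_ : (fun x => _) = (fun x => x * p x - m * p x)); last by apply/funext => x; rewrite mulrBl.
  rewrite RintegralB//; last exact: (@integrable_mulr _ _ _ leb).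
  by rewrite RintegralZl// p1 n1p sub0r mulr1 => /eqP; rewrite oppr_eq0 => /eqP.
have s1 : s <= 1.
  have := @normal_variance R m s s0; rewrite m0.
  rewrite (_ : (fun x => _) = (fun x => x ^+ 2 * p x)); last by apply/funext => x; rewrite subr0 /p m0.
  move=> /(_ i2p); rewrite {1}/Rintegral n2p /= => h.
  by rewrite -(@ler_pXn2r _ 2) ?nnegrE ?(ltW s0)// expr1n.
rewrite (_ : P _ = normal_prob m s [set x | t < `|x|]); first exact: normal_tail.
rewrite -gX//.
rewrite (_ : [set _ | _] = (fun x : R => `|x|) @^-1` `]t, +oo[%classic).
  by rewrite -[X in measurable X]setTI; apply: measurableT_comp => //; exact: measurable_itv.
by apply/seteqP; split => x /=; rewrite in_itv/= andbT.
Qed.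

End gaussian_tail.

(** * The deterministic error bound *)

Section torus_Linfty.
Context {R : realType} (d : nat).
Local Notation mu := (torus_measure d : probability _ R).
Implicit Types (f g : 'rV[R]_d -> R).

Let mu_gt0 : (0 < mu setT)%E.
Proof. by rewrite probability_setT lte01. Qed.

Lemma Linfty_ae g M : (Lq_norm +oo g <= M%:E)%E -> {ae mu, forall x, `|g x| <= M}.
Proof.
rewrite /Lq_norm unlock mu_gt0 => /ess_supP; apply: filterS => x /=.
by rewrite lee_fin.
Qed.

Lemma ae_Linfty g M : {ae mu, forall x, `|g x| <= M} -> (Lq_norm +oo g <= M%:E)%E.
Proof.
by rewrite /Lq_norm unlock mu_gt0 => h; apply/ess_supP; apply: filterS h => x /=; rewrite lee_fin.
Qed.

Lemma torus_L_measurable p g : torus_L p g -> measurable_fun setT g.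
Proof. by move=> [_]; rewrite inE => /andP[]; rewrite inE. Qed.

Lemma torus_LinftyB f g M M' : torus_L +oo%E f -> torus_L +oo%E g ->
  (Lq_norm +oo f <= M%:E)%E -> (Lq_norm +oo g <= M'%:E)%E ->
  torus_L +oo%E (f \- g) /\ (Lq_norm +oo (f \- g)%R <= (M + M')%:E)%E.
Proof.
move=> Lf Lg fM gM; have h : (Lq_norm +oo (f \- g)%R <= (M + M')%:E)%E.
  apply: ae_Linfty; apply: filterS2 (Linfty_ae fM) (Linfty_ae gM) => x fx gx.
  exact: le_trans (ler_normB _ _) (lerD fx gx).
split => //; split.
  by move=> x i; rewrite /= (Lf.1 x i) (Lg.1 x i).
rewrite inE; apply/andP; split; rewrite inE.
  by apply: measurable_funB; [exact: torus_L_measurable Lf | exact: torus_L_measurable Lg].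
exact: le_lt_trans h (ltry _).
Qed.

Lemma integrable_L2_Linfty f g : torus_L 2%:E f -> torus_L +oo%E g ->
  mu.-integrable setT (EFin \o (fun x => f x * g x)).
Proof.
move=> [_ f2] [_ g8]; apply/Lfun1_integrable; apply: Lfun2_mul_Lfun1 => //.
apply: (Lfun_subset _ _ _ _ g8) => //; first by rewrite lee_fin ler1n.
- exact: leey.
- exact: fin_num_measure.
- exact: leey.
Qed.

Lemma inner_subr (phi : 'rV[R]_d -> R) f g : torus_L 2%:E phi -> torus_L +oo%E f -> torus_L +oo%E g ->
  inner mu phi (f \- g) = inner mu phi f - inner mu phi g.
Proof.
move=> hphi hf hg; rewrite /inner -RintegralB//; last 2 first.
- exact: integrable_L2_Linfty.
- exact: integrable_L2_Linfty.
by apply: eq_Rintegral => x _; rewrite mulrBr.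
Qed.

(** Turns an essential bound into one that holds everywhere without changing any
    L^q norm. *)
Definition truncate (U : R) g x : R := if `|g x| <= U then g x else 0.

Lemma truncate_bound U g x : 0 <= U -> `|truncate U g x| <= U.
Proof. by move=> U0; rewrite /truncate; case: ifP => // _; rewrite normr0. Qed.

Lemma truncate_le U g x : `|truncate U g x| <= `|g x|.
Proof. by rewrite /truncate; case: ifP => // _; rewrite normr0. Qed.

Lemma measurable_truncate U g : measurable_fun setT g -> measurable_fun setT (truncate U g).
Proof.
move=> mg; apply: measurable_fun_ifT => //.
by apply: measurable_fun_ler => //; exact: measurableT_comp.
Qed.

Lemma Lq_truncate q U g : measurable_fun setT g -> {ae mu, forall x, `|g x| <= U} ->
  Lq_norm q%:E g = Lq_norm q%:E (truncate U g).
Proof.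
move=> mg gU; rewrite /Lq_norm unlock; congr (_ `^ _)%E.
have mp (h : 'rV[R]_d -> R) : measurable_fun setT h ->
    measurable_fun setT (fun x => (`|(EFin \o h) x| `^ q)%E).
  move=> mh; apply/measurable_EFinP; apply: (@measurableT_comp _ _ _ _ _ _ (fun t : R => t `^ q)); first exact: measurable_powR.
  exact: measurableT_comp.
apply: ae_eq_integral => //; [exact: mp | by apply: mp; exact: measurable_truncate |].
by apply: filterS gU => x gx _; rewrite /truncate/= gx.
Qed.

Lemma Lq_norm_le_Linfty q U g : 1 <= q -> 0 < U -> measurable_fun setT g ->
  {ae mu, forall x, `|g x| <= U} -> (Lq_norm q%:E g <= (2 * U)%:E)%E.
Proof.
move=> q1 U0 mg gU; rewrite (Lq_truncate q mg gU).
have mt := measurable_truncate U mg.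
apply: (Lnorm_le_power mt (fun x => truncate_bound g x (ltW U0)) q1 (lexx q) U0).
rewrite -[X in _ <= X](@Rintegral_cst1 R _ _ mu); apply: le_Rintegral => //.
- apply: (@integrable_bounded _ _ _ mu _ (U `^ q)).
    apply: (@measurableT_comp _ _ _ _ _ _ (fun t : R => t `^ q)); first exact: measurable_powR.
    exact: measurableT_comp.
  move=> x; rewrite ger0_norm ?powR_ge0// ge0_ler_powR ?nnegrE ?(ltW U0)//.
    exact: le_trans q1.
  by apply: truncate_bound; exact: ltW.
- exact: finite_measure_integrable_cst.
- move=> x _; rewrite ge0_ler_powR ?nnegrE ?(ltW U0)//; first exact: le_trans q1.
  by apply: truncate_bound; exact: ltW.
Qed.

End torus_Linfty.

Section deterministic_bound.
Context {R : realType} (d : nat).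
Local Notation mu := (torus_measure d : probability _ R).

(** Where |G| > u and |T| <= u / 2 one has |G - T| > u / 2; then Markov. *)
Lemma exceedance_bound (G T H : 'rV[R]_d -> R) (u : R) : 0 < u ->
  mu.-integrable setT (EFin \o (fun x => G x - T x)) -> measurable_fun setT H ->
  (forall x, `|T x| <= u / 2) -> (forall x, `|H x| <= `|G x|) ->
  \int[mu]_x (u < `|H x|)%R%:R <= 2 / u * \int[mu]_x `|G x - T x|.
Proof.
move=> u0 iGT mH Tu HG.
have in_ := integrable_norm iGT.
rewrite -RintegralZl//; apply: le_Rintegral => //.
- apply: (@integrable_bounded _ _ _ mu _ 1).
    rewrite (_ : (fun x => _) = (fun x => if u < `|H x| then 1 else 0)).
      by apply: measurable_fun_ifT => //; apply: measurable_fun_ltr => //; exact: measurableT_comp.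
    by apply/funext => x; case: ifP.
  by move=> x; rewrite normr_nat lern1 leq_b1.
- exact: (@integrable_mulr _ _ _ mu).
move=> x _; case: ltP => uH; last by rewrite mulr_ge0// divr_ge0// ltW.
rewrite mulrAC ler_pdivlMr// mul1r.
have := ler_normD (G x - T x) (T x); rewrite subrK.
by have := Tu x; have := HG x; lra.
Qed.

(** By the defining inequality of the dictionary the wavelet coefficients of
    G = g - f are of order ln n / sqrt n, and its total variation is at most 2 L.
    At the j-th threshold of [Lq_rate], G is compared with its projection to
    level j. *)
Lemma dictionary_Lq_bound (L q Gamma D : R) (S : nat) (phi psi : R -> R)
    (Omega : countType) (Phi : Omega -> 'rV[R]_d -> R) (On : nat -> {fset Omega}) :
  (0 < d)%N -> 0 < L -> 1 <= q -> (1 < S)%N -> 0 <= D -> regular_wavelet S phi psi ->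
  dictionary_assumption Phi phi psi On Gamma ->
  exists C : R, 0 < C /\ forall n (f g : 'rV[R]_d -> R), (2 <= n)%N -> L <= ln n%:R ->
    BV_ball L f -> BV g -> torus_L +oo%E g -> (Lq_norm +oo g <= (ln n%:R)%:E)%E ->
    (BV_seminorm g <= L%:E)%E ->
    (forall w, w \in On n -> `|inner mu (Phi w) (g \- f)| <= D * (ln n%:R / Num.sqrt n%:R)) ->
  (Lq_norm q%:E (g \- f)%R <= (C * convergence_rate d q n)%:E)%E.
Proof.
move=> d0 L0 q1 S1 D0 wave dict.
have [A [K [A0 K0 approx]]] := wavelet_approximation d0 S1 wave.
have [Cb [Cb0 besov]] := dictionary_besov dict.
pose C3 := Cb * D + 2 * Cb; have C30 : 0 <= C3 by rewrite addr_ge0 ?mulr_ge0 ?(ltW Cb0).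
(* the thresholds are at least twice the sup bounds A delta 2 ^ (d j / 2) of the
   projections *)
have a2 : 2 <= 2 * A * C3 + 2 by rewrite lerDr !mulr_ge0// ltW.
have c0 : 0 <= 2 * K * (L + L) by rewrite !mulr_ge0 ?addr_ge0 ?(ltW L0) ?(ltW K0).
have [K' [K'0 rate]] := Lq_rate d0 q1 a2 c0.
exists K'; split => // n f g n2 Ln [[f1 fBV] f8 fL fTV] [g1 gBV] g8 gL gTV coef.
pose l : R := ln n%:R; have l0 : 0 < l by exact: ln_nat_gt0.
have sn0 : 0 < Num.sqrt n%:R :> R by rewrite sqrtr_gt0 ltr0n; exact: leq_trans n2.
pose G := g \- f.
have [G8 GU] := torus_LinftyB g8 f8 gL fL.
have aeG : {ae mu, forall x, `|G x| <= 2 * l}.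
  by apply: filterS (Linfty_ae GU) => x h; apply: le_trans h _; rewrite mulr2n mulrDl !mul1r lerD2l.
have mG : measurable_fun setT G := torus_L_measurable G8.
have ig : mu.-integrable setT (EFin \o g) by apply/Lfun1_integrable; exact: g1.2.
have if_ : mu.-integrable setT (EFin \o f) by apply/Lfun1_integrable; exact: f1.2.
have iG : mu.-integrable setT (EFin \o G) by exact: (@integrable_subr _ _ _ mu).
have TVG : tested_variation G (L + L).
  exact: tested_variationB ig if_ (BV_tested_variation ig gTV) (BV_tested_variation if_ fTV).
pose delta := C3 * (l / Num.sqrt n%:R).
have Gdelta : (besov_norm phi psi G <= delta%:E)%E.
  apply: le_trans (besov n n2 G G8) _.
  apply: (@le_trans _ _ ((Cb * (D * (l / Num.sqrt n%:R)))%:E + (Cb / Num.sqrt n%:R)%:E * (2 * l)%:E)%E).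
    apply: leeD.
      rewrite lee_fin ler_wpM2l ?(ltW Cb0)// big_seq; apply: bigmax_le => [|w wn].
        by rewrite mulr_ge0// divr_ge0// ltW.
      exact: coef.
    by apply: lee_wpmul2l; [rewrite lee_fin divr_ge0// ltW | exact: ae_Linfty].
  rewrite -EFinM -EFinD lee_fin /delta /C3; apply: eq_ler; field.
  by rewrite gt_eqF.
rewrite (Lq_truncate q mG aeG); apply: rate => //.
- exact: measurable_truncate.
- by move=> x; apply: truncate_bound; rewrite mulr_ge0// ltW.
move=> j /=; set u := _ * _ ^+ j.
have rj0 : 0 < (Num.sqrt 2 ^+ d) ^+ j :> R by rewrite !exprn_gt0// sqrtr_gt0.
have u0 : 0 < u.
  by rewrite mulr_gt0// mulr_gt0 ?divr_gt0//; apply: lt_le_trans a2.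
have LL : 0 <= L + L by rewrite addr_ge0 ?ltW.
have [T [iT TA GT]] := approx G (L + L) delta j iG LL TVG Gdelta.
have iGT : mu.-integrable setT (EFin \o (fun x => G x - T x)) by exact: (@integrable_subr _ _ _ mu).
have Tu x : `|T x| <= u / 2.
  apply: le_trans (TA x) _; rewrite /u /delta.
  have -> : (2 * A * C3 + 2) * (ln n%:R / Num.sqrt n%:R) * (Num.sqrt 2 ^+ d) ^+ j / 2 =
    A * (C3 * (l / Num.sqrt n%:R)) * (Num.sqrt 2 ^+ d) ^+ j + (l / Num.sqrt n%:R) * (Num.sqrt 2 ^+ d) ^+ j.
    by rewrite -/l; field; rewrite gt_eqF.
  by rewrite lerDl mulr_ge0 ?(ltW rj0)// divr_ge0// ltW.
have u20 : 0 <= 2 / u by rewrite divr_ge0// ltW.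
apply: le_trans (exceedance_bound u0 iGT (measurable_truncate (2 * l) mG) Tu (truncate_le (2 * l) G)) _.
apply: le_trans (ler_wpM2l u20 GT) _.
apply: eq_ler; field.
by rewrite expf_neq0// gt_eqF.
Qed.

End deterministic_bound.

Section constants.
Context {R : realType}.

(** The threshold is of order ln n / sqrt n because the dictionary has
    polynomially many elements. *)
Lemma threshold_bound (Q : {poly R}) : exists D : R, 0 <= D /\ forall n (N : R), (2 <= n)%N ->
  0 <= N -> N <= Q.[n%:R] -> Num.sqrt (2 * ln N / n%:R) <= D * (ln n%:R / Num.sqrt n%:R).
Proof.
have l2 : 0 < ln 2 :> R by exact: (ln_nat_gt0 (leqnn 2)).
pose A := \sum_(i < size Q) `|Q`_i| + 1.
have A1 : 1 <= A by rewrite lerDr sumr_ge0.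
pose D := ln A / ln 2 + (size Q)%:R.
have D0 : 0 <= D by apply: addr_ge0 => //; apply: divr_ge0; [exact: ln_ge0 | exact: ltW].
exists ((ln 2)^-1 + 2 * D); split; first by rewrite addr_ge0 ?mulr_ge0// invr_ge0 ltW.
move=> n N n2 N0 NQ.
have n0 : 0 < n%:R :> R by rewrite ltr0n; exact: leq_trans n2.
have n1 : 1 <= n%:R :> R by rewrite ler1n; exact: leq_trans n2.
have l0 : 0 < ln n%:R :> R by exact: ln_nat_gt0.
have sn0 : 0 < Num.sqrt n%:R :> R by rewrite sqrtr_gt0.
have NA : N <= A * n%:R ^+ size Q.
  apply: le_trans NQ _; rewrite horner_coef mulrDl mul1r mulr_suml.
  apply: le_trans (ler_norm _) _; apply: le_trans (ler_norm_sum _ _ _) _.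
  apply: (@le_trans _ _ (\sum_(i < size Q) `|Q`_i| * n%:R ^+ size Q)); last by rewrite lerDl exprn_ge0// ltW.
  apply: ler_sum => i _; rewrite normrM normrX (gtr0_norm n0) ler_wpM2l//.
  by rewrite ler_weXn2l// ltnW.
have lnN : ln N <= D * ln n%:R.
  have [N00|Np] := leP N 0.
    apply: (@le_trans _ _ 0); first by rewrite ln_le0//; lra.
    by rewrite mulr_ge0// ltW.
  have Ap : 0 < A by exact: lt_le_trans A1.
  apply: (@le_trans _ _ (ln (A * n%:R ^+ size Q))).
    by rewrite ler_ln ?posrE// mulr_gt0// exprn_gt0.
  rewrite lnM ?posrE ?exprn_gt0// lnXn// -[_ *+ size Q]mulr_natl mulrDl lerD2r.
  rewrite mulrAC ler_pdivlMr// ler_wpM2l ?ln_ge0//; exact: ln2_le_ln.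
apply: (@le_trans _ _ (Num.sqrt ((((ln 2)^-1 + 2 * D) * (ln n%:R / Num.sqrt n%:R)) ^+ 2))); last first.
  rewrite sqrtr_sqr ger0_norm// mulr_ge0 ?divr_ge0 ?(ltW l0)//.
  by rewrite addr_ge0 ?mulr_ge0// invr_ge0 ltW.
rewrite ler_wsqrtr// mulrA expr_div_n sqr_sqrtr ?(ltW n0)// ler_wpM2r ?invr_ge0 ?(ltW n0)//.
apply: (@le_trans _ _ (2 * (D * ln n%:R))); first by rewrite ler_wpM2l.
have -> : ((ln 2)^-1 + 2 * D) * ln n%:R = (ln 2)^-1 * ln n%:R + 2 * (D * ln n%:R) by ring.
have y1 : 1 <= (ln 2)^-1 * ln n%:R :> R.
  by rewrite ler_pdivlMl// mulr1; exact: ln2_le_ln.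
have z0 : 0 <= D * ln n%:R by rewrite mulr_ge0// ltW.
move: y1 z0; move: (_^-1 * _) (D * _) => y z y1 z0.
nra.
Qed.

End constants.

(** * The noise event and the estimator *)

Section noise_event.
Context {R : realType} (d : nat) d0 (T : measurableType d0) (P : probability T R).
Local Notation mu := (torus_measure d : probability _ R).

Lemma measure_bigsetU_le (I : Type) (s : seq I) (B : I -> set T) (b : R) :
  (forall i, measurable (B i)) -> (forall i, (P (B i) <= b%:E)%E) ->
  measurable (\big[setU/set0]_(i <- s) B i) /\
  (P (\big[setU/set0]_(i <- s) B i) <= ((size s)%:R * b)%:E)%E.
Proof.
move=> mB PB; elim: s => [|i s [mU IHs]].
  by rewrite big_nil measure0 mul0r; split.
rewrite big_cons; split; first exact: measurableU.
apply: le_trans (measureU2 _ (mB i) mU) _.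
by rewrite /= -[(size s).+1]add1n natrD mulrDl mul1r EFinD; apply: leeD.
Qed.

Lemma inner_normalized (f : 'rV[R]_d -> R) : Lq_norm 2%:E f = 1%E -> inner mu f f = 1.
Proof.
move=> f1; have := @powR_Lnorm _ _ _ mu (EFin \o f) 2.
rewrite -[Lnorm _ _ _]/(Lq_norm 2%:E f) f1 poweR1r => /(_ _) h.
rewrite /inner /Rintegral -[RHS]/(fine 1%E) h ?gt_eqF//; congr fine.
apply: eq_integral => x _ /=.
by rewrite -[2]/(2%:R) powR_mulrn// real_normK ?num_real// expr2.
Qed.

(** Union bound: each of the N normalised coefficients exceeds
    kappa sqrt (2 ln N) with probability at most N^(- kappa^2). *)
Lemma noise_event (Omega : countType) (Phi : Omega -> 'rV[R]_d -> R)
    (W : ('rV[R]_d -> R) -> {RV P >-> R}) (A : {fset Omega}) (kappa : R) :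
  white_noise W -> (forall w, torus_L 2%:E (Phi w)) -> (forall w, Lq_norm 2%:E (Phi w) = 1%E) ->
  (0 < #|` A|)%N -> 0 <= kappa ->
  exists bad : set T, [/\ measurable bad,
    (P bad <= ((#|` A|%:R : R) `^ (1 - kappa ^+ 2))%:E)%E &
    forall t, ~ bad t -> forall w, w \in A ->
      `|W (Phi w) t| <= kappa * Num.sqrt (2 * ln #|` A|%:R)].
Proof.
move=> [gW EW covW] Phi2 Phi1 A0 k0.
pose N : R := #|` A|%:R; have N1 : 1 <= N by rewrite ler1n.
have N0 : 0 < N by exact: lt_le_trans N1.
pose t := kappa * Num.sqrt (2 * ln N).
have t0 : 0 <= t by rewrite mulr_ge0.
pose B w := [set u | (t < `|W (Phi w) u|)%R].
have mB w : measurable (B w).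
  rewrite [B w](_ : _ = (fun u => `|W (Phi w) u|) @^-1` `]t, +oo[%classic).
    have mW : measurable_fun setT (fun u => `|W (Phi w) u|) by exact: measurableT_comp.
    by rewrite -[X in measurable X]setTI; apply: mW => //; exact: measurable_itv.
  by apply/seteqP; split => x /=; rewrite in_itv/= andbT.
have tail : expR (- t ^+ 2 / 2) = N `^ (- kappa ^+ 2).
  rewrite /powR gt_eqF//; congr expR; rewrite /t exprMn sqr_sqrtr; last by rewrite mulr_ge0// ln_ge0.
  by field.
have PB w : (P (B w) <= (N `^ (- kappa ^+ 2))%:E)%E.
  rewrite -tail; apply: standard_gaussian_tail => //.
  - have := gW 1%N (fun=> 1) (fun=> Phi w) (fun=> Phi2 w); congr gaussian.
    by apply/funext => u; rewrite big_ord1 mul1r.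
  - exact: EW.
  - by rewrite covW// inner_normalized.
have [mU PU] := measure_bigsetU_le (enum_fset A) mB PB.
exists (\big[setU/set0]_(w <- enum_fset A) B w); split => //.
  apply: le_trans PU _; rewrite lee_fin -/N.
  by rewrite addrC powRD ?powRr1 ?(ltW N0)// 1?mulrC// (gt_eqF N0) implybT.
move=> u nB w wA; rewrite leNgt; apply/negP => h; apply: nB.
by rewrite -bigcup_seq; exists w.
Qed.

End noise_event.

Section estimator.
Context {R : realType} (d : nat).
Local Notation mu := (torus_measure d : probability _ R).
Variables (Omega : countType) (Phi : Omega -> 'rV[R]_d -> R) (A : {fset Omega}).
Variables (M gamma : R) (y : Omega -> R) (g : 'rV[R]_d -> R).
Hypothesis sol : TV_solution Phi A M gamma y g.

(** This covers the zero function returned when nothing is feasible. *)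
Lemma TV_solution_Linfty : 0 <= M -> torus_L +oo%E g /\ (Lq_norm +oo g <= M%:E)%E.
Proof.
move=> M0; have [h1 h2] := sol.
have [ne|] := pselect (feasible Phi A M gamma y !=set0); first by have [[]] := h1 ne.
move=> /set0P/negP; rewrite negbK => /eqP/h2 ->.
have n0 : (Lq_norm +oo (cst 0%R : 'rV[R]_d -> R) <= 0%:E)%E.
  by apply: ae_Linfty; apply: aeW => x; rewrite normr0.
split; last by apply: le_trans n0 _; rewrite lee_fin.
split => //; rewrite inE; apply/andP; split; rewrite inE; first exact: measurable_cst.
exact: le_lt_trans n0 (ltry _).
Qed.

(** If the noise is below the threshold, the truth is feasible, hence the
    solution is feasible and at most as rough as the truth. *)
Lemma TV_solution_feasible (f : 'rV[R]_d -> R) (L : R) :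
  BV_ball L f -> L <= M -> 0 <= gamma ->
  (forall w, w \in A -> `|inner mu (Phi w) f - y w| <= gamma) ->
  [/\ BV g, (BV_seminorm g <= L%:E)%E &
      forall w, w \in A -> `|inner mu (Phi w) g - y w| <= gamma].
Proof.
move=> [fBV f8 fL fTV] LM g0 fy.
have feas : feasible Phi A M gamma y f.
  split => //; first by apply: le_trans fL _; rewrite lee_fin.
  by rewrite big_seq; apply: bigmax_le => // w wA; exact: fy.
have [[gBV g8 gM gc] gmin] := sol.1 (ex_intro _ f feas).
split => //; first exact: le_trans (gmin f feas) fTV.
move=> w wA; apply: le_trans gc.
exact: (@Order.TotalTheory.le_bigmax_seq _ _ _ (enum_fset A) 0 w xpredT
  (fun w => `|inner mu (Phi w) g - y w|) wA isT).
Qed.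

End estimator.

Theorem theorem1 (R : realType) (d : nat) (L q sigma kappa Gamma : R)
    (S : nat) (phi psi : R -> R)
    (Omega : countType) (Phi : Omega -> 'rV[R]_d -> R)
    (On : nat -> {fset Omega})
    (d0 : measure_display) (T : measurableType d0) (P : probability T R)
    (W : ('rV[R]_d -> R) -> {RV P >-> R})
    (d_gt0 : (0 < d)%N) (L_gt0 : 0 < L) (q_ge1 : 1 <= q)
    (sigma_gt0 : 0 < sigma) (kappa_gt1 : 1 < kappa)
    (S_gt : Num.max 1 (d%:R / 2) < S%:R :> R)
    (wave : regular_wavelet S phi psi)
    (dict : dictionary_assumption Phi phi psi On Gamma)
    (noise : white_noise W) :
  let card_n (n : nat) : R := #|` On n|%:R in
  let gamma_n (n : nat) : R :=
    kappa * sigma * Num.sqrt (2 * ln (card_n n) / n%:R) in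
  let Y (n : nat) (f : 'rV[R]_d -> R) (t : T) (w : Omega) : R :=
    inner (torus_measure d) (Phi w) f
      + sigma / Num.sqrt n%:R * W (Phi w) t in
  let estimator (n : nat) (fhat : (Omega -> R) -> 'rV[R]_d -> R) : Prop :=
    TV_estimator Phi (On n) (ln n%:R) (gamma_n n) fhat in
  (exists C : R, 0 < C /\
     forall n : nat, expR L <= n%:R ->
     forall fhat, estimator n fhat ->
     exists A : set T,
       [/\ measurable A,
           ((1 - card_n n `^ (1 - kappa ^+ 2))%:E <= P A)%E &
           forall t, A t ->
             (ereal_sup [set Lq_norm q%:E (fhat (Y n f t) \- f)%R |
                           f in BV_ball L]
              <= (C * convergence_rate d q n)%:E)%E])
  /\
  (1 + ((d.+2)%:R * Gamma)^-1 < kappa ^+ 2 ->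
   exists C : R, 0 < C /\
     \forall n \near \oo,
     forall fhat, estimator n fhat ->
       (ereal_sup [set outer_expectation P
                         (fun t => Lq_norm q%:E (fhat (Y n f t) \- f)%R) |
                     f in BV_ball L]
        <= (C * convergence_rate d q n)%:E)%E).
Proof.
move=> card_n gamma_n Y estimator.
have S1 : (1 < S)%N by rewrite -(@ltr1n R); apply: le_lt_trans S_gt; rewrite le_max lexx.
have k0 : 0 <= kappa by exact: le_trans (ltW kappa_gt1).
have [Q [c [c0 hcard]]] := dictionary_card dict.
have [D1 [D10 hD1]] := threshold_bound Q.
have D0 : 0 <= 2 * (kappa * sigma * D1) by rewrite !mulr_ge0// ltW.
have [C [C0 hC]] := dictionary_Lq_bound d_gt0 L_gt0 q_ge1 S1 D0 wave dict.
have cardp n : (2 <= n)%N -> (0 < #|` On n|)%N.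
  move=> n2; rewrite -(@ltr0n R); have /andP[+ _] := hcard n n2; apply: lt_le_trans.
  by rewrite mulr_gt0// powR_gt0// ltr0n; exact: leq_trans n2.
have ln_card n : (2 <= n)%N -> 0 <= ln (card_n n) by move=> n2; rewrite ln_ge0// ler1n cardp.
have gammaE n : (2 <= n)%N ->
    gamma_n n = sigma / Num.sqrt n%:R * (kappa * Num.sqrt (2 * ln (card_n n))).
  move=> n2; rewrite /gamma_n sqrtrM ?mulr_ge0 ?ln_card// sqrtrV//.
  by rewrite mulrA -mulrA [Num.sqrt _ * _]mulrC; ring.
have n_ge2 n : expR L <= n%:R -> (2 <= n)%N.
  move=> Ln; rewrite -(@ltr1n R); apply: lt_le_trans Ln.
  by rewrite -expR0 ltr_expR.
have ln_geL n : expR L <= n%:R -> L <= ln n%:R.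
  move=> Ln; rewrite -[X in X <= _](expRK L) ler_ln ?posrE ?expR_gt0//.
  exact: lt_le_trans (expR_gt0 _) Ln.
(* on the noise event the coefficients of the error are at most 2 gamma_n: both
   f and the estimate are within gamma_n of the data *)
have good n fhat f t : expR L <= n%:R -> estimator n fhat -> BV_ball L f ->
    (forall w, w \in On n -> `|W (Phi w) t| <= kappa * Num.sqrt (2 * ln (card_n n))) ->
    (Lq_norm q%:E (fhat (Y n f t) \- f)%R <= (C * convergence_rate d q n)%:E)%E.
  move=> Ln est ball hW; have n2 := n_ge2 n Ln; have LN := ln_geL n Ln.
  have sol := est (Y n f t); set g := fhat _ in sol *.
  have sn0 : 0 <= sigma / Num.sqrt n%:R by rewrite divr_ge0// ltW.
  have gam0 : 0 <= gamma_n n by rewrite gammaE//; apply: mulr_ge0 => //; exact: mulr_ge0.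
  have gamD : gamma_n n <= kappa * sigma * D1 * (ln n%:R / Num.sqrt n%:R).
    rewrite -mulrA; apply: ler_wpM2l; first by rewrite mulr_ge0// ltW.
    by have /andP[_ hQ] := hcard n n2; exact: hD1.
  have fY w : w \in On n -> `|inner (torus_measure d) (Phi w) f - Y n f t w| <= gamma_n n.
    move=> wn; rewrite /Y opprD addrA subrr add0r normrN normrM ger0_norm// gammaE//.
    by rewrite ler_wpM2l// hW.
  have [g8 gL] := TV_solution_Linfty sol (le_trans (ltW L_gt0) LN).
  have [gBV gTV gY] := TV_solution_feasible sol ball LN gam0 fY.
  apply: hC => // w wn; have [_ f8 _ _] := ball.
  rewrite inner_subr//; last exact: dictionary_L2 dict w.
  apply: (@le_trans _ _ (gamma_n n + gamma_n n)).
    rewrite -(subrK (Y n f t w) (inner _ (Phi w) g)) -addrA.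
    apply: le_trans (ler_normD _ _) _; rewrite lerD ?gY// distrC; exact: fY.
  apply: le_trans (lerD gamD gamD) _.
  by apply: eq_ler; ring.
split.
  exists C; split => // n Ln fhat est; have n2 := n_ge2 n Ln.
  have [bad [mbad Pbad hbad]] := noise_event noise (dictionary_L2 dict)
    (dictionary_normalized dict) (cardp n n2) k0.
  exists (~` bad); split; first exact: measurableC.
    by rewrite probability_setC// EFinB; apply: leeB.
  move=> t nb; apply: ge_ereal_sup => _ [f ball <-].
  by apply: good => // w wn; exact: hbad.
move=> kG.
(* on the bad event the loss is at most 4 ln n, both functions being essentially
   bounded by ln n *)
pose C' := C + 4 * (c `^ (1 - kappa ^+ 2) * (1 + (ln 2)^-1)).
have l2 : 0 < ln 2 :> R by exact: (ln_nat_gt0 (leqnn 2)).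
exists C'; split.
  by rewrite ltr_pwDl// !mulr_ge0 ?powR_ge0// addr_ge0// invr_ge0 ltW.
exists (Num.bound (expR L)) => // n /= Nn fhat est.
have Ln : expR L <= n%:R.
  apply: (@le_trans _ _ (Num.bound (expR L))%:R); last by rewrite ler_nat.
  by rewrite ltW// archi_boundP// expR_ge0.
have n2 := n_ge2 n Ln; have LN := ln_geL n Ln.
have l0 : 0 < ln n%:R :> R by exact: ln_nat_gt0.
have [bad [mbad Pbad hbad]] := noise_event noise (dictionary_L2 dict)
  (dictionary_normalized dict) (cardp n n2) k0.
apply: ge_ereal_sup => _ [f ball <-].
pose rate := convergence_rate d q n.
have rate0 : 0 <= rate by rewrite mulr_ge0 ?powR_ge0// exprn_ge0// ltW.
pose X (t : T) : \bar R := ((C * rate)%:E + (4 * ln n%:R)%:E * (\1_bad t)%:E)%E.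
have mbad1 : measurable_fun setT (fun t => (\1_bad t)%:E : \bar R).
  by apply/measurable_EFinP; exact: measurable_indic.
have mbad4 : measurable_fun setT (fun t => (4 * ln n%:R)%:E * (\1_bad t)%:E : \bar R)%E.
  exact: emeasurable_funM.
have l4 : 0 <= 4 * ln n%:R :> R by rewrite mulr_ge0// ltW.
have Cr0 : 0 <= C * rate by rewrite mulr_ge0// ltW.
have iX : (\int[P]_t X t = (C * rate)%:E + (4 * ln n%:R)%:E * P bad)%E.
  rewrite /X ge0_integralD//; last by move=> t _; rewrite mule_ge0 ?lee_fin.
  rewrite integral_cst//= probability_setT mule1 ge0_integralZl//.
  by rewrite integral_indic// setIT.
apply: (@le_trans _ _ (\int[P]_t X t)%E).
  apply: ereal_inf_lbound; exists X => //; split; first exact: emeasurable_funD.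
  move=> t; have [bt|nbt] := pselect (bad t); last first.
    by rewrite /X indicE memNset// mule0 adde0; apply: good => // w wn; exact: hbad.
  rewrite /X indicE mem_set// mule1 -EFinD.
  have [_ f8 fL _] := ball.
  have [g8 gL] := TV_solution_Linfty (est (Y n f t)) (ltW l0).
  have [G8 GU] := torus_LinftyB g8 f8 gL fL.
  have l20 : 0 < 2 * ln n%:R :> R by rewrite mulr_gt0.
  apply: le_trans (Lq_norm_le_Linfty q_ge1 l20 (torus_L_measurable G8) _) _.
    apply: filterS (Linfty_ae GU) => x h; apply: le_trans h _.
    by rewrite mulr2n mulrDl !mul1r lerD2l.
  by rewrite lee_fin mulrA -natrM lerDr.
rewrite iX; apply: (@le_trans _ _ ((C * rate)%:E + (4 * ln n%:R)%:E * (card_n n `^ (1 - kappa ^+ 2))%:E)%E).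
  by apply: leeD => //; apply: lee_wpmul2l.
rewrite -EFinM -EFinD lee_fin /C' [X in _ <= X]mulrDl lerD2l.
pose m := Num.min (d.+2%:R^-1) ((d%:R * q)^-1) : R.
have n0 : 0 < n%:R :> R by rewrite ltr0n; exact: leq_trans n2.
have n1 : 1 <= n%:R :> R by rewrite ler1n; exact: leq_trans n2.
have Gamma0 := dictionary_Gamma_gt0 dict.
have k1 : 0 < kappa ^+ 2 - 1.
  by rewrite subr_gt0; apply: lt_trans kG; rewrite ltrDl invr_gt0 mulr_gt0.
(* the lower bound on kappa makes the bad event less likely than the rate *)
have mG : m <= Gamma * (kappa ^+ 2 - 1).
  apply: (@le_trans _ _ d.+2%:R^-1); first by rewrite /m ge_min lexx.
  rewrite -ler_pdivrMl// -invfM mulrC.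
  by move: kG; rewrite -ltrBrDl => /ltW; rewrite mulrC.
have card_le : card_n n `^ (1 - kappa ^+ 2) <= c `^ (1 - kappa ^+ 2) * n%:R `^ (- m).
  apply: (@le_trans _ _ ((c * n%:R `^ Gamma) `^ (1 - kappa ^+ 2))).
    rewrite -opprB !powRN lef_pV2 ?posrE ?powR_gt0 ?mulr_gt0 ?powR_gt0 ?ltr0n ?cardp//.
    rewrite ge0_ler_powR ?(ltW k1) ?nnegrE ?mulr_ge0 ?powR_ge0 ?(ltW c0)//.
    by have /andP[] := hcard n n2.
    by rewrite -(@ltr0n R).
  rewrite powRM ?(ltW c0) ?powR_ge0// ler_wpM2l ?powR_ge0// -powRrM.
  by apply: ler_powR => //; rewrite -opprB mulrN lerN2.
apply: le_trans (ler_wpM2l l4 card_le) _.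
have lp := @ln_le_power R d n d_gt0 n2.
have cm0 : 0 <= 4 * (c `^ (1 - kappa ^+ 2) * n%:R `^ (- m)) by rewrite !mulr_ge0 ?powR_ge0.
rewrite (_ : 4 * ln n%:R * _ = 4 * (c `^ (1 - kappa ^+ 2) * n%:R `^ (- m)) * ln n%:R); last by ring.
apply: le_trans (ler_wpM2l cm0 lp) _.
by apply: eq_ler; rewrite /rate /convergence_rate -/m; ring.
Qed.
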